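(* Let $1\le m\le3$. Then for every $\lambda=(\lambda_1,\dots,\lambda_m)\in\mathbb{Z}^m$, $$\overline{\mathcal{S}}\big(\mathbf{1}_{Kt_\lambda K}\big)=\mathcal{S}_{(E)}\big(\mathbf{1}_{K_{(E)}s_\lambda K_{(E)}}\big)\quad\text{in }\mathbb{C}[\mathbb{Z}^m],$$ where $K=\mathrm{GL}(m,\mathcal{O}_D)$, $K_{(E)}=\mathrm{GL}(m,\mathcal{O}_E)$, $t_\lambda=\mathrm{diag}(\varpi_D^{\lambda_1},\dots,\varpi_D^{\lambda_m})\in\mathrm{GL}(m,D)$ and $s_\lambda=\mathrm{diag}(\varpi_F^{\lambda_1},\dots,\varpi_F^{\lambda_m})\in\mathrm{GL}(m,E)$.
   Context: $F$ is a non-archimedean locally compact local field of residue characteristic $p$; $D$ is a central division algebra over $F$ of dimension $d^2$; $E\subseteq D$ is a maximal commutative subfield which is unramified of degree $d$ over $F$; $\varpi_D$ is a uniformizer of $D$ such that $\varpi_F:=\varpi_D^d$ is a uniformizer of $F$ (hence of $E$). $\mathcal{O}_D,\mathcal{O}_E$ are the rings of integers. Let $G=\mathrm{GL}(m,D)$, $G_{(E)}=\mathrm{GL}(m,E)$, $U^-$ and $U_{(E)}^-$ their subgroups of lower triangular unipotent matrices. $\mathbb{Z}^m$ is identified with the cocharacter group of the diagonal split torus; $\mathbb{C}[\mathbb{Z}^m]$ has basis $(e^\mu)_{\mu\in\mathbb{Z}^m}$. The (normalized complex) Satake transforms are, for compactly supported bi-$K$-invariant $f:G\to\mathbb{C}$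 and bi-$K_{(E)}$-invariant $f:G_{(E)}\to\mathbb{C}$, $$\overline{\mathcal{S}}(f)=\sum_{\mu}\delta_G(t_\mu)^{1/2}\Big(\sum_{u\in U^-/(U^-\cap K)}f(t_\mu u)\Big)e^\mu,\quad \mathcal{S}_{(E)}(f)=\sum_{\mu}\delta_{(E)}(s_\mu)^{1/2}\Big(\sum_{u\in U_{(E)}^-/(U_{(E)}^-\cap K_{(E)})}f(s_\mu u)\Big)e^\mu,$$ where $\delta_G(t)$ is the generalized index $[t(U^-\cap K)t^{-1}:U^-\cap K]$ and $\delta_{(E)}$ is defined in the same way with $U_{(E)}^-\cap K_{(E)}$. $\mathbf{1}_X$ is the characteristic function of $X$. *)

(* Defs.v *)
From HB Require Import structures.
From mathcomp Require Import all_boot all_order all_algebra all_field.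
From mathcomp Require Import all_classical all_reals all_analysis.
From mathcomp Require Import finmap complex.
From mathcomp Require Import -(notations) monalg.
Set Implicit Arguments.
Unset Strict Implicit.
Unset Printing Implicit Defensive.
Import Order.TTheory GRing.Theory Num.Theory.
Local Open Scope classical_set_scope.
Local Open Scope ring_scope.

Record nonarch_absval (R : realType) (F : fieldType) := NonarchAbsval {
  absval :> F -> R ;
  absval_ge0 : forall x, 0 <= absval x ;
  absval_eq0 : forall x, absval x = 0 <-> x = 0 ;
  absvalM : forall x y, absval (x * y) = absval x * absval y ;
  absvalD : forall x y, absval (x + y) <= Num.max (absval x) (absval y)
}.

(* The field F carrying the topology of the metric |x - y|. *)
Definition valued_top (R : realType) (F : fieldType) (v : nonarch_absval R F)
  : Type := F.

Section ValuedTopology.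
Context (R : realType) (F : fieldType) (v : nonarch_absval R F).

Definition vball (x : F) (e : R) : set F := [set y | v (x - y) < e].

Definition vent : set_system (F * F) := entourage_ vball.

Lemma vball_center (x : F) (e : R) : 0 < e -> vball x e x.
Proof. by move=> e0; rewrite /vball /= subrr (absval_eq0 v 0).2. Qed.

Lemma absvalN (x : F) : v (- x) = v x.
Proof.
have h1 : v 1 = 1.
  have n0 : v 1 != 0 by apply/eqP => /(absval_eq0 v 1) /eqP; rewrite oner_eq0.
  by apply: (mulfI n0); rewrite -absvalM !mulr1.
have hm1 : v (-1) = 1.
  have : v (-1) ^+ 2 == 1 by rewrite expr2 -absvalM mulrNN mulr1 h1.
  by rewrite sqrp_eq1 ?absval_ge0// => /eqP.
by rewrite -mulN1r absvalM hm1 mul1r.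
Qed.

Lemma vball_sym (x y : F) (e : R) : vball x e y -> vball y e x.
Proof. by rewrite /vball /= -absvalN opprB. Qed.

Lemma vball_triangle (x y z : F) (e1 e2 : R) :
  vball x e1 y -> vball y e2 z -> vball x (e1 + e2) z.
Proof.
rewrite /vball /= => h1 h2.
have -> : x - z = (x - y) + (y - z) by rewrite addrA subrK.
apply: le_lt_trans (absvalD _ _ _) _.
rewrite gt_max (lt_le_trans h1) ?(lt_le_trans h2)// ?lerDr ?lerDl //.
- exact: le_trans (absval_ge0 _ _) (ltW h1).
- exact: le_trans (absval_ge0 _ _) (ltW h2).
Qed.

HB.instance Definition _ := Choice.on (valued_top v).
HB.instance Definition _ :=
  hasNbhs.Build (valued_top v) (nbhs_ vent).
HB.instance Definition _ :=
  Nbhs_isPseudoMetric.Build R (valued_top v)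
    erefl vball_center vball_sym vball_triangle erefl.

End ValuedTopology.

(* F, with |.| = v, is a non-archimedean locally compact local field: v is
   nontrivial (F is not discrete) and F is locally compact for v. *)
Definition local_field (R : realType) (F : fieldType) (v : nonarch_absval R F)
  : Prop :=
  (exists2 x : F, x != 0 & v x != 1) /\
  locally_compact [set: valued_top v].

Section Rings.
Context (R : realType) (F : fieldType) (v : nonarch_absval R F).

Definition base_integers : set F := [set x | v x <= 1].

(* p%:R vanishes in the residue field, i.e. lies in the maximal ideal v x < 1. *)
Definition residue_char (p : nat) : Prop := prime p /\ v p%:R < 1.

(* Elements of the subspace A of D that are integral over the valuation ring of
   F; for A = D or A a subfield of D, this is the ring of integers of A. *)
Definition integers (D : falgType F) (A : {vspace D}) : set D :=
  [set x | x \in A /\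
     exists p : {poly F},
       [/\ p \is monic, (forall i, base_integers p`_i)
         & root (map_poly (in_alg D) p) x]].

Definition central_division_algebra (D : falgType F) : Prop :=
  (forall x : D, x != 0 -> x \is a GRing.unit) /\ 'Z({:D})%VS = 1%VS.

(* In a finite-dimensional division algebra every nonzero commutative subalgebra
   is a subfield containing F. *)
Definition maximal_commutative (D : falgType F) (E : {aspace D}) : Prop :=
  (E <= 'C(E))%VS /\
  forall E' : {aspace D}, (E' <= 'C(E'))%VS -> (E <= E')%VS -> E' = E.

End Rings.

(* w generates the maximal ideal (the set of non-units) of the local ring O. *)
Definition uniformizer (A : nzRingType) (O : set A) (w : A) : Prop :=
  let O_unit x := exists2 y, O y & x * y = 1 /\ y * x = 1 in
  [set x | O x /\ ~ O_unit x] = [set w * y | y in O].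

(* Ramification index 1; residue fields are finite, so that the residue
   extension is automatically separable. *)
Definition unramified (R : realType) (F : fieldType) (v : nonarch_absval R F)
    (D : falgType F) (E : {aspace D}) : Prop :=
  forall w : F, uniformizer (base_integers v) w ->
    uniformizer (integers v E) (w%:A : D).

Section Groups.
Context (D : unitRingType) (m : nat).
Implicit Types (A O : set D) (w : D) (mu : 'rV[int]_m) (H N : set 'M[D]_m).

(* GL(m, A) for a subring A of D, as a set of matrices over D. *)
Definition GL A : set 'M[D]_m :=
  [set g : 'M[D]_m | (forall i j, A (g i j)) /\
     exists h : 'M[D]_m,
       [/\ forall i j, A (h i j), g *m h = 1%:M & h *m g = 1%:M]].

Definition lower_unip A : set 'M[D]_m :=
  [set u : 'M[D]_m | [/\ GL A u, is_trig_mx u & forall i, u i i = 1]].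

Definition cochar w mu : 'M[D]_m := diag_mx (\row_i w ^ mu 0 i).

Definition double_coset H (t : 'M[D]_m) : set 'M[D]_m :=
  [set g : 'M[D]_m | exists2 k, H k & exists2 k', H k' & g = k *m t *m k'].

Definition left_cosets H N : set (set 'M[D]_m) :=
  [set [set u *m k | k in N] | u in H].

Definition coset_index H N : nat := #|` fset_set (left_cosets H N)|%N.

End Groups.

Arguments GL {D} m A _.
Arguments lower_unip {D} m A _.

Section Satake.
Context (R : realType) (D : unitRingType) (m : nat).
Implicit Types (A O : set D) (w : D) (mu : 'rV[int]_m).

(* Generalized index [H : N] of commensurable subgroups. *)
Definition gen_index (H N : set 'M[D]_m) : R :=
  (coset_index H (H `&` N))%:R / (coset_index N (H `&` N))%:R.

(* [t (U^- /\ K) t^-1 : U^- /\ K] for t = cochar w mu and K = GL(m, O). *)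
Definition modulus A O w mu : R :=
  let UK := lower_unip m A `&` GL m O in
  gen_index [set cochar w mu *m u *m cochar w (- mu) | u in UK] UK.

(* Sum of f(t u) over u in U^- / (U^- /\ K), for f right K-invariant: f is
   evaluated at an arbitrary representative of each coset. *)
Definition orbital_sum A O (f : 'M[D]_m -> R[i]) (t : 'M[D]_m) : R[i] :=
  let U := lower_unip m A in
  \sum_(c \in left_cosets U (U `&` GL m O)) f (t *m xget 1%:M c).

(* The Satake transform for GL(m, A), K = GL(m, O) and t_mu = cochar w mu, on
   functions that are K-bi-invariant and compactly supported; both sums then
   have finite support.  C[Z^m] is the free C-vector space on Z^m,
   and mkmalgU mu 1 is its basis element e^mu. *)
Definition satake A O w (f : 'M[D]_m -> R[i]) : malg 'rV[int]_m R[i] :=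
  \sum_(mu \in [set: 'rV[int]_m])
    (real_complex R (Num.sqrt (modulus A O w mu))
       * orbital_sum A O f (cochar w mu)) *: mkmalgU mu 1.

End Satake.

(* Main.v *)
(* Both sides count, for every mu, the cosets u (U^- /\ K) with t_mu u in K t_lambda K.  For
   m <= 3 this condition only depends on the absolute values of the entries of u and u^-1: a
   double coset K t_nu K is determined by the minimum, the maximum and the sum of nu, which are
   read off the largest entry of g, the largest entry of g^-1 and a determinant of g.

   D and E have the same residue field, so that digit expansions in varpi_D and varpi_F with common
   digits give an isometry phi from D / O_D to E / O_E.  Writing u with coordinates
   x = u_21, y = u_32, z = u_31, the absolute values of x, y, z and y x - z are to be preserved;
   mapping x and y by phi and z by phi followed by the multiplication by the unit
   phi(y) phi(x) / phi(y x) does so.  This gives a bijection of cosets, and the same bijection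
   compares the moduli.

   The absolute value of D is x |-> |det (right multiplication by x)|.  It is ultrametric by a
   compactness argument: |1 + x| is bounded for |x| <= 1, and the bound is removed by raising
   1 + x to large powers. *)
From HB Require Import structures.
Require Import Defs.
From mathcomp Require Import all_boot all_order all_algebra all_field.
From mathcomp Require Import all_classical all_reals all_analysis.
From mathcomp Require Import complex.
From mathcomp Require Import -(notations) monalg.
From mathcomp Require Import finmap fingroup perm ring zify.
Import Order.TTheory GRing.Theory Num.Theory.
Local Open Scope classical_set_scope.
Local Open Scope ring_scope.
Set Implicit Arguments.
Unset Strict Implicit.
Unset Printing Implicit Defensive.
Import VectorInternalTheory.

(** * Compactness in a local field *)

(** The isometry phi is neither additive nor multiplicative, and it controls distances only above a
    fixed level. It can therefore be used only where few products occur: up to size 3, the entries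
    of u and u^-1 involve the single product [y * x], whose image is put right by one unit factor.
    This factor depends on x and y, so the map is defined on chosen representatives of the
    coordinates and has to be checked against the coset relation by hand. The bound on m enters a
    second time through the exponents: (0, 1, 2, 3) and (0, 0, 3, 3) already share minimum, maximum
    and sum.

    The cosets are taken modulo groups given by three arbitrary radii, one for each coordinate. This
    covers the conjugates of U^- /\ K and their intersections with it, hence the moduli.

    Indices and orbital sums are transported along bijections. An infinite index or a sum with
    infinite support takes the same default value on both sides, so finiteness is never established.

    For the sum of the exponents, one determinant over F serves both groups, since matrices over E
    are treated as matrices over D. *)

HB.instance Definition _ (R : realType) (F : fieldType)
  (v : nonarch_absval R F) := isPointed.Build (valued_top v) (0 : F).

Section Absval.
Context (R : realType) (F : fieldType) (v : nonarch_absval R F).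

Lemma absval0 : v 0 = 0. Proof. exact: (absval_eq0 v 0).2. Qed.

Lemma absval_eq0b x : (v x == 0) = (x == 0).
Proof. by apply/eqP/eqP => /(absval_eq0 v). Qed.

Lemma absval_gt0 x : (0 < v x) = (x != 0).
Proof. by rewrite lt_def absval_ge0 andbT absval_eq0b. Qed.

Lemma absval1 : v 1 = 1.
Proof.
have n0 : v 1 != 0 by rewrite absval_eq0b oner_eq0.
by apply: (mulfI n0); rewrite -absvalM !mulr1.
Qed.

Lemma absvalX x k : v (x ^+ k) = v x ^+ k.
Proof. by elim: k => [|k IH]; rewrite ?expr0 ?absval1// !exprS absvalM IH. Qed.

Lemma absvalV x : v x^-1 = (v x)^-1.
Proof.
have [->|x0] := eqVneq x 0; first by rewrite invr0 absval0 invr0.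
have vx0 : v x != 0 by rewrite absval_eq0b.
by apply: (mulfI vx0); rewrite -absvalM !divff// absval1.
Qed.

Lemma absval_sum_le I (r : seq I) (P : pred I) (f : I -> F) (c : R) : 0 <= c ->
  (forall i, P i -> v (f i) <= c) -> v (\sum_(i <- r | P i) f i) <= c.
Proof.
move=> c0 h; elim/big_ind: _ => //; first by rewrite absval0.
by move=> x y hx hy; apply: le_trans (absvalD _ _ _) _; rewrite ge_max hx hy.
Qed.

Lemma absval_nat_le1 k : v k%:R <= 1.
Proof.
elim: k => [|k IH]; first by rewrite absval0.
by rewrite -natr1; apply: le_trans (absvalD _ _ _) _; rewrite ge_max IH absval1 lexx.
Qed.

Lemma absval_sub_le x y c : v x <= c -> v y <= c -> v (x - y) <= c.
Proof.
by move=> hx hy; apply: le_trans (absvalD _ _ _) _; rewrite ge_max hx absvalN hy.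
Qed.

Lemma absval_prod I (r : seq I) (P : pred I) (f : I -> F) :
  v (\prod_(i <- r | P i) f i) = \prod_(i <- r | P i) v (f i).
Proof. exact: (big_morph v (absvalM v) absval1). Qed.

Lemma absval_sign (b : nat) x : v ((-1) ^+ b * x) = v x.
Proof. by rewrite absvalM absvalX absvalN absval1 expr1n mul1r. Qed.

Lemma absval_det_le n (A : 'M[F]_n) (c : R) :
  (forall i j, v (A i j) <= c) -> v (\det A) <= c ^+ n.
Proof.
case: n A => [|n] A h; first by rewrite det_mx00 absval1 expr0.
have c0 : 0 <= c by apply: le_trans (h ord0 ord0); exact: absval_ge0.
apply: absval_sum_le => [|s _]; first exact: exprn_ge0.
rewrite absval_sign absval_prod.
apply: (@le_trans _ _ (\prod_(i < n.+1) c)).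
  by apply: ler_prod => i _; rewrite absval_ge0 h.
by rewrite prodr_const card_ord.
Qed.

(** Telescoping: the factors are exchanged one at a time, and each exchange costs [e] times a
    product of other factors. The surplus factor [c] in the bound is affordable because [1 <= c]. *)
Lemma absval_prod_sub_le n (f g : 'I_n -> F) (c e : R) : 1 <= c -> 0 <= e ->
  (forall i, v (f i) <= c) -> (forall i, v (g i) <= c) ->
  (forall i, v (f i - g i) <= e) ->
  v (\prod_i f i - \prod_i g i) <= e * c ^+ n.
Proof.
move=> c1 e0; have c0 : 0 <= c by apply: le_trans c1.
elim: n f g => [|n IH] f g hf hg hfg.
  by rewrite !big_ord0 subrr absval0 mulr_ge0 ?exprn_ge0.
rewrite !big_ord_recl /=.
set pf := \prod_(i < n) _; set pg := \prod_(i < n) _.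
have -> : f ord0 * pf - g ord0 * pg =
    f ord0 * (pf - pg) + (f ord0 - g ord0) * pg.
  by rewrite mulrBr mulrBl addrA subrK.
have hpg : v pg <= c ^+ n.
  rewrite absval_prod; apply: (@le_trans _ _ (\prod_(i < n) c)).
    by apply: ler_prod => i _; rewrite absval_ge0 hg.
  by rewrite prodr_const card_ord.
apply: le_trans (absvalD _ _ _) _; rewrite ge_max !absvalM; apply/andP; split.
  rewrite exprS mulrCA ler_pM ?absval_ge0//.
  by apply: IH => i.
rewrite ler_pM ?absval_ge0//; apply: le_trans hpg _.
by rewrite exprS ler_peMl ?exprn_ge0.
Qed.

Lemma absval_det_sub_le n (A B : 'M[F]_n) (c e : R) : 1 <= c -> 0 <= e ->
  (forall i j, v (A i j) <= c) -> (forall i j, v (B i j) <= c) ->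
  (forall i j, v (A i j - B i j) <= e) ->
  v (\det A - \det B) <= e * c ^+ n.
Proof.
move=> c1 e0 hA hB hAB; rewrite /determinant -sumrB.
apply: absval_sum_le => [|s _].
  by rewrite mulr_ge0 ?exprn_ge0//; apply: le_trans c1.
by rewrite -mulrBr absval_sign; exact: absval_prod_sub_le.
Qed.

Lemma absval_eq_sub x y : v (x - y) < v y -> v x = v y.
Proof.
move=> h; apply/eqP; rewrite eq_le; apply/andP; split.
  by rewrite -[in leLHS](subrK y x); apply: le_trans (absvalD _ _ _) _;
    rewrite ge_max lexx (ltW h).
rewrite leNgt; apply/negP => hx.
have : v y <= Num.max (v (x - y)) (v x).
  by rewrite -{1}(subrK x y) -(absvalN v (x - y)) opprB; exact: absvalD.
by rewrite leNgt gt_max h hx.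
Qed.

Section Compactness.
Hypothesis hF : local_field v.

Lemma exists_absval_lt1 : exists2 t : F, t != 0 & v t < 1.
Proof.
have [[x x0 x1] _] := hF.
case: (ltgtP (v x) 1) => [h|h|h]; last by rewrite h eqxx in x1.
  by exists x.
exists x^-1; first by rewrite invr_eq0.
by rewrite absvalV invf_lt1// absval_gt0.
Qed.

Lemma exists_absval_small (e : R) : 0 < e -> exists2 t : F, t != 0 & v t < e.
Proof.
move=> e0; have [t t0 t1] := exists_absval_lt1.
have := @cvg_expr R (v t); rewrite ger0_norm ?absval_ge0// => /(_ t1).
move=> /cvgr0Pnorm_lt /(_ e e0) [N _ /(_ N)] /= /(_ (leqnn N)).
rewrite normrX ger0_norm ?absval_ge0// => h.
by exists (t ^+ N); rewrite ?expf_neq0// absvalX.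
Qed.

Lemma closed_absval_le (c : R) : 0 < c -> closed [set x : valued_top v | v x <= c].
Proof.
move=> c0 x /(_ (vball v x c)) []; first by apply/nbhs_ballP; exists c.
move=> y /= [hy]; rewrite /vball/= => hxy.
rewrite -(subrK (y : F) x); apply: le_trans (absvalD _ _ _) _.
by rewrite ge_max hy (ltW hxy).
Qed.

Lemma compact_absval_le :
  exists2 c : R, 0 < c & compact [set x : valued_top v | v x <= c].
Proof.
have [_ lc] := hF.
have [U + [cU _]] := lc (0 : F) Logic.I.
rewrite withinET => /nbhs_ballP[e /= e0 he].
exists (e / 2); first by rewrite divr_gt0.
apply: (subclosed_compact _ cU).
  by apply: closed_absval_le; rewrite divr_gt0.
move=> x /= hx; apply: he; rewrite /ball/= /vball/= sub0r absvalN.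
by apply: le_lt_trans hx _; rewrite ltr_pdivrMr// ltr_pMr// ltr1n.
Qed.

(** Bolzano-Weierstrass: multiplication by a small scalar [s] brings the sequence into a power of
    the compact ball of [compact_absval_le]. *)
Lemma cluster_rV n (c : R) (a : nat -> 'rV[F]_n) :
  (forall k i, v (a k 0 i) <= c) ->
  exists b : 'rV[F]_n, forall (e : R) r, 0 < e ->
    exists2 k, (r <= k)%N & forall i, v (a k 0 i - b 0 i) < e.
Proof.
move=> ha; have [c0 c00 cK] := compact_absval_le.
have [s s0 hs] : exists2 s : F, s != 0 & v s * c <= c0.
  have [c1|c1] := leP c 0; first by exists 1; rewrite ?oner_eq0// absval1 mul1r (le_trans c1)// ltW.
  have [s s0 hs] := exists_absval_small (divr_gt0 c00 c1).
  by exists s => //; rewrite -ler_pdivlMr// ltW.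
pose T := valued_top v.
pose K := [set x : 'rV[T]_n | forall i, [set x : T | v x <= c0] (x ord0 i)].
have KK : compact K.
  exact: (@rV_compact T n (fun=> [set x : T | v x <= c0]) (fun=> cK)).
pose sa k : 'rV[T]_n := s *: a k.
have sK : forall k, K (sa k).
  move=> k i /=; rewrite mxE absvalM; apply: le_trans hs.
  by rewrite ler_wpM2l ?absval_ge0.
have [b [_ hb]] := KK (sa @ \oo) _ (filterE _ sK).
exists (s^-1 *: b) => e r e0.
have vs0 : 0 < v s by rewrite absval_gt0.
have := hb [set sa k | k in [set k | (r <= k)%N]] (ball b (v s * e)).
case.
- by exists r => // k /= hk; exists k.
- by apply/nbhs_ballP; exists (v s * e) => //=; exact: mulr_gt0.
move=> _ [[k /= rk <-] hk]; exists k => // i.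
have := hk.2 ord0 i; rewrite /ball /= /vball /= !mxE => h.
rewrite -(ltr_pM2l vs0) -absvalM mulrBr mulVKf//.
by rewrite -absvalN opprB.
Qed.

Lemma pigeonhole_rV n (c : R) (a : nat -> 'rV[F]_n) (r : nat) :
  (forall k i, v (a k 0 i) <= c) ->
  exists k l, (r <= k < l)%N /\ forall i, v (a l 0 i - a k 0 i) <= 1.
Proof.
move=> /cluster_rV[b hb].
have [k rk hk] := hb 1 r ltr01.
have [l kl hl] := hb 1 k.+1 ltr01.
exists k, l; split=> [|i]; first by rewrite rk kl.
have -> : a l 0 i - a k 0 i = (a l 0 i - b 0 i) - (a k 0 i - b 0 i).
  by rewrite opprB addrA subrK.
by apply: absval_sub_le; apply: ltW.
Qed.

(** A sequence in [S] along which [f] tends to 0 would cluster at a point of [S], near which [f] is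
    constant and positive. Local constancy stands in for continuity: an ultrametric absolute value
    is locally constant away from 0. *)
Lemma pos_lower_bound_rV n (i0 : 'I_n) (f : 'rV[F]_n -> R) :
  let S (a : 'rV[F]_n) := (forall i, v (a 0 i) <= 1) /\ a 0 i0 = 1 in
  (forall a, S a -> 0 < f a) ->
  (forall a, S a -> exists2 e : R, 0 < e &
     forall b, S b -> (forall i, v (b 0 i - a 0 i) < e) -> f b = f a) ->
  exists2 c : R, 0 < c & forall a, S a -> c <= f a.
Proof.
move=> S f0 flc.
apply: contrapT => hn.
have small (k : nat) : exists a, S a /\ f a < k.+1%:R^-1.
  apply: contrapT => hk; apply: hn; exists k.+1%:R^-1 => // a Sa.
  by rewrite leNgt; apply/negP => h; apply: hk; exists a.
have [a ha] := choice small.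
have [b hb] := @cluster_rV n 1 a (fun k => (ha k).1.1).
have Sb : S b.
  split=> [i|].
    have [k _ hk] := hb 1 0%N ltr01.
    rewrite -[b 0 i](subKr (a k 0 i)); apply: absval_sub_le.
      exact: (ha k).1.1.
    exact: ltW.
  apply/eqP; rewrite eq_sym -subr_eq0 -absval_eq0b eq_le absval_ge0 andbT leNgt.
  apply/negP => h; have [k _ /(_ i0)] := hb _ 0%N h.
  by rewrite (ha k).1.2 ltxx.
have [e e0 he] := flc b Sb.
have fb := f0 b Sb.
have [r hr] : exists r : nat, (r.+1%:R)^-1 <= f b.
  exists (Num.bound (f b)^-1).
  rewrite -[leRHS]invrK lef_pV2 ?posrE ?invr_gt0//.
  apply/ltW/(lt_trans (archi_boundP _)); first by rewrite invr_ge0 ltW.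
  by rewrite ltr_nat.
have [k rk hk] := hb e r e0.
have := (ha k).2; rewrite (he _ (ha k).1 hk) ltNge => /negP; apply.
by apply: le_trans hr; rewrite lef_pV2 ?posrE// ler_nat.
Qed.
End Compactness.
End Absval.

(** * The absolute value of a division algebra *)

Lemma fin_ubound (R : realType) (I : finType) (f : I -> R) :
  exists2 B : R, 1 <= B & forall i, f i <= B.
Proof.
exists (\big[Num.max/1]_i f i); first by rewrite bigmax_ge_id.
by move=> i; apply: le_bigmax.
Qed.

Section RightMultiplication.
Context (F : fieldType) (D : falgType F).
Local Notation n := (dim D).

Definition stdb (i : 'I_n) : D := r2v (delta_mx 0 i).

(** Vectors are rows, so right multiplications, not left ones, compose in the order of the product
    of [D]. *)
Definition rmulmx (x : D) : 'M[F]_n := lin1_mx (v2r \o amulr x \o r2v).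

Lemma mul_rmulmx (r : 'rV_n) x : r *m rmulmx x = v2r (r2v r * x).
Proof. by rewrite mul_rV_lin1 /= lfunE. Qed.

Lemma rmulmxE x i j : rmulmx x i j = v2r (stdb i * x) 0 j.
Proof. by rewrite -mul_rmulmx -rowE [RHS]mxE. Qed.

Lemma rmulmxM x y : rmulmx (x * y) = rmulmx x *m rmulmx y.
Proof.
apply/row_matrixP => i; rewrite !rowE mulmxA !mul_rmulmx v2rK.
by rewrite mulrA.
Qed.

Lemma rmulmxB x y : rmulmx (x - y) = rmulmx x - rmulmx y.
Proof.
apply/row_matrixP => i; rewrite linearB /= !rowE !mul_rmulmx.
by rewrite mulrBr linearB.
Qed.

Lemma rmulmx0 : rmulmx 0 = 0.
Proof. by rewrite -(subrr 0) rmulmxB subrr. Qed.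

Lemma rmulmxD x y : rmulmx (x + y) = rmulmx x + rmulmx y.
Proof. by rewrite -{1}[y]opprK -[- y]sub0r !rmulmxB rmulmx0 sub0r opprK. Qed.

Lemma rmulmxBE x y i j : rmulmx (x - y) i j = rmulmx x i j - rmulmx y i j.
Proof. by rewrite rmulmxB [LHS]mxE [X in _ + X]mxE. Qed.

Lemma rmulmx_alg (c : F) : rmulmx c%:A = c%:M.
Proof.
apply/row_matrixP => i; rewrite !rowE mul_rmulmx mul_mx_scalar.
by rewrite -scalerAr mulr1 linearZ /= r2vK.
Qed.

Lemma v2r_r2v_sum (x : D) : x = \sum_k v2r x 0 k *: stdb k.
Proof.
apply: (can_inj v2rK); rewrite linear_sum /= [LHS]row_sum_delta.
by apply: eq_bigr => k _; rewrite linearZ /= r2vK.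
Qed.

Lemma dim_falg_gt0 : (0 < n)%N.
Proof. by rewrite -dimvf; exact: adim_gt0. Qed.

End RightMultiplication.

Section Norm.
Context (R : realType) (F : fieldType) (v : nonarch_absval R F).
Context (D : falgType F).
Local Notation n := (dim D).
Local Notation stdb := (@stdb F D).

(** This restricts to the [dim D]-th power of [v] on the scalars. No root is taken, since a power of
    an absolute value serves equally well in ultrametric arguments. *)
Definition bnorm (x : D) : R := v (\det (rmulmx x)).
Local Notation N := bnorm.

Lemma bnorm_ge0 x : 0 <= N x. Proof. exact: absval_ge0. Qed.

Lemma bnormM x y : N (x * y) = N x * N y.
Proof. by rewrite /N rmulmxM det_mulmx absvalM. Qed.

Lemma bnorm_alg (c : F) : N c%:A = v c ^+ n.
Proof. by rewrite /N rmulmx_alg det_scalar absvalX. Qed.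

Lemma bnorm1 : N 1 = 1.
Proof. by rewrite -[1]scale1r bnorm_alg absval1 expr1n. Qed.

Lemma bnormN x : N (- x) = N x.
Proof.
by rewrite -mulN1r -scaleN1r bnormM bnorm_alg absvalN absval1 expr1n mul1r.
Qed.

Lemma bnorm0 : N 0 = 0.
Proof.
by rewrite -(scale0r 1) bnorm_alg absval0 expr0n; case: n (dim_falg_gt0 D).
Qed.

Lemma bnormX x k : N (x ^+ k) = N x ^+ k.
Proof. by elim: k => [|k IH]; rewrite ?expr0 ?bnorm1// !exprS bnormM IH. Qed.

Lemma v2r_functional_bounded (f : {linear D -> F^o}) :
  exists2 B : R, 1 <= B & forall x c,
    (forall i, v (v2r x 0 i) <= c) -> v (f x) <= c * B.
Proof.
have [B B1 hB] := fin_ubound (fun i => v (f (stdb i))).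
exists B => // x c hx.
have c0 : 0 <= c.
  by apply: le_trans (hx (Ordinal (dim_falg_gt0 D))); exact: absval_ge0.
rewrite (v2r_r2v_sum x) linear_sum; apply: absval_sum_le => [|i _].
  by rewrite mulr_ge0// (le_trans ler01).
by rewrite linearZ /= absvalM ler_pM ?absval_ge0.
Qed.

Lemma rmulmx_bounded :
  exists2 B : R, 1 <= B & forall (x : D) c, (forall i, v (v2r x 0 i) <= c) ->
    forall i j, v (rmulmx x i j) <= c * B.
Proof.
have [B B1 hB] := fin_ubound (fun u : 'I_n * 'I_n * 'I_n =>
  v (v2r (stdb u.1.1 * stdb u.1.2) 0 u.2)).
exists B => // x c hx i j.
have c0 : 0 <= c by apply: le_trans (hx i); exact: absval_ge0.
rewrite rmulmxE {1}(v2r_r2v_sum x) mulr_sumr linear_sum summxE.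
apply: absval_sum_le => [|k _].
  by rewrite mulr_ge0// (le_trans ler01).
rewrite -scalerAr linearZ mxE absvalM ler_pM ?absval_ge0//.
exact: (hB (i, k, j)).
Qed.

Section Division.
Hypothesis hF : local_field v.
Hypothesis hD : forall x : D, x != 0 -> x \is a GRing.unit.

Lemma bnorm_eq0 x : (N x == 0) = (x == 0).
Proof.
apply/eqP/eqP => [h|->]; last exact: bnorm0.
apply/eqP/negP => /negP x0; have /eqP := oner_neq0 R; apply.
by rewrite -bnorm1 -(mulrV (hD x0)) bnormM h mul0r.
Qed.

Lemma bnorm_gt0 x : (0 < N x) = (x != 0).
Proof. by rewrite lt_def bnorm_ge0 andbT bnorm_eq0. Qed.

Lemma bnormV x : N x^-1 = (N x)^-1.
Proof.
have [->|x0] := eqVneq x 0; first by rewrite invr0 bnorm0 invr0.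
have nx0 : N x != 0 by rewrite bnorm_eq0.
by apply: (mulfI nx0); rewrite -bnormM divrr ?hD// divff// bnorm1.
Qed.

(** Dividing [x] by its largest coordinate [t] puts it in a compact set that misses 0, on which [N]
    is at least some [c > 0]. Hence [v t ^+ n <= c^-1] whenever [N x <= 1]. *)
Lemma bnorm_coord_bounded :
  exists2 C : R, 1 <= C & forall x, N x <= 1 -> forall i, v (v2r x 0 i) <= C.
Proof.
have [B B1 hB] := rmulmx_bounded.
have B0 : 0 < B by apply: lt_le_trans B1.
have low i0 : exists2 c : R, 0 < c & forall x : D,
    (forall i, v (v2r x 0 i) <= 1) -> v2r x 0 i0 = 1 -> c <= N x.
  have [||c c0 hc] := @pos_lower_bound_rV _ _ v hF n i0 (N \o r2v).
  - move=> a [_ ai0] /=; rewrite bnorm_gt0; apply/eqP => /(congr1 v2r).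
    rewrite r2vK linear0 => /rowP/(_ i0); rewrite ai0 mxE => /eqP.
    by rewrite oner_eq0.
  - move=> a [a1 ai0] /=.
    have Na : 0 < N (r2v a).
      rewrite bnorm_gt0; apply/eqP => /(congr1 v2r).
      rewrite r2vK linear0 => /rowP/(_ i0); rewrite ai0 mxE => /eqP.
      by rewrite oner_eq0.
    (* With this radius the two determinants differ by at most half of [N (r2v a)], so the
       ultrametric inequality forces equal absolute values. *)
    exists (N (r2v a) / (2 * B * B ^+ n)).
      by rewrite divr_gt0// !mulr_gt0// exprn_gt0.
    move=> b [b1 _] hab; apply: absval_eq_sub.
    set e := _ / _ in hab.
    apply: (@le_lt_trans _ _ (e * B * B ^+ n)).
      apply: absval_det_sub_le => //.
      - by rewrite mulr_ge0 ?divr_ge0 ?bnorm_ge0// ?mulr_ge0 ?exprn_ge0 ?ltW.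
      - by move=> i j; rewrite -[leRHS]mul1r; apply: hB => k; rewrite r2vK.
      - by move=> i j; rewrite -[leRHS]mul1r; apply: hB => k; rewrite r2vK.
      - move=> i j; rewrite -rmulmxBE; apply: hB => k.
        by rewrite linearB /= !r2vK !mxE; exact: ltW.
    have -> : e * B * B ^+ n = N (r2v a) / 2.
      rewrite /e -[2 * B * _]mulrA invfM mulrA -!mulrA mulVf ?mulr1//.
      by rewrite gt_eqF// mulr_gt0 ?exprn_gt0.
    by rewrite ltr_pdivrMr// ltr_pMr// ltr1n.
  exists c => // x x1 xi0; have := hc (v2r x); rewrite /= v2rK; apply.
  by split.
have [c hc] := choice (fun i => let: ex_intro2 c c0 h := low i in ex_intro _ c (conj c0 h)).
have [C C1 hC] := fin_ubound (fun i => (c i)^-1).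
exists C => // x Nx.
have [i0 _ hi0] := @arg_maxP _ _ _ (Ordinal (dim_falg_gt0 D)) xpredT (fun i => v (v2r x 0 i)) isT.
move=> i; apply: le_trans (hi0 i isT) _ => {i}.
have [->|xi0] := eqVneq (v2r x 0 i0) 0; first by rewrite absval0 (le_trans ler01).
set t := v2r x 0 i0 in xi0 hi0 *.
have vt0 : 0 < v t by rewrite absval_gt0.
have : c i0 <= N (t^-1 *: x).
  apply: (hc i0).2 => [i|]; rewrite linearZ mxE.
    by rewrite absvalM absvalV mulrC ler_pdivrMr// mul1r; exact: hi0.
  by rewrite mulVf.
rewrite -[t^-1 *: x]mulr_algl bnormM bnorm_alg absvalV exprVn => h.
have [t1|t1] := leP (v t) 1; first exact: le_trans C1.
apply: le_trans (hC i0).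
rewrite -[leLHS]invrK lef_pV2 ?posrE ?invr_gt0 ?(hc i0).1//.
apply: le_trans h _.
apply: (@le_trans _ _ ((v t ^+ n)^-1)).
  by rewrite ler_piMr// invr_ge0 exprn_ge0// ltW.
rewrite lef_pV2 ?posrE ?exprn_gt0//.
by apply: ler_eXnr; rewrite ?dim_falg_gt0// ltW.
Qed.

Lemma bnorm_succ_bounded :
  exists2 C : R, 1 <= C & forall x, N x <= 1 -> N (1 + x) <= C.
Proof.
have [C C1 hC] := bnorm_coord_bounded; have [B B1 hB] := rmulmx_bounded.
exists ((C * B) ^+ n) => [|x hx].
  by rewrite exprn_ege1// -[leLHS]mulr1 ler_pM.
apply: absval_det_le; apply: hB => i.
rewrite linearD mxE; apply: le_trans (absvalD _ _ _) _.
by rewrite ge_max !hC// bnorm1.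
Qed.

Lemma bnorm_natmul_le x k : N (x *+ k) <= N x.
Proof.
have -> : x *+ k = x * (k%:R : F)%:A.
  by rewrite scaler_nat mulrnAr mulr1.
by rewrite bnormM bnorm_alg ler_piMr ?bnorm_ge0// exprn_ile1 ?absval_ge0// absval_nat_le1.
Qed.

(* The bound [C] on [N (1 + x)] applied to the binomial expansion of [(1 + x) ^ (2 ^ k - 1)]
   gives [N (1 + x) ^ (2 ^ k - 1) <= C ^ k] for all [k], hence [N (1 + x) <= 1]. *)
Lemma bnorm_succ_le1 x : N x <= 1 -> N (1 + x) <= 1.
Proof.
move=> x1; have [C C1 hC] := bnorm_succ_bounded.
have C0 : 0 <= C by apply: le_trans C1.
have quasi y z c : N y <= c -> N z <= c -> N (y + z) <= C * c.
  wlog yz : y z / N z <= N y => [hw hy hz|hy _].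
    by have [h|/ltW h] := leP (N z) (N y); [exact: hw|rewrite addrC; exact: hw].
  have [y0|y0] := eqVneq y 0.
    move: yz; rewrite y0 bnorm0 => yz; rewrite add0r (le_trans yz)//.
    by rewrite mulr_ge0// (le_trans _ hy)// bnorm_ge0.
  have -> : y + z = y * (1 + y^-1 * z) by rewrite mulrDr mulr1 mulVKr ?hD.
  rewrite bnormM mulrC ler_pM ?bnorm_ge0// hC// bnormM bnormV mulrC.
  by rewrite ler_pdivrMr ?mul1r// bnorm_gt0.
(* Adding by halves costs one factor [C] per halving, so [2 ^ k] terms cost only [k] factors. *)
have sum2 k (f : nat -> D) c : (forall i, N (f i) <= c) ->
    N (\sum_(0 <= i < 2 ^ k) f i) <= C ^+ k * c.
  elim: k f => [|k IH] f hf; first by rewrite big_nat1 expr0 mul1r.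
  rewrite expnS mul2n -addnn (@big_cat_nat _ _ _ (2 ^ k)) ?leq_addr//=.
  rewrite -{2}[(2 ^ k)%N]add0n big_addn addnK exprS -mulrA.
  by apply: quasi; apply: IH.
rewrite leNgt; apply/negP; set a := N (1 + x) => a1.
have grow k : a ^+ (2 ^ k - 1) <= C ^+ k.
  rewrite -bnormX addrC exprD1n -(big_mkord xpredT (fun i => x ^+ i *+ 'C(2 ^ k - 1, i))).
  rewrite subn1 prednK ?expn_gt0// -[leRHS]mulr1; apply: sum2 => i.
  by apply: le_trans (bnorm_natmul_le _ _) _; rewrite bnormX exprn_ile1 ?bnorm_ge0.
have [j hj] : exists j : nat, C <= a ^+ j.
  exists (Num.bound (C / (a - 1))).
  have am1 : 0 < a - 1 by rewrite subr_gt0.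
  have hb : C / (a - 1) < (Num.bound (C / (a - 1)))%:R.
    by apply: archi_boundP; rewrite divr_ge0// ltW.
  rewrite ltr_pdivrMr// in hb.
  apply: (le_trans (ltW hb)).
  have bern k : k%:R * (a - 1) + 1 <= a ^+ k.
    elim: k => [|k IH]; first by rewrite mul0r add0r expr0.
    rewrite exprS; apply: (@le_trans _ _ (a * (k%:R * (a - 1) + 1))).
      have -> : a * (k%:R * (a - 1) + 1) = k.+1%:R * (a - 1) + 1 + k%:R * (a - 1) ^+ 2.
        by rewrite -natr1; set t := k%:R; rewrite expr2; ring.
      by rewrite lerDl mulr_ge0 ?sqr_ge0.
    by rewrite ler_pM2l// (lt_trans ltr01).
  by apply: le_trans (bern _); rewrite lerDl.
(* The bound [grow] fails at [l.*2]: from [C <= a ^+ j] its right side is at most [a ^+ (j * l.*2)],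
   while [l < 2 ^ l] gives [j * l.*2 < 2 ^ l.*2 - 1]. *)
pose l := j.*2.+1.
have := grow l.*2; apply/negP; rewrite -ltNge.
apply: (@le_lt_trans _ _ (a ^+ (j * l.*2))).
  by rewrite exprM lerXn2r ?nnegrE// exprn_ge0// bnorm_ge0.
rewrite ltr_eXn2l//.
have h : (l.+1 * l.+1 <= 2 ^ l.*2)%N.
  by rewrite -addnn expnD leq_mul// ltn_expl.
rewrite /l in h *; nia.
Qed.

Lemma bnormD x y : N (x + y) <= Num.max (N x) (N y).
Proof.
wlog yx : x y / N y <= N x => [hw|].
  case/orP: (le_total (N y) (N x)) => h; first exact: hw.
  by rewrite addrC maxC; exact: hw.
rewrite max_l//.
have [x0|x0] := eqVneq x 0; first by move: yx; rewrite x0 add0r.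
have -> : x + y = x * (1 + x^-1 * y) by rewrite mulrDr mulr1 mulVKr ?hD.
rewrite bnormM ler_piMr ?bnorm_ge0// bnorm_succ_le1// bnormM bnormV mulrC.
by rewrite ler_pdivrMr ?mul1r// bnorm_gt0.
Qed.

Lemma bnorm_sum_le I (r : seq I) (P : pred I) (f : I -> D) (c : R) : 0 <= c ->
  (forall i, P i -> N (f i) <= c) -> N (\sum_(i <- r | P i) f i) <= c.
Proof.
move=> c0 h; elim/big_ind: _ => //; first by rewrite bnorm0.
by move=> x y hx hy; apply: le_trans (bnormD _ _) _; rewrite ge_max hx hy.
Qed.
End Division.
End Norm.

(** * Integral elements are the elements of norm at most 1 *)

Section Integers.
Context (R : realType) (F : fieldType) (v : nonarch_absval R F) (D : falgType F).
Hypothesis hF : local_field v.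
Hypothesis hD : forall x : D, x != 0 -> x \is a GRing.unit.
Local Notation N := (@bnorm R F v D).

(** If [N x > 1], the leading term of the integral equation outweighs the sum of all others. *)
Lemma integral_bnorm_le1 (p : {poly F}) (x : D) : p \is monic ->
  (forall i, v p`_i <= 1) -> root (map_poly (in_alg D) p) x -> N x <= 1.
Proof.
move=> pm hp /rootP px; rewrite leNgt; apply/negP => x1.
have := px; rewrite horner_coef size_map_poly.
have := monicP pm; rewrite /lead_coef; have := monic_neq0 pm.
rewrite -size_poly_gt0; case: (size p) => // k _ /= pk.
rewrite big_ord_recr /= coef_map /= pk scale1r mul1r => /eqP.
rewrite addrC addr_eq0 => /eqP xk.
case: k pk xk => [|k] pk xk.
  by move: xk; rewrite big_ord0 oppr0 => /eqP; rewrite expr0 oner_eq0.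
have : N (x ^+ k.+1) <= N x ^+ k.
  rewrite xk bnormN; apply: bnorm_sum_le => // [|i _].
    by rewrite exprn_ge0// bnorm_ge0.
  rewrite coef_map /= bnormM bnorm_alg bnormX -[leRHS]mul1r.
  rewrite ler_pM ?exprn_ge0 ?absval_ge0 ?bnorm_ge0//.
    by rewrite exprn_ile1 ?absval_ge0.
  by apply: ler_weXn2l; [exact: ltW|rewrite -ltnS].
by rewrite bnormX leNgt ltr_eXn2l// ltnS leqnn.
Qed.

Definition powers (x : D) K := [seq x ^+ i | i <- iota 0 K].

(** [K] is the degree of the minimal polynomial of [x], found as the least exponent whose power
    depends linearly on the preceding ones. The span is then stable under multiplication by [x]. *)
Lemma free_powers (x : D) : exists2 K : nat,
  free (powers x K) & forall k, x ^+ k \in <<powers x K>>%VS.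
Proof.
set X := powers x.
have ex : exists K, ~~ free (X K.+1).
  exists (\dim {:D}); apply/negP => /eqP fX.
  have := dimvS (subvf <<X (\dim {:D}).+1>>%VS).
  by rewrite fX size_map size_iota ltnn.
have [K nfK minK] := ex_minnP ex.
have fK : free (X K).
  case: K nfK minK => [|K] nfK minK; first by rewrite /X /= nil_free.
  by rewrite -[free _]negbK; apply/negP => /minK; rewrite ltnn.
have xK : x ^+ K \in <<X K>>%VS.
  move: nfK; rewrite /X /powers -addn1 iotaD map_cat /= add0n.
  rewrite (perm_free (_ : perm_eq _ (x ^+ K :: X K))); last by rewrite cats1 perm_rcons.
  by rewrite free_cons negb_and negbK fK orbF.
exists K => //; elim=> [|k IH].
  case: K {nfK minK fK} xK => [|K] xK; first by rewrite expr0 in xK *.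
  by apply: memv_span; rewrite /X /powers; apply/mapP; exists 0%N; rewrite // mem_iota.
rewrite exprS; move: IH.
suff : (amull x @: <<X K>> <= <<X K>>)%VS.
  by move=> /subvP h /(memv_img (amull x))/h; rewrite lfunE.
rewrite limg_span; apply/span_subvP => y /mapP[z zX ->]; case/(@mapP _ D _ _ _): zX => i;
rewrite mem_iota add0n => /andP[_ iK] ->; rewrite lfunE /= -exprS.
have [iK1|] := ltnP i.+1 K; last first.
  by move=> iK1; have -> : i.+1 = K by apply/eqP; rewrite eqn_leq iK iK1.
by apply: memv_span; rewrite /X /powers; apply/mapP; exists i.+1; rewrite // mem_iota.
Qed.

(* The powers of [x] are bounded, so that two of them, [x ^ k] and [x ^ l], have
   coordinates with integral differences in a basis of [F[x]] consisting of powers of [x]. *)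
Lemma bnorm_le1_integral (x : D) : N x <= 1 -> exists p : {poly F},
  [/\ p \is monic, forall i, v p`_i <= 1 & root (map_poly (in_alg D) p) x].
Proof.
move=> x1; have [K fX xX] := free_powers x.
set X := powers x K in fX xX.
have sX : size X = K by rewrite size_map size_iota.
pose Xt := in_tuple X.
have [C C1 hC] := bnorm_coord_bounded hF hD.
have hB i := v2r_functional_bounded v (coord Xt i : {linear D -> F^o}).
have [B hB'] := choice (fun i => let: ex_intro2 c c0 h := hB i in ex_intro _ c (conj c0 h)).
have [B0 B1 hB0] := fin_ubound B.
pose a k : 'rV[F]_(size X) := \row_i coord Xt i (x ^+ k).
(* Starting at index [K] ensures that ['X^l] dominates both ['X^k] and the correction [q], whose
   degree is below [K]; so the polynomial constructed below is monic. *)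
have [|k [l [/andP[Kk kl] hkl]]] := @pigeonhole_rV R F v hF _ (C * B0) a K.
  move=> k i; rewrite mxE; apply: (@le_trans _ _ (C * B i)).
    apply: (hB' i).2 => j; apply: hC.
    by rewrite bnormX exprn_ile1 ?bnorm_ge0.
  by rewrite ler_pM2l// (lt_le_trans ltr01).
pose b i := a l 0 i - a k 0 i.
pose q : {poly F} := \sum_(i < size X) b i *: 'X^i.
have hq : (size ('X^k + q)%R < l.+1)%N.
  rewrite ltnS; apply: leq_trans (size_polyD _ _) _.
  rewrite geq_max size_polyXn kl /=; apply: leq_trans (size_sum _ _ _) _.
  apply/bigmax_leqP => i _; apply: leq_trans (size_scale_leq _ _) _.
  by rewrite size_polyXn (leq_trans _ kl)// ltnS (leq_trans _ Kk)// -sX ltnW.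
exists ('X^l - ('X^k + q)); split.
- by rewrite monicE lead_coefDl ?lead_coefXn// size_polyN size_polyXn.
- move=> i; rewrite coefB coefD !coefXn.
  have vb (c : bool) : v c%:R <= 1 by exact: absval_nat_le1.
  apply: absval_sub_le => //.
  apply: le_trans (absvalD _ _ _) _; rewrite ge_max vb /= coef_sum.
  apply: absval_sum_le => // j _; rewrite coefZ coefXn absvalM -[leRHS]mulr1.
  by rewrite ler_pM ?absval_ge0//; exact: hkl.
- rewrite /root !rmorphB rmorphD /= !map_polyXn rmorph_sum /=.
  rewrite !hornerE horner_sum.
  under eq_bigr => i _ do rewrite map_polyZ map_polyXn hornerZ hornerXn mulr_algl.
rewrite !hornerXn {1}(coord_span (X := Xt) (xX l)) {1}(coord_span (X := Xt) (xX k)).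
  rewrite opprD addrA -sumrB subr_eq0; apply/eqP/eq_bigr => i _.
  rewrite -scalerBl /b !mxE; congr (_ *: _).
  rewrite (nth_map 0%N) ?nth_iota ?size_iota ?add0n//; by rewrite -sX.
Qed.

Lemma integersP (A : {vspace D}) x :
  integers v A x <-> x \in A /\ N x <= 1.
Proof.
split=> [[xA [p [pm hp px]]]|[xA /bnorm_le1_integral[p [pm hp px]]]].
  by split => //; apply: integral_bnorm_le1 px.
by split => //; exists p.
Qed.

End Integers.

(** * Residue fields *)

Section Residue.
Context (R : realType) (F : fieldType) (v : nonarch_absval R F) (D : falgType F).
Hypothesis hF : local_field v.
Hypothesis hD : forall x : D, x != 0 -> x \is a GRing.unit.
Local Notation N := (@bnorm R F v D).

Lemma bnorm_sum_lt I (r : seq I) (P : pred I) (f : I -> D) (c : R) : 0 < c ->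
  (forall i, P i -> N (f i) < c) -> N (\sum_(i <- r | P i) f i) < c.
Proof.
move=> c0 h; elim/big_ind: _ => //; first by rewrite bnorm0.
by move=> x y hx hy; apply: le_lt_trans (bnormD hF hD _ _) _; rewrite gt_max hx hy.
Qed.

Lemma bnormB x y : N (x - y) <= Num.max (N x) (N y).
Proof. by rewrite -[N y]bnormN; exact: bnormD. Qed.

Lemma bnormD_lt x y : N y < N x -> N (x + y) = N x.
Proof.
move=> yx; apply/eqP; rewrite eq_le; apply/andP; split.
  by apply: le_trans (bnormD hF hD _ _) _; rewrite ge_max lexx ltW.
have := bnormB (x + y) y; rewrite addrK le_max.
by rewrite [N x <= N y]leNgt yx orbF.
Qed.

(** A nonzero term of largest norm strictly exceeds all the others, so nothing can cancel it. This
    yields the independence in the dimension count for residue fields. *)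
Lemma distinct_bnorm_sum_eq0 (I : finType) (u : I -> D) :
  (forall i j, u i != 0 -> N (u i) = N (u j) -> i = j) ->
  \sum_i u i = 0 -> forall i, u i = 0.
Proof.
move=> hu su i; apply/eqP/negP => /negP ui.
have [i0 _ hi0] := @arg_maxP _ _ _ i xpredT (fun i => N (u i)) isT.
have ui0 : 0 < N (u i0).
  by apply: lt_le_trans (hi0 i isT); rewrite bnorm_gt0.
move: su; rewrite (bigD1 i0)//= => /eqP; rewrite addr_eq0 => /eqP h.
have : N (- u i0) < N (u i0); last by rewrite bnormN ltxx.
rewrite {1}h opprK; apply: bnorm_sum_lt => // j ji0.
rewrite lt_neqAle (hi0 j isT : N (u j) <= N (u i0)) andbT; apply: contraNneq ji0 => e.
by apply/eqP/esym; apply: hu => //; rewrite -(bnorm_gt0 v hD).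
Qed.

Lemma uniformizer_bnorm (A : {aspace D}) (w : D) :
  uniformizer (integers v A) w ->
  [/\ w \in A, N w < 1 & forall x, x \in A -> N x < 1 -> N x <= N w].
Proof.
move=> hw.
have unitP x : integers v A x ->
    (exists2 y, integers v A y & x * y = 1 /\ y * x = 1) <-> N x = 1.
  move=> /(integersP hF hD)[xA x1]; split=> [[y /(integersP hF hD)[_ y1] [xy _]]|nx].
    apply/eqP; rewrite eq_le x1 /=; apply: le_trans (_ : N x * N y <= _).
      by rewrite -bnormM xy bnorm1.
    by rewrite ler_piMr ?bnorm_ge0.
  have x0 : x != 0 by rewrite -(bnorm_gt0 v hD)// nx.
  exists x^-1; last by rewrite mulrV ?mulVr ?hD.
  by apply/(integersP hF hD); rewrite memvV xA bnormV// nx invr1.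
(* An [{aspace D}] only comes with a unit of its own; that this is [1] follows by dividing a nonzero
   element by itself. *)
have o1 : integers v A 1.
  apply/(integersP hF hD); rewrite bnorm1 lexx; split=> //.
  have [u uA u0] : exists2 u, u \in A & u != 0.
    exists (vpick A); first exact: memv_pick.
    by rewrite vpick0 -dimv_eq0 -lt0n adim_gt0.
  by rewrite -(divrr (hD u0)) memvM// memvV.
have {}hw x : (integers v A x /\ ~ (exists2 y, integers v A y & x * y = 1 /\ y * x = 1))
    <-> [set w * y | y in integers v A] x by rewrite -hw.
have [wO wn] := (hw w).2 (ex_intro2 _ _ 1 o1 (mulr1 w)).
 have [wA w1] := (integersP hF hD A w).1 wO.
split=> //.
  by rewrite lt_neqAle w1 andbT; apply/eqP => nw; apply: wn; apply/unitP.
move=> x xA x1.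
have xO : integers v A x by apply/(integersP hF hD); split=> //; exact: ltW.
have /(hw x).1[y +] : integers v A x /\
    ~ (exists2 y, integers v A y & x * y = 1 /\ y * x = 1).
  by split=> // /(unitP x xO) nx; rewrite nx ltxx in x1.
move=> /(integersP hF hD)[_ y1] <-.
by rewrite bnormM ler_piMr ?bnorm_ge0.
Qed.

(** No element of [A] has norm strictly between [N w] and 1. Dividing by the power of [w] whose norm
    is the first above that of [x] thus leaves norm 1; norms above 1 are reached by inversion. *)
Lemma bnorm_discrete (A : {aspace D}) (w : D) :
  w \in A -> w != 0 -> N w < 1 ->
  (forall x, x \in A -> N x < 1 -> N x <= N w) ->
  forall x, x \in A -> x != 0 -> exists k : int, N x = N w ^ k.
Proof.
move=> wA w0 w1 hw.
have Nw0 : 0 < N w by rewrite bnorm_gt0.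
have small x : x \in A -> x != 0 -> N x <= 1 -> exists k : nat, N x = N w ^+ k.
  move=> xA x0 x1; have Nx0 : 0 < N x by rewrite bnorm_gt0.
  have ex : exists k, N w ^+ k.+1 < N x.
    have := @cvg_expr R (N w); rewrite ger0_norm ?bnorm_ge0// => /(_ w1).
    move=> /cvgr0Pnorm_lt /(_ _ Nx0) [k _ /(_ k.+1)] /= /(_ (leqnSn k)).
    by rewrite ger0_norm ?exprn_ge0 ?bnorm_ge0// => h; exists k.
  have [k hk mink] := ex_minnP ex; exists k.
  have xk : N x <= N w ^+ k.
    case: k hk mink => [|k] hk mink; first by rewrite expr0.
    by rewrite leNgt; apply/negP => /mink; rewrite ltnn.
  have e : N (x / w ^+ k) = N x / N w ^+ k by rewrite bnormM bnormV// bnormX.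
  have wk0 : 0 < N w ^+ k by rewrite exprn_gt0.
  have wkA : x / w ^+ k \in A.
    rewrite memvM// memvV; elim: k {hk mink xk e wk0} => [|k IH]; last by rewrite exprS memvM.
    by rewrite expr0 -(divrr (hD w0)) memvM// memvV.
  apply/eqP; rewrite eq_le xk /= leNgt; apply/negP => lt.
  have := hw _ wkA; rewrite e ltr_pdivrMr// mul1r => /(_ lt).
  by rewrite ler_pdivrMr// -exprS leNgt hk.
move=> x xA x0; have [x1|/ltW x1] := leP (N x) 1.
  by have [k ->] := small x xA x0 x1; exists k%:Z.
have xV0 : x^-1 != 0 by rewrite -(bnorm_gt0 v hD)// bnormV// invr_gt0 bnorm_gt0.
have [||k hk] := small x^-1 _ xV0; first by rewrite memvV.
  by rewrite bnormV// invf_le1// bnorm_gt0.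
by exists (- k%:Z); rewrite -exprnN -hk bnormV// invrK.
Qed.

(* If the residue of [x] avoided [E], the spaces [(E + E x) w ^ j] for [j < d] would be
   independent, the norms of their nonzero elements lying in distinct classes, and
   [D] would have dimension at least [2 d ^ 2]. *)
Lemma residue_surjective (E : {aspace D}) (w : D) (t : F) (d : nat) :
  (0 < d)%N -> \dim E = d -> \dim {:D} = (d ^ 2)%N -> w ^+ d = t%:A ->
  0 < N w < 1 ->
  (forall x, x \in E -> x != 0 -> exists k : int, N x = N t%:A ^ k) ->
  forall x, N x <= 1 -> exists s, [/\ s \in E, N s <= 1 & N (x - s) < 1].
Proof.
move=> d0 dE dD wd /andP[Nw0 Nw1] discE x x1; apply: contrapT => hx.
have w0 : w != 0 by rewrite -(bnorm_gt0 v hD).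
have wU := hD w0.
have hx1 s : s \in E -> N s <= 1 -> N (x - s) = 1.
  move=> sE s1; apply/eqP; rewrite eq_le (le_trans (bnormB _ _)) ?ge_max ?x1//=.
  by rewrite leNgt; apply/negP => h; apply: hx; exists s.
(* [1] and [x] are orthonormal over [E], because no integral element of [E] comes closer to [x] than
   distance 1. So [E + E x] has twice the dimension of [E] but no new norms. *)
have nab a b : a \in E -> b \in E -> N (a + b * x) = Num.max (N a) (N b).
  move=> aE bE; have [ab|ab] := ltP (N b) (N a).
    by apply: bnormD_lt; apply: le_lt_trans ab; rewrite bnormM ler_piMr ?bnorm_ge0.
  have [b0|b0] := eqVneq b 0.
    move: ab; rewrite b0 mul0r addr0 bnorm0 => ab; apply/eqP.
    by rewrite eq_le ab bnorm_ge0.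
  have -> : a + b * x = b * (x - (- (b^-1 * a))).
    by rewrite opprK mulrDr mulVKr ?hD// addrC.
  rewrite bnormM hx1 ?mulr1//.
    by rewrite memvN memvM// memvV.
  by rewrite bnormN bnormM bnormV// mulrC ler_pdivrMr ?mul1r// bnorm_gt0.
pose W := (E + amulr x @: E)%VS.
have WP z : z \in W -> exists a b, [/\ a \in E, b \in E & z = a + b * x].
  move=> /memv_addP[a aE [y /memv_imgP[b bE ->] ->]].
  by exists a, b; split=> //; rewrite lfunE.
have x0 : x != 0.
  apply/eqP => x0; have := hx1 0 (mem0v _); rewrite bnorm0 ler01 subr0 x0 bnorm0.
  by move=> /(_ isT)/eqP; rewrite eq_sym oner_eq0.
have dW : \dim W = d.*2.
  rewrite dimv_disjoint_sum.
    rewrite limg_dim_eq ?dE ?addnn//.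
    by have /eqP-> := lker0_amulr (hD x0); rewrite capv0.
  apply/eqP; rewrite -subv0; apply/subvP => z; rewrite memv_cap => /andP[zE].
  move=> /memv_imgP[b bE]; rewrite lfunE /= => zb.
  have := nab z (- b) zE; rewrite memvN bE zb mulNr subrr bnorm0 => /(_ isT)/esym/eqP.
  rewrite -zb => h; rewrite memv0 -(bnorm_eq0 v hD) eq_le bnorm_ge0 andbT.
  by rewrite -(eqP h) le_max lexx.
pose V (j : 'I_d) := (amulr (w ^+ j) @: W)%VS.
have dV j : \dim (V j) = d.*2.
  rewrite limg_dim_eq ?dW//.
  by have /eqP-> := lker0_amulr (unitrX j wU); rewrite capv0.
have NW z : z \in W -> z != 0 -> exists k : int, N z = N w ^ (k * d).
  move=> /WP[a [b [aE bE ->]]] z0.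
  have [c [cE c0 ->]] : exists c, [/\ c \in E, c != 0 & N (a + b * x) = N c].
    rewrite nab//; have : 0 < Num.max (N a) (N b) by rewrite -nab// bnorm_gt0.
    case: (leP (N a) (N b)) => _; rewrite bnorm_gt0// => c0.
      by exists b.
    by exists a.
  have [k ->] := discE c cE c0; exists k.
  by rewrite -wd bnormX exprnP exprz_exp mulrC.
have dirV : directv (\sum_j V j).
  apply/directv_sum_independent => u uV su j _.
  apply: (distinct_bnorm_sum_eq0 _ su) => {j} i j ui hij.
  have uP k : u k != 0 -> exists m : int, N (u k) = N w ^ (m * d + k%:Z).
    move=> uk; have /memv_imgP[z zW uz] := uV k isT.
    rewrite lfunE /= in uz.
    have z0 : z != 0 by apply: contraNneq uk => z0; rewrite uz z0 mul0r.
    have [m hm] := NW z zW z0; exists m.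
    by rewrite uz bnormM hm bnormX expfzDr ?gt_eqF.
  have uj : u j != 0 by rewrite -(bnorm_gt0 v hD) -hij bnorm_gt0.
  have [[m hm] [m' hm']] := (uP _ ui, uP _ uj).
  move: hij; rewrite hm hm' => /(ieexprIz Nw0); rewrite lt_eqF// => /(_ isT) e.
  have := congr1 (fun z => (z %% d)%Z) e; rewrite !modzMDl !modz_small ?ltz_nat ?ltn_ord//.
  by move=> [/val_inj].
have := dimvS (subvf (\sum_j V j)%VS).
rewrite (directvP dirV) /= (eq_bigr _ (fun j _ => dV j)) sum_nat_const card_ord dD.
by rewrite -mul2n; nia.
Qed.
End Residue.

(** * Cartan decomposition *)

(* [D] is a division ring with absolute value [nv], [A] a division subring of [D] in which [w] is
   a uniformizer of absolute value [rho].  [D] and [E] will both be given this structure inside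
   the same ring and with the same [rho]: the absolute value of [D] is raised to the power [d]. *)
Record valdiv (R : realType) (D : unitRingType) (A : set D) (nv : D -> R)
    (w : D) (rho : R) : Prop := Valdiv {
  valdiv_unit : forall x : D, x != 0 -> x \is a GRing.unit ;
  valdiv_ge0 : forall x, 0 <= nv x ;
  valdiv_eq0 : forall x, (nv x == 0) = (x == 0) ;
  valdivM : forall x y, nv (x * y) = nv x * nv y ;
  valdivD : forall x y, nv (x + y) <= Num.max (nv x) (nv y) ;
  valdiv_in1 : A 1 ;
  valdiv_inB : forall x y, A x -> A y -> A (x - y) ;
  valdiv_inM : forall x y, A x -> A y -> A (x * y) ;
  valdiv_inV : forall x, A x -> A x^-1 ;
  valdiv_unif : A w /\ nv w = rho ;
  valdiv_rho : 0 < rho < 1 ;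
  valdiv_discrete : forall x, A x -> x != 0 -> exists k : int, nv x = rho ^ k
}.

Section ValuedDivisionRing.
Context (R : realType) (D : unitRingType) (A : set D) (nv : D -> R) (w : D) (rho : R).
Hypothesis H : valdiv A nv w rho.

Definition valring : set D := [set x | A x /\ nv x <= 1].
Local Notation O := valring.

Lemma nv0 : nv 0 = 0. Proof. by apply/eqP; rewrite (valdiv_eq0 H). Qed.

Lemma nv_gt0 x : (0 < nv x) = (x != 0).
Proof. by rewrite lt_def (valdiv_ge0 H) andbT (valdiv_eq0 H). Qed.

Lemma nv_one : nv 1 = 1.
Proof.
have n0 : nv 1 != 0 by rewrite (valdiv_eq0 H) oner_eq0.
by apply: (mulfI n0); rewrite -(valdivM H) !mulr1.
Qed.

Lemma nvN x : nv (- x) = nv x.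
Proof.
rewrite -mulN1r (valdivM H).
have : nv (-1) ^+ 2 == 1 by rewrite expr2 -(valdivM H) mulrNN mulr1 nv_one.
by rewrite sqrp_eq1 ?(valdiv_ge0 H)// => /eqP ->; rewrite mul1r.
Qed.

Lemma nvV x : nv x^-1 = (nv x)^-1.
Proof.
have [->|x0] := eqVneq x 0; first by rewrite invr0 nv0 invr0.
have nx0 : nv x != 0 by rewrite (valdiv_eq0 H).
by apply: (mulfI nx0); rewrite -(valdivM H) divrr ?(valdiv_unit H)// divff// nv_one.
Qed.

Lemma nvX x k : nv (x ^+ k) = nv x ^+ k.
Proof. by elim: k => [|k IH]; rewrite ?expr0 ?nv_one// !exprS (valdivM H) IH. Qed.

Lemma nvXz x (k : int) : nv (x ^ k) = nv x ^ k.
Proof. by case: k => k; rewrite /exprz /= ?nvV nvX. Qed.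

Lemma nvB x y : nv (x - y) <= Num.max (nv x) (nv y).
Proof. by rewrite -[nv y]nvN; exact: (valdivD H). Qed.

Lemma nvD_le x y c : nv x <= c -> nv y <= c -> nv (x + y) <= c.
Proof. by move=> hx hy; apply: le_trans (valdivD H _ _) _; rewrite ge_max hx. Qed.

Lemma nvB_le x y c : nv x <= c -> nv y <= c -> nv (x - y) <= c.
Proof. by move=> hx hy; apply: le_trans (nvB _ _) _; rewrite ge_max hx. Qed.

Lemma nvBC x y : nv (x - y) = nv (y - x).
Proof. by rewrite -nvN opprB. Qed.

Lemma nvD_gt x y : nv y < nv x -> nv (x + y) = nv x.
Proof.
move=> yx; apply/eqP; rewrite eq_le nvD_le ?(ltW yx)//=.
have := nvB (x + y) y; rewrite addrK le_max.
by rewrite [nv x <= nv y]leNgt yx orbF.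
Qed.

Lemma nv_sum_le I (r : seq I) (P : pred I) (f : I -> D) (c : R) : 0 <= c ->
  (forall i, P i -> nv (f i) <= c) -> nv (\sum_(i <- r | P i) f i) <= c.
Proof.
move=> c0 h; elim/big_ind: _ => //; first by rewrite nv0.
by move=> x y; exact: nvD_le.
Qed.

Lemma in0 : A 0.
Proof. by rewrite -(subrr 1); apply: (valdiv_inB H); exact: (valdiv_in1 H). Qed.

Lemma inN x : A x -> A (- x).
Proof. by rewrite -sub0r; apply: (valdiv_inB H); exact: in0. Qed.

Lemma inD x y : A x -> A y -> A (x + y).
Proof. by move=> Ax Ay; rewrite -[y]opprK; apply: (valdiv_inB H) => //; exact: inN. Qed.

Lemma inXz x (k : int) : A x -> A (x ^ k).
Proof.
move=> Ax; have inX n : A (x ^+ n).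
  by elim: n => [|n IH]; [exact: (valdiv_in1 H)|rewrite exprS; exact: (valdiv_inM H)].
by case: k => k; [exact: inX|apply: (valdiv_inV H); exact: inX].
Qed.

Lemma rho_gt0 : 0 < rho. Proof. by case/andP: (valdiv_rho H). Qed.
Lemma rho_lt1 : rho < 1. Proof. by case/andP: (valdiv_rho H). Qed.
Lemma in_unif : A w. Proof. by case: (valdiv_unif H). Qed.
Lemma nv_unif : nv w = rho. Proof. by case: (valdiv_unif H). Qed.

Lemma unif_unit : w \is a GRing.unit.
Proof. by apply: (valdiv_unit H); rewrite -nv_gt0 nv_unif rho_gt0. Qed.

Lemma nv_unifX (k : int) : nv (w ^ k) = rho ^ k.
Proof. by rewrite nvXz nv_unif. Qed.

Lemma ler_rhoXz (a b : int) : (rho ^ a <= rho ^ b) = (b <= a).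
Proof.
have e (c : int) : rho ^ c = rho^-1 ^ (- c) by rewrite exprz_inv opprK.
by rewrite !e ler_eXz2l ?lerN2// invf_gt1 ?rho_gt0 ?rho_lt1.
Qed.

Lemma unifXD (a b : int) : w ^ (a + b) = w ^ a * w ^ b.
Proof. by rewrite exprzDr ?unif_unit. Qed.

Lemma unifXN (a : int) : w ^ a * w ^ (- a) = 1.
Proof. by rewrite -unifXD subrr. Qed.

Lemma O0 : O 0. Proof. by split; [exact: in0|rewrite nv0]. Qed.
Lemma O1 : O 1. Proof. by split; [exact: (valdiv_in1 H)|rewrite nv_one]. Qed.
Lemma OM x y : O x -> O y -> O (x * y).
Proof.
move=> [Ax x1] [Ay y1]; split; first exact: (valdiv_inM H).
by rewrite (valdivM H) mulr_ile1 ?(valdiv_ge0 H).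
Qed.
Lemma ON x : O x -> O (- x).
Proof. by move=> [Ax x1]; split; [exact: inN|rewrite nvN]. Qed.
Lemma OD x y : O x -> O y -> O (x + y).
Proof. by move=> [Ax x1] [Ay y1]; split; [exact: inD|exact: nvD_le]. Qed.

Section Groups.
Variable m : nat.
Local Notation K := (GL m O).

Lemma mulmx_in m1 m2 m3 (S : set D) (g : 'M[D]_(m1, m2)) (h : 'M[D]_(m2, m3)) :
  S 0 -> (forall x y, S x -> S y -> S (x + y)) ->
  (forall x y, S x -> S y -> S (x * y)) ->
  (forall i j, S (g i j)) -> (forall i j, S (h i j)) ->
  forall i j, S ((g *m h) i j).
Proof.
move=> S0 SD SM hg hh i j; rewrite mxE; elim/big_ind: _ => // k _.
exact: SM.
Qed.

Lemma GL_mul (S : set D) g h :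
  S 0 -> (forall x y, S x -> S y -> S (x + y)) ->
  (forall x y, S x -> S y -> S (x * y)) ->
  GL m S g -> GL m S h -> GL m S (g *m h).
Proof.
move=> S0 SD SM [gS [g' [g'S gg' g'g]]] [hS [h' [h'S hh' h'h]]]; split.
  exact: mulmx_in.
exists (h' *m g'); split; first exact: mulmx_in.
  by rewrite mulmxA -[g *m h *m h']mulmxA hh' mulmx1.
by rewrite mulmxA -[h' *m g' *m g]mulmxA g'g mulmx1.
Qed.

Lemma KM g h : K g -> K h -> K (g *m h).
Proof. by apply: GL_mul; [exact: O0|exact: OD|exact: OM]. Qed.

Lemma GLA_mul g h : GL m A g -> GL m A h -> GL m A (g *m h).
Proof. by apply: GL_mul; [exact: in0|exact: inD|exact: (valdiv_inM H)]. Qed.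

Lemma K_inv g : K g -> exists h, [/\ K h, g *m h = 1%:M & h *m g = 1%:M].
Proof.
by move=> [gS [h [hS gh hg]]]; exists h; split=> //; split=> //; exists g.
Qed.

Lemma K1 : K 1%:M.
Proof.
have h1 i j : O ((1%:M : 'M[D]_m) i j).
  by rewrite !mxE; case: (i == j); [exact: O1|exact: O0].
by split=> //; exists 1%:M; rewrite mulmx1; split.
Qed.

Lemma K_perm (s : 'S_m) : K (perm_mx s).
Proof.
have hp (t : 'S_m) i j : O ((perm_mx t : 'M[D]_m) i j).
  by rewrite !mxE; case: (_ == _); [exact: O1|exact: O0].
split=> //; exists (perm_mx s^-1%g); split=> //.
  by rewrite -perm_mxM mulgV perm_mx1.
by rewrite -perm_mxM mulVg perm_mx1.
Qed.

End Groups.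

(** Gaussian elimination with an entry of largest absolute value as pivot: the factors [c * al^-1]
    on the left and [al^-1 * r] on the right that clear its column and row are then integral. The
    induction continues with the Schur complement, which may be singular. *)
Lemma cartan_diag m (g : 'M[D]_m) : (forall i j, A (g i j)) ->
  exists k k' (a : 'rV[D]_m), [/\ GL m O k, GL m O k', forall i, A (a 0 i)
    & k *m g *m k' = diag_mx a].
Proof.
elim: m g => [|m IH] g gA.
  exists 1%:M, 1%:M, 0; split; try exact: K1.
    by case.
  by apply/matrixP; case.
have [[i0 j0] _ hmax] := @arg_maxP _ _ _ (ord0, ord0) xpredT
  (fun u : 'I_m.+1 * 'I_m.+1 => nv (g u.1 u.2)) isT.
set al := g i0 j0 in hmax; rewrite /= -/al in hmax.
have [al0|al0] := eqVneq al 0.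
  exists 1%:M, 1%:M, 0; split; try exact: K1.
    by move=> i; rewrite mxE; exact: in0.
  rewrite mul1mx mulmx1; apply/matrixP => i j; rewrite !mxE mul0rn.
  apply/eqP; rewrite -(valdiv_eq0 H) eq_le (valdiv_ge0 H) andbT.
  by have := hmax (i, j) isT; rewrite /= al0 nv0.
have nal : 0 < nv al by rewrite nv_gt0.
have alA : A al by exact: gA.
pose g1 : 'M[D]_(1 + m) := tperm_mx ord0 i0 *m g *m tperm_mx ord0 j0.
have g1E i j : g1 i j = g (tperm ord0 i0 i) (tperm ord0 j0 j).
  by rewrite /g1 -xrowE -xcolE !mxE.
have g1D : g1 = tperm_mx ord0 i0 *m g *m tperm_mx ord0 j0 by [].
clearbody g1.
pose r := ursubmx g1; pose c := dlsubmx g1; pose B := drsubmx g1.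
have g1B : g1 = block_mx al%:M r c B.
  rewrite -[LHS]submxK; congr block_mx; apply/matrixP => i j.
  rewrite !ord1 !mxE g1E (_ : lshift m 0 = ord0) ?tpermL//.
  exact: val_inj.
have cO i j : O ((c *m (al^-1)%:M) i j).
  have -> : (c *m (al^-1)%:M) i j = c i j * al^-1.
    by rewrite mxE big_ord1 !ord1 !mxE eqxx.
  rewrite !mxE g1E; split.
    by apply: (valdiv_inM H); [exact: gA|exact: (valdiv_inV H)].
  by rewrite (valdivM H) nvV ler_pdivrMr// mul1r; exact: (hmax (_, _) isT).
have rO i j : O (((al^-1)%:M *m r) i j).
  have -> : ((al^-1)%:M *m r) i j = al^-1 * r i j.
    by rewrite mul_scalar_mx mxE.
  rewrite !mxE g1E; split.
    by apply: (valdiv_inM H); [exact: (valdiv_inV H)|exact: gA].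
  by rewrite (valdivM H) nvV mulrC ler_pdivrMr// mul1r; exact: (hmax (_, _) isT).
have block_in (S : set D) (m1 m2 n1 n2 : nat) (a1 : 'M[D]_(m1, n1)) (a2 : 'M[D]_(m1, n2))
    (a3 : 'M[D]_(m2, n1)) (a4 : 'M[D]_(m2, n2)) :
    (forall i j, S (a1 i j)) -> (forall i j, S (a2 i j)) ->
    (forall i j, S (a3 i j)) -> (forall i j, S (a4 i j)) ->
    forall i j, S (block_mx a1 a2 a3 a4 i j).
  move=> h1 h2 h3 h4 i j; rewrite -(splitK i) -(splitK j).
  by case: (fintype.split i) => i'; case: (fintype.split j) => j' /=;
    rewrite ?block_mxEul ?block_mxEur ?block_mxEdl ?block_mxEdr.
have O0mx (m1 m2 : nat) i j : O ((0 : 'M[D]_(m1, m2)) i j) by rewrite mxE; exact: O0.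
have O1mx (m1 : nat) i j : O ((1%:M : 'M[D]_m1) i j) by exact: (K1 m1).1.
have ONmx (m1 m2 : nat) (M : 'M[D]_(m1, m2)) : (forall i j, O (M i j)) -> forall i j, O ((- M) i j).
  by move=> hM i j; rewrite mxE; exact: ON.
pose P : 'M[D]_(1 + m) := block_mx 1%:M 0 (- (c *m (al^-1)%:M)) 1%:M.
pose Q : 'M[D]_(1 + m) := block_mx 1%:M (- ((al^-1)%:M *m r)) 0 1%:M.
have PK : GL (1 + m) O P.
  split; first by apply: block_in => //; exact: ONmx.
  exists (block_mx 1%:M 0 (c *m (al^-1)%:M) 1%:M); split.
  - exact: block_in.
  - rewrite mulmx_block !mul1mx !mulmx1 !mul0mx !mulmx0 !addr0 !add0r addNr.
    by rewrite -scalar_mx_block.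
  - rewrite mulmx_block !mul1mx !mulmx1 !mul0mx !mulmx0 !addr0 !add0r subrr.
    by rewrite -scalar_mx_block.
have QK : GL (1 + m) O Q.
  split; first by apply: block_in => //; exact: ONmx.
  exists (block_mx 1%:M ((al^-1)%:M *m r) 0 1%:M); split.
  - exact: block_in.
  - rewrite mulmx_block !mul1mx !mulmx1 !mul0mx !mulmx0 !addr0 !add0r subrr.
    by rewrite -scalar_mx_block.
  - rewrite mulmx_block !mul1mx !mulmx1 !mul0mx !mulmx0 !addr0 !add0r addNr.
    by rewrite -scalar_mx_block.
have diagK (k : 'M[D]_m) : GL m O k -> GL (1 + m) O (block_mx 1%:M 0 0 k).
  move=> [kO [h [hO kh hk]]]; split; first exact: block_in.
  exists (block_mx 1%:M 0 0 h); split; first exact: block_in.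
    rewrite mulmx_block !mul1mx !mulmx1 !mul0mx !mulmx0 !addr0 !add0r kh.
    by rewrite -scalar_mx_block.
  rewrite mulmx_block !mul1mx !mulmx1 !mul0mx !mulmx0 !addr0 !add0r hk.
  by rewrite -scalar_mx_block.
have alU : al \is a GRing.unit by exact: (valdiv_unit H).
have PgQ : P *m g1 *m Q = block_mx al%:M 0 0 (B - c *m (al^-1)%:M *m r).
  rewrite g1B !mulmx_block !mul1mx !mulmx1 !mul0mx !mulmx0 !addr0.
  rewrite mulNmx -[c *m _ *m al%:M]mulmxA -scalar_mxM mulVr// mulmx1 addNr.
  rewrite mulmxN mulmxA -scalar_mxM mulrV// mul1mx addNr mul0mx add0r.
  by rewrite mulNmx addrC.
have [|k [k' [a [kK k'K aA e]]]] := IH (B - c *m (al^-1)%:M *m r).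
  move=> i j; rewrite [X in A X]mxE; apply: inD; first by rewrite !mxE g1E; exact: gA.
  rewrite [X in A X]mxE; apply: inN; apply: mulmx_in => //.
  - exact: in0.
  - exact: inD.
  - exact: (valdiv_inM H).
  - by move=> i' j'; case: (cO i' j').
  - by move=> i' j'; rewrite !mxE g1E; exact: gA.
have rA (i : 'I_(1 + m)) : A ((row_mx al%:M a : 'rV_(1 + m)) 0 i).
  rewrite -(splitK i); case: (fintype.split i) => i' /=.
    by rewrite row_mxEl mxE ord1 eqxx.
  by rewrite row_mxEr.
exists (block_mx 1%:M 0 0 k *m P *m tperm_mx ord0 i0).
exists (tperm_mx ord0 j0 *m Q *m block_mx 1%:M 0 0 k').
exists (row_mx al%:M a); split.
- by apply: KM; [apply: KM => //; exact: diagK|exact: K_perm].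
- by apply: KM; [apply: KM => //; exact: K_perm|exact: diagK].
- exact: rA.
- transitivity (block_mx 1%:M 0 0 k *m (P *m g1 *m Q) *m block_mx 1%:M 0 0 k').
    by rewrite g1D !mulmxA.
  rewrite PgQ !mulmx_block !mul1mx !mulmx1 !mul0mx !mulmx0 !addr0 !add0r e.
  have e1 : (al%:M : 'M[D]_1) = diag_mx (al%:M : 'rV[D]_1).
    by apply/matrixP => i j; rewrite !ord1 !mxE eqxx.
  by rewrite mul0mx {1}e1; exact (esym (@diag_mx_row _ m 1 al%:M a)).
Qed.

Lemma cocharE m (mu : 'rV[int]_m) i j :
  cochar w mu i j = if i == j then w ^ mu 0 i else 0.
Proof. by rewrite !mxE; case: eqP => [->|]; rewrite ?mulr1n ?mulr0n. Qed.

Lemma cochar_mul m (mu : 'rV[int]_m) (g : 'M[D]_m) i j :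
  (cochar w mu *m g) i j = w ^ mu 0 i * g i j.
Proof. by rewrite mul_diag_mx !mxE. Qed.

Lemma mul_cochar m (mu : 'rV[int]_m) (g : 'M[D]_m) i j :
  (g *m cochar w mu) i j = g i j * w ^ mu 0 j.
Proof. by rewrite mul_mx_diag !mxE. Qed.

Lemma cocharD m (mu nu : 'rV[int]_m) :
  cochar w (mu + nu) = cochar w mu *m cochar w nu.
Proof.
apply/matrixP => i j; rewrite cochar_mul !cocharE mxE.
by case: eqP => [->|_]; rewrite ?unifXD ?mulr0.
Qed.

Lemma cochar0 m : cochar w (0 : 'rV[int]_m) = 1%:M.
Proof. by apply/matrixP => i j; rewrite cocharE !mxE expr0z; case: eqP. Qed.

Lemma cocharN m (mu : 'rV[int]_m) : cochar w mu *m cochar w (- mu) = 1%:M.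
Proof. by rewrite -cocharD subrr cochar0. Qed.

Lemma cocharNl m (mu : 'rV[int]_m) : cochar w (- mu) *m cochar w mu = 1%:M.
Proof. by rewrite -cocharD addNr cochar0. Qed.

Lemma GLA_cochar m (mu : 'rV[int]_m) : GL m A (cochar w mu).
Proof.
have h (nu : 'rV[int]_m) i j : A (cochar w nu i j).
  by rewrite cocharE; case: eqP => _; [apply: inXz; exact: in_unif|exact: in0].
by split=> //; exists (cochar w (- mu)); rewrite cocharN cocharNl; split.
Qed.

(** By discreteness each diagonal entry, nonzero as [g] is invertible, is a power of [w] times an
    element of absolute value 1; the latter is absorbed into the right factor. *)
Lemma cartan m (g : 'M[D]_m) : GL m A g ->
  exists nu : 'rV[int]_m, double_coset (GL m O) (cochar w nu) g.
Proof.
move=> gG; have [gA [g' [g'A gg' g'g]]] := gG.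
have [k [k' [a [kK k'K aA e]]]] := cartan_diag gA.
have [h [hK kh hk]] := K_inv kK; have [h' [h'K kh' hk']] := K_inv k'K.
have gE : g = h *m diag_mx a *m h'.
  by rewrite -e !mulmxA hk mul1mx -mulmxA kh' mulmx1.
have a0 i : a 0 i != 0.
  apply/eqP => ai0.
  have : (diag_mx a *m (h' *m g' *m h)) i i = 1.
    rewrite -e !mulmxA -[k *m g *m k' *m h']mulmxA kh' mulmx1.
    by rewrite -[k *m g *m g']mulmxA gg' mulmx1 kh mxE eqxx.
  by rewrite mul_diag_mx mxE ai0 mul0r => /esym/eqP; rewrite oner_eq0.
have [nu hnu] := choice (fun i => valdiv_discrete H (aA i) (a0 i)).
pose nur : 'rV[int]_m := \row_i nu i.
exists nur; exists h => //.
pose ep := diag_mx (\row_i (w ^ (- nu i) * a 0 i)).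
exists (ep *m h'); last first.
  rewrite gE !mulmxA; congr (_ *m _); rewrite -mulmxA; congr (_ *m _).
  apply/matrixP => i j; rewrite cochar_mul !mxE; case: eqP => [->|]; last by rewrite mulr0.
  by rewrite !mulr1n mulrA unifXN mul1r.
apply: KM => //.
have epO (b : 'I_m -> D) : (forall i, A (b i) /\ nv (b i) = 1) ->
    forall i j, O (diag_mx (\row_i b i) i j).
  move=> hb i j; rewrite !mxE; case: eqP => _; last by exact: O0.
  by have [Ab nb] := hb i; rewrite mulr1n; split=> //; rewrite nb.
have hb i : A (w ^ (- nu i) * a 0 i) /\ nv (w ^ (- nu i) * a 0 i) = 1.
  split; first by apply: (valdiv_inM H) => //; apply: inXz; exact: in_unif.
  rewrite (valdivM H) nv_unifX hnu -expfzDr ?gt_eqF ?rho_gt0//.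
  by rewrite addNr expr0z.
have hbU i : w ^ (- nu i) * a 0 i \is a GRing.unit.
  by apply: (valdiv_unit H); rewrite -nv_gt0 (hb i).2.
split; first by apply: epO => i; exact: hb.
exists (diag_mx (\row_i (w ^ (- nu i) * a 0 i)^-1)); split.
- apply: epO => i; split; first by apply: (valdiv_inV H); case: (hb i).
  by rewrite nvV (hb i).2 invr1.
- apply/matrixP => i j; rewrite mul_diag_mx !mxE; case: eqP => [->|]; last by rewrite mulr0.
  by rewrite !mulr1n divrr.
- apply/matrixP => i j; rewrite mul_diag_mx !mxE; case: eqP => [->|]; last by rewrite mulr0.
  by rewrite !mulr1n mulVr.
Qed.
End ValuedDivisionRing.

(** * Invariants of double cosets *)

(** At most one entry lies between the extremes, and the sum gives it. Minimum and maximum are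
    expressed through all their bounds [k], the form in which matrix entries reveal them. *)
Lemma sorted_eq_of_extrema_sum (s t : seq int) :
  sorted <=%R s -> sorted <=%R t -> (size s <= 3)%N -> size s = size t ->
  (forall k, all (fun z => k <= z) s = all (fun z => k <= z) t) ->
  (forall k, all (fun z => z <= k) s = all (fun z => z <= k) t) ->
  \sum_(z <- s) z = \sum_(z <- t) z -> s = t.
Proof.
case: s => [|a [|b [|c [|]]]]; case: t => [|a' [|b' [|c' [|]]]] //=;
  rewrite ?big_cons ?big_nil ?addr0 ?andbT.
- by move=> _ _ _ _ _ _ ->.
- move=> ? ? _ _ h1 h2 ?.
  have := (h1 a, h1 a', h2 b, h2 b') => -[[[]]] {h1 h2} ? ? ? ?.
  have [-> ->] : a = a' /\ b = b' by lia.
  by [].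
- move=> /andP[? ?] /andP[? ?] _ _ h1 h2 ?.
  have := (h1 a, h1 a', h2 c, h2 c') => -[[[]]] {h1 h2} ? ? ? ?.
  have [-> [-> ->]] : a = a' /\ b = b' /\ c = c' by lia.
  by [].
Qed.

Lemma perm_of_extrema_sum m (la nu : 'rV[int]_m) : (0 < m <= 3)%N ->
  (forall k : int, (forall i, k <= la 0 i) <-> (forall i, k <= nu 0 i)) ->
  (forall k : int, (forall i, la 0 i <= k) <-> (forall i, nu 0 i <= k)) ->
  \sum_i la 0 i = \sum_i nu 0 i ->
  exists s : 'S_m, forall i, nu 0 i = la 0 (s i).
Proof.
move=> hm h1 h2 h3.
suff : perm_eq [tuple nu 0 i | i < m] [tuple la 0 i | i < m].
  move=> /tuple_permP[s hs]; exists s => i.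
  by have := congr1 (fun t => nth 0 t i) hs; rewrite !nth_mktuple tnth_mktuple.
have forallE (P : int -> bool) (x : 'rV[int]_m) :
    (forall i, P (x 0 i)) <-> all P [tuple x 0 i | i < m].
  split=> [h|/allP h i]; first by apply/allP => z /mapP[i _ ->].
  by apply: h; apply/mapP; exists i; rewrite ?mem_enum.
have {}h1 k : all (fun z => k <= z) [tuple la 0 i | i < m] =
    all (fun z => k <= z) [tuple nu 0 i | i < m].
  by apply/idP/idP => /forallE h; apply/forallE/h1.
have {}h2 k : all (fun z => z <= k) [tuple la 0 i | i < m] =
    all (fun z => z <= k) [tuple nu 0 i | i < m].
  by apply/idP/idP => /(forallE (fun z => z <= k)) h; apply/(forallE (fun z => z <= k))/h2.
have {}h3 : \sum_(z <- [tuple la 0 i | i < m]) z = \sum_(z <- [tuple nu 0 i | i < m]) z.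
  by rewrite !big_map.
set s := val [tuple la 0 i | i < m] in h1 h2 h3 *.
set t := val [tuple nu 0 i | i < m] in h1 h2 h3 *.
have [ps pt] : perm_eq (sort <=%R s) s /\ perm_eq (sort <=%R t) t.
  by rewrite !perm_sort !perm_refl.
rewrite perm_sym -(permPl ps) -(permPr pt).
rewrite (_ : sort <=%R s = sort <=%R t) ?perm_refl//.
apply: sorted_eq_of_extrema_sum.
- exact/sort_sorted/le_total.
- exact/sort_sorted/le_total.
- by rewrite size_sort size_tuple; case/andP: hm.
- by rewrite !size_sort !size_tuple.
- by move=> k; rewrite !all_sort.
- by move=> k; rewrite !all_sort.
- by rewrite (perm_big _ ps) (perm_big _ pt).
Qed.

Section DoubleCosets.
Context (R : realType) (D : unitRingType) (A : set D) (nv : D -> R) (w : D) (rho : R).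
Hypothesis H : valdiv A nv w rho.
Variable m : nat.
Local Notation O := (valring A nv).
Local Notation K := (GL m O).

Definition mxle (g : 'M[D]_m) (c : R) := forall i j, nv (g i j) <= c.

Lemma rhoX_ge0 (k : int) : 0 <= rho ^ k.
Proof. by rewrite exprz_ge0// ltW// (rho_gt0 H). Qed.

Lemma mxle_mulKl k g c : 0 <= c -> K k -> mxle g c -> mxle (k *m g) c.
Proof.
move=> c0 [kO _] hg i j; rewrite mxE; apply: (nv_sum_le H) => // l _.
by rewrite (valdivM H) -[c]mul1r ler_pM ?(valdiv_ge0 H)//; case: (kO i l).
Qed.

Lemma mxle_mulKr k g c : 0 <= c -> K k -> mxle g c -> mxle (g *m k) c.
Proof.
move=> c0 [kO _] hg i j; rewrite mxE; apply: (nv_sum_le H) => // l _.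
by rewrite (valdivM H) -[c]mulr1 ler_pM ?(valdiv_ge0 H)//; case: (kO l j).
Qed.

Lemma mxle_cochar nu c : 0 <= c ->
  mxle (cochar w nu) c <-> forall i, rho ^ nu 0 i <= c.
Proof.
move=> c0; split=> [h i|h i j].
  by have := h i i; rewrite (cocharE w) eqxx (nv_unifX H).
by rewrite (cocharE w); case: eqP => _; rewrite ?(nv_unifX H) ?(nv0 H).
Qed.

Lemma mxle_double_coset nu g c : 0 <= c -> double_coset K (cochar w nu) g ->
  mxle g c <-> forall i, rho ^ nu 0 i <= c.
Proof.
move=> c0 [k kK [k' k'K ->]]; rewrite -mxle_cochar//.
have [h [hK kh hk]] := K_inv kK; have [h' [h'K kh' hk']] := K_inv k'K.
split=> hg; last by apply: mxle_mulKr => //; exact: mxle_mulKl.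
have -> : cochar w nu = h *m (k *m cochar w nu *m k') *m h'.
  by rewrite !mulmxA hk mul1mx -mulmxA kh' mulmx1.
by apply: mxle_mulKr => //; exact: mxle_mulKl.
Qed.

(** Inversion turns the maximum of [nu] into a minimum, so the largest entry of the inverse detects
    it. *)
Lemma double_coset_inv nu g h : g *m h = 1%:M -> h *m g = 1%:M ->
  double_coset K (cochar w nu) g -> double_coset K (cochar w (- nu)) h.
Proof.
move=> gh hg [k kK [k' k'K ge]].
have [l [lK kl lk]] := K_inv kK; have [l' [l'K kl' lk']] := K_inv k'K.
exists l' => //; exists l => //.
have e : l' *m cochar w (- nu) *m l *m g = 1%:M.
  rewrite ge !mulmxA -[_ *m l *m k]mulmxA lk mulmx1.
  by rewrite -[_ *m _ *m cochar w nu]mulmxA (cocharNl H) mulmx1.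
by rewrite -[LHS]mul1mx -e -mulmxA gh mulmx1.
Qed.

(* The properties of the absolute value of the Dieudonne determinant that are needed; they are
   met by the determinant over [F] of the block matrix of right multiplications. *)
Definition detlike (Delta : 'M[D]_m -> R) := [/\
  forall g h, Delta (g *m h) = Delta g * Delta h, forall k, K k -> Delta k = 1,
  forall g, 0 <= Delta g & Delta w%:M != 1].

(** On cocharacters [Delta] is a homomorphism, invariant under permutations of the exponents because
    permutation matrices lie in [K]. All basis vectors thus have the same value [a], and [a = 1]
    would give [Delta w%:M = 1]. *)
Lemma detlike_cochar Delta : (0 < m)%N -> detlike Delta ->
  exists a : R, [/\ 0 < a, a != 1 &
    forall nu : 'rV[int]_m, Delta (cochar w nu) = a ^ (\sum_i nu 0 i)].
Proof.
move=> m0 [DM DK D0 Dw]; pose h (nu : 'rV[int]_m) := Delta (cochar w nu).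
have h0 : h 0 = 1 by rewrite /h cochar0 DK//; exact: (K1 H).
have hD mu nu : h (mu + nu) = h mu * h nu by rewrite /h (cocharD H) DM.
have hN nu : h nu * h (- nu) = 1 by rewrite -hD subrr.
have hne nu : h nu != 0.
  by apply/eqP => e; have := hN nu; rewrite e mul0r => /esym/eqP; rewrite oner_eq0.
have hNV nu : h (- nu) = (h nu)^-1 by apply: (mulfI (hne nu)); rewrite hN divff.
have hn nu (n : nat) : h (nu *+ n) = h nu ^+ n.
  by elim: n => [|n IH]; rewrite ?mulr0n ?h0// mulrS hD IH exprS.
have hz nu (z : int) : h (nu *~ z) = h nu ^ z.
  by case: z => n; rewrite ?NegzE ?mulrNz ?exprzN /= ?hNV -pmulrn ?hn.
have hperm (s : 'S_m) (nu : 'rV[int]_m) : h (\row_i nu 0 (s i)) = h nu.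
  rewrite /h (_ : cochar w (\row_i _) = perm_mx s *m cochar w nu *m perm_mx s^-1%g).
    by rewrite !DM !(DK (perm_mx _))// ?mul1r ?mulr1//; exact: (K_perm H).
  rewrite -mulmxA -row_permE -col_permE; apply/matrixP => i j.
  by rewrite [in RHS]mxE [in RHS]mxE !(cocharE w) mxE (inj_eq perm_inj).
pose i0 := Ordinal m0; pose d i : 'rV[int]_m := delta_mx 0 i.
have hd i : h (d i) = h (d i0).
  rewrite -(hperm (tperm i i0)); congr h; apply/rowP => j; rewrite !mxE /=.
  by rewrite (canF_eq (tpermK _ _)) tpermL.
exists (h (d i0)); have hsum nu : h nu = h (d i0) ^ (\sum_i nu 0 i).
  rewrite {1}(row_sum_delta nu) (big_morph h hD h0).
  rewrite (big_morph (fun z : int => h (d i0) ^ z) (op1 := *%R) (id1 := 1)).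
  - apply: eq_bigr => i _; rewrite -[nu 0 i]intz scaler_int hz intz.
    by rewrite -[delta_mx _ _]/(d i) hd.
  - by move=> a b; rewrite expfzDr.
  - by rewrite expr0z.
split=> //; first by rewrite lt_def hne; exact: D0.
apply: contraNneq Dw => e.
have -> : w%:M = cochar w (\row_i 1 : 'rV[int]_m).
  by apply/matrixP => i j; rewrite (cocharE w) !mxE expr1z; case: eqP.
by rewrite -/(h _) hsum e exp1rz.
Qed.

Lemma detlike_sum_eq Delta mu nu g u : (0 < m)%N -> detlike Delta ->
  Delta u = 1 -> g = cochar w mu *m u -> double_coset K (cochar w nu) g ->
  \sum_i mu 0 i = \sum_i nu 0 i.
Proof.
move=> m0 hDe Du -> [k kK [k' k'K e]].
have [a [a0 a1 ha]] := detlike_cochar m0 hDe.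
have [DM DK _ _] := hDe.
have := congr1 Delta e; rewrite !DM Du (DK k)// (DK k')// mul1r !mulr1 !ha.
by move=> /(ieexprIz a0 a1).
Qed.

Lemma double_coset_perm (s : 'S_m) (nu : 'rV[int]_m) g :
  double_coset K (cochar w (\row_i nu 0 (s i))) g -> double_coset K (cochar w nu) g.
Proof.
move=> [k kK [k' k'K ->]].
exists (k *m perm_mx s); first by apply: (KM H) => //; exact: (K_perm H).
exists (perm_mx s^-1%g *m k'); first by apply: (KM H) => //; exact: (K_perm H).
rewrite !mulmxA; congr (_ *m _); rewrite -!mulmxA; congr (_ *m _).
rewrite -row_permE -col_permE; apply/matrixP => i j.
by rewrite [in RHS]mxE [in RHS]mxE !(cocharE w) mxE (inj_eq perm_inj).
Qed.

(* Because of the diagonal entries [1], absolute values below [1] do not matter. *)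
Lemma mxle_cochar_mul mu (u : 'M[D]_m) c : (forall i, u i i = 1) ->
  mxle (cochar w mu *m u) c <->
  forall i j, rho ^ mu 0 i * Num.max 1 (nv (u i j)) <= c.
Proof.
move=> u1; split=> h i j; last first.
  rewrite (cochar_mul w) (valdivM H) (nv_unifX H); apply: le_trans (h i j).
  by rewrite ler_wpM2l ?rhoX_ge0// le_max lexx orbT.
rewrite maxr_pMr ?rhoX_ge0// ge_max; apply/andP; split.
  by have := h i i; rewrite (cochar_mul w) (valdivM H) (nv_unifX H) u1 (nv_one H).
by have := h i j; rewrite (cochar_mul w) (valdivM H) (nv_unifX H).
Qed.

Lemma mxle_mul_cochar mu (u : 'M[D]_m) c : (forall i, u i i = 1) ->
  mxle (u *m cochar w mu) c <->
  forall i j, Num.max 1 (nv (u i j)) * rho ^ mu 0 j <= c.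
Proof.
move=> u1; split=> h i j; last first.
  rewrite (mul_cochar w) (valdivM H) (nv_unifX H); apply: le_trans (h i j).
  by rewrite ler_wpM2r ?rhoX_ge0// le_max lexx orbT.
rewrite maxr_pMl ?rhoX_ge0// ge_max; apply/andP; split.
  by have := h j j; rewrite (mul_cochar w) (valdivM H) (nv_unifX H) u1 (nv_one H).
by have := h i j; rewrite (mul_cochar w) (valdivM H) (nv_unifX H).
Qed.
End DoubleCosets.

(** The Cartan decomposition puts [cochar w2 mu *m u2] in the double coset of some [nu]. The entries
    give [nu] the minimum of [la], those of the inverse its maximum, and the determinants its sum;
    so [nu] permutes [la]. *)
Lemma double_coset_transfer (R : realType) (D1 D2 : unitRingType)
  (A1 : set D1) (A2 : set D2) (nv1 : D1 -> R) (nv2 : D2 -> R) (w1 : D1) (w2 : D2)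
  (rho : R) (H1 : valdiv A1 nv1 w1 rho) (H2 : valdiv A2 nv2 w2 rho) (m : nat)
  (Delta1 : 'M[D1]_m -> R) (Delta2 : 'M[D2]_m -> R) (mu la : 'rV[int]_m)
  (u1 h1 : 'M[D1]_m) (u2 h2 : 'M[D2]_m) :
  (0 < m <= 3)%N -> detlike A1 nv1 w1 Delta1 -> detlike A2 nv2 w2 Delta2 ->
  Delta1 u1 = 1 -> Delta2 u2 = 1 -> GL m A2 u2 ->
  u1 *m h1 = 1%:M -> h1 *m u1 = 1%:M -> u2 *m h2 = 1%:M -> h2 *m u2 = 1%:M ->
  (forall i, u1 i i = 1) -> (forall i, h1 i i = 1) ->
  (forall i, u2 i i = 1) -> (forall i, h2 i i = 1) ->
  (forall i j, Num.max 1 (nv1 (u1 i j)) = Num.max 1 (nv2 (u2 i j))) ->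
  (forall i j, Num.max 1 (nv1 (h1 i j)) = Num.max 1 (nv2 (h2 i j))) ->
  double_coset (GL m (valring A1 nv1)) (cochar w1 la) (cochar w1 mu *m u1) ->
  double_coset (GL m (valring A2 nv2)) (cochar w2 la) (cochar w2 mu *m u2).
Proof.
move=> hm De1 De2 Du1 Du2 u2A uh1 hu1 uh2 hu2 du1 dh1 du2 dh2 euv ehv dc1.
have m0 : (0 < m)%N by case/andP: hm.
have [nu dc2] := cartan H2 (GLA_mul H2 (GLA_cochar H2 mu) u2A).
have inv1 (D' : unitRingType) (A : set D') nv w (H : valdiv A nv w rho) (u h : 'M[D']_m) :
    u *m h = 1%:M -> h *m u = 1%:M ->
    (cochar w mu *m u) *m (h *m cochar w (- mu)) = 1%:M /\
    (h *m cochar w (- mu)) *m (cochar w mu *m u) = 1%:M.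
  move=> uh hu; split.
    by rewrite -mulmxA [u *m _]mulmxA uh mul1mx (cocharN H).
  by rewrite -mulmxA [cochar w (- mu) *m _]mulmxA (cocharNl H) mul1mx.
have [e1 e1'] := inv1 _ _ _ _ H1 _ _ uh1 hu1.
have [e2 e2'] := inv1 _ _ _ _ H2 _ _ uh2 hu2.
have dci1 := double_coset_inv H1 e1 e1' dc1.
have dci2 := double_coset_inv H2 e2 e2' dc2.
have rX := rhoX_ge0 H1.
have hA (k : int) : (forall i, k <= la 0 i) <-> (forall i, k <= nu 0 i).
  have b1 := mxle_double_coset H1 (rX k) dc1.
  have b2 := mxle_double_coset H2 (rX k) dc2.
  have c1 := mxle_cochar_mul H1 mu (rho ^ k) du1.
  have c2 := mxle_cochar_mul H2 mu (rho ^ k) du2.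
  have e : mxle nv1 (cochar w1 mu *m u1) (rho ^ k) <-> mxle nv2 (cochar w2 mu *m u2) (rho ^ k).
    by rewrite c1 c2; split=> h i j; [have := h i j; rewrite euv|rewrite euv; exact: h].
  by split=> h i; rewrite -(ler_rhoXz H1); [apply: b2.1; apply/e/b1|apply: b1.1; apply/e/b2] => j;
    rewrite (ler_rhoXz H1).
have hB (k : int) : (forall i, la 0 i <= k) <-> (forall i, nu 0 i <= k).
  have b1 := mxle_double_coset H1 (rX (- k)) dci1.
  have b2 := mxle_double_coset H2 (rX (- k)) dci2.
  have c1 := mxle_mul_cochar H1 (- mu) (rho ^ (- k)) dh1.
  have c2 := mxle_mul_cochar H2 (- mu) (rho ^ (- k)) dh2.
  have e : mxle nv1 (h1 *m cochar w1 (- mu)) (rho ^ (- k)) <->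
      mxle nv2 (h2 *m cochar w2 (- mu)) (rho ^ (- k)).
    by rewrite c1 c2; split=> h i j; [have := h i j; rewrite ehv|rewrite ehv; exact: h].
  have lN (x : 'rV[int]_m) i : (x 0 i <= k) = (rho ^ ((- x) 0 i) <= rho ^ (- k)).
    by rewrite (ler_rhoXz H1) mxE lerN2.
  by split=> h i; rewrite lN; [apply: b2.1; apply/e/b1|apply: b1.1; apply/e/b2] => j; rewrite -lN.
have hS : \sum_i la 0 i = \sum_i nu 0 i.
  rewrite -(detlike_sum_eq H1 m0 De1 Du1 erefl dc1).
  exact: (detlike_sum_eq H2 m0 De2 Du2 erefl dc2).
have [s hs] := perm_of_extrema_sum hm hA hB hS.
apply: (double_coset_perm H2 (s := s)).
by rewrite (_ : \row_i _ = nu)//; apply/rowP => i; rewrite mxE hs.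
Qed.

(** * Digit expansions *)

(* [phi] induces an isometry between the quotients of [A1] and [A2] by the balls of radius [c]. *)
Record trunc_isometry (R : realType) (D1 D2 : zmodType) (A1 : set D1) (A2 : set D2)
    (nv1 : D1 -> R) (nv2 : D2 -> R) (c : R) (phi : D1 -> D2) : Prop := TruncIsometry {
  tiso_in : forall x, A1 x -> A2 (phi x) ;
  tiso0 : phi 0 = 0 ;
  tiso_eq : forall x y, A1 x -> A1 y -> nv1 (x - y) <= c -> phi x = phi y ;
  tiso_gt : forall x y, A1 x -> A1 y -> c < nv1 (x - y) ->
    nv2 (phi x - phi y) = nv1 (x - y) ;
  tiso_surj : forall x', A2 x' -> exists2 x, A1 x & nv2 (phi x - x') <= c
}.

Section Digits.
Context (R : realType) (D : unitRingType) (A1 A2 : set D) (nv1 nv2 : D -> R)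
  (w1 w2 : D) (rho : R) (d : nat).
Hypothesis H1 : valdiv A1 nv1 w1 rho.
Hypothesis H2 : valdiv A2 nv2 w2 rho.
Hypothesis sA : A2 `<=` A1.
Hypothesis d0 : (0 < d)%N.
Hypothesis nvd : forall x, nv1 x = nv2 x ^+ d.
Hypothesis res : forall x, A1 x -> nv1 x <= 1 ->
  exists s, [/\ A2 s, nv2 s <= 1 & nv1 (x - s) < 1].

Definition digit (x : D) : D :=
  if nv1 x < 1 then 0 else xget 0 [set s | [/\ A2 s, nv2 s <= 1 & nv1 (x - s) < 1]].

Lemma nv12_lt1 x : (nv1 x < 1) = (nv2 x < 1).
Proof. by rewrite nvd expr_lt1 ?(valdiv_ge0 H2). Qed.

Lemma nv12_le1 x : (nv1 x <= 1) = (nv2 x <= 1).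
Proof. by rewrite nvd expr_le1 ?(valdiv_ge0 H2). Qed.

Lemma nv_lt1_le_rho (A : set D) nv w x (H : valdiv A nv w rho) :
  A x -> nv x < 1 -> nv x <= rho.
Proof.
move=> Ax x1; have [->|x0] := eqVneq x 0; first by rewrite (nv0 H) ltW// (rho_gt0 H).
move: x1; have [k ->] := valdiv_discrete H Ax x0.
rewrite -[ltRHS](expr0z rho) -[leRHS]expr1z (ler_rhoXz H) ltNge (ler_rhoXz H).
by rewrite -ltNge.
Qed.

Lemma digitP x : A1 x -> nv1 x <= 1 ->
  [/\ A2 (digit x), nv2 (digit x) <= 1 & nv1 (x - digit x) < 1].
Proof.
move=> Ax x1; rewrite /digit; case: ifPn => [h|_].
  by rewrite subr0 (nv0 H2); split=> //; exact: (in0 H2).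
exact: (@xgetPex _ 0 [set s | [/\ A2 s, nv2 s <= 1 & nv1 (x - s) < 1]] (res Ax x1)).
Qed.

Lemma nv1_lt1D x y : nv1 x < 1 -> nv1 y < 1 -> nv1 (x + y) < 1.
Proof. by move=> hx hy; apply: le_lt_trans (valdivD H1 _ _) _; rewrite gt_max hx. Qed.

Lemma digit_eq x y : nv1 (x - y) < 1 -> digit x = digit y.
Proof.
move=> xy; have yx : nv1 (y - x) < 1 by rewrite (nvBC H1).
have e a b z : nv1 (a - b) < 1 -> nv1 (b - z) < 1 -> nv1 (a - z) < 1.
  by move=> ab bz; rewrite -(subrK b a) -addrA; exact: nv1_lt1D.
have e' a b : nv1 (a - b) < 1 -> nv1 b < 1 -> nv1 a < 1.
  by move=> ab b1; rewrite -(subrK b a); exact: nv1_lt1D.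
rewrite /digit (_ : (nv1 x < 1) = (nv1 y < 1)); last by apply/idP/idP; exact: e'.
case: ifP => // _; congr xget; apply/predeqP => s.
by split=> -[As s1 h]; split=> //; exact: e h.
Qed.

Lemma digit_id x : A1 x -> nv1 x <= 1 -> digit (digit x) = digit x.
Proof.
by move=> Ax x1; apply/esym/digit_eq; have [_ _] := digitP Ax x1.
Qed.

(* [expand n] replaces [w1] by [w2] in the polar part of the expansion of an [x] whose pole has
   order at most [n]. *)
Fixpoint expand (n : nat) (x : D) : D :=
  if n is n'.+1 then
    let s := digit (x * w1 ^ n) in
    s * w2 ^ (- n%:Z) + expand n' (x - s * w1 ^ (- n%:Z))
  else 0.

Local Notation r_ n := (rho ^ (- n%:Z)).

Lemma nvXK x (k : int) : nv1 (x * w1 ^ k) = nv1 x * rho ^ k.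
Proof. by rewrite (valdivM H1) (nv_unifX H1). Qed.

Lemma rhoXK (k : int) : rho ^ (- k) * rho ^ k = 1.
Proof. by rewrite -expfzDr ?gt_eqF ?(rho_gt0 H1)// addNr expr0z. Qed.

Lemma rX_gt0 (k : int) : 0 < rho ^ k.
Proof. by rewrite exprz_gt0// (rho_gt0 H1). Qed.

Lemma rhoS n : rho * r_ n.+1 = r_ n.
Proof.
rewrite -[X in X * _]expr1z -expfzDr ?gt_eqF ?(rho_gt0 H1)//.
by congr (_ ^ _); lia.
Qed.

Lemma expand_step n x : A1 x -> nv1 x <= r_ n.+1 ->
  let s := digit (x * w1 ^ n.+1) in
  [/\ A2 s, nv2 s <= 1, nv1 (x * w1 ^ n.+1 - s) < 1,
      A1 (x - s * w1 ^ (- n.+1%:Z)) & nv1 (x - s * w1 ^ (- n.+1%:Z)) <= r_ n].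
Proof.
move=> Ax hx s.
have AX : A1 (x * w1 ^ n.+1).
  by apply: (valdiv_inM H1) => //; apply: (inXz H1); exact: (in_unif H1).
have X1 : nv1 (x * w1 ^ n.+1) <= 1.
  by rewrite nvXK -(rhoXK n.+1) ler_pM2r// rX_gt0.
have [As s1 hs] := digitP AX X1; rewrite -/s in As s1 hs *.
have e : x - s * w1 ^ (- n.+1%:Z) = (x * w1 ^ n.+1 - s) * w1 ^ (- n.+1%:Z).
  by rewrite mulrBl -mulrA (unifXN H1) mulr1.
split=> //.
  rewrite e; apply: (valdiv_inM H1); last by apply: (inXz H1); exact: (in_unif H1).
  by apply: (valdiv_inB H1) => //; exact: sA.
rewrite e nvXK; apply: (@le_trans _ _ (rho * r_ n.+1)).
  rewrite ler_pM2r ?rX_gt0//; apply: (nv_lt1_le_rho H1) => //.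
  by apply: (valdiv_inB H1) => //; exact: sA.
by rewrite rhoS.
Qed.

Lemma expand_in n x : A1 x -> nv1 x <= r_ n ->
  A2 (expand n x) /\ nv2 (expand n x) <= r_ n.
Proof.
elim: n x => [|n IH] x Ax hx /=.
  by rewrite (nv0 H2) ltW ?rX_gt0//; split=> //; exact: (in0 H2).
have /= [As s1 _ A' h'] := expand_step Ax hx.
have [Ae he] := IH _ A' h'; split.
  apply: (inD H2) => //; apply: (valdiv_inM H2) => //.
  by apply: (inXz H2); exact: (in_unif H2).
apply: (nvD_le H2).
  by rewrite (valdivM H2) (nv_unifX H2) ler_piMl// ltW ?rX_gt0.
apply: le_trans he _; rewrite (ler_rhoXz H1); lia.
Qed.

(** Common leading digits cancel on both sides. At the first place where the digits differ, their
    difference has absolute value 1 and later terms are smaller, so that place determines both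
    distances. *)
Lemma expand_isometry n x y : A1 x -> A1 y -> nv1 x <= r_ n -> nv1 y <= r_ n ->
  (nv1 (x - y) <= 1 -> expand n x = expand n y) /\
  (1 < nv1 (x - y) -> nv2 (expand n x - expand n y) = nv1 (x - y)).
Proof.
elim: n x y => [|n IH] x y Ax Ay hx hy /=.
  split=> // h; have : nv1 (x - y) <= 1 by rewrite (nvB_le H1)// -[leRHS](expr0z rho).
  by rewrite leNgt h.
have /= [As s1 hs A' h'] := expand_step Ax hx.
have /= [Bs t1 ht B' g'] := expand_step Ay hy.
set s := digit (x * w1 ^ n.+1) in As s1 hs A' h' *.
set t := digit (y * w1 ^ n.+1) in Bs t1 ht B' g' *.
have [st|st] := eqVneq s t.
  have [i1 i2] := IH _ _ A' B' h' g'.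
  have e : (x - s * w1 ^ (- n.+1%:Z)) - (y - t * w1 ^ (- n.+1%:Z)) = x - y.
    by rewrite st opprB addrA subrK.
  rewrite e in i1 i2; split=> h; first by rewrite (i1 h) st.
  by rewrite -(i2 h) st opprD addrACA subrr add0r.
have XY : nv1 (x * w1 ^ n.+1 - y * w1 ^ n.+1) = 1.
  apply/eqP; rewrite eq_le; apply/andP; split; last first.
    rewrite leNgt; apply: contra st => h; apply/eqP; exact: digit_eq.
  rewrite -mulrBl nvXK -(rhoXK n.+1) ler_pM2r ?rX_gt0//.
  exact: (nvB_le H1).
have xy : nv1 (x - y) = r_ n.+1.
  apply: (mulIf (lt0r_neq0 (rX_gt0 n.+1))).
  by rewrite rhoXK -nvXK mulrBl.
have r1 : 1 < r_ n.+1.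
  by rewrite -[ltLHS](expr0z rho) ltNge (ler_rhoXz H1).
split=> [|_]; first by rewrite xy leNgt r1.
rewrite opprD addrACA -mulrBl.
(* Congruent digits would make the two scaled elements congruent, and these would then have the same
   digit. *)
have st1 : nv2 (s - t) = 1.
  apply/eqP; rewrite eq_le (nvB_le H2)//= leNgt -nv12_lt1; apply/negP => h.
  move/eqP: st; apply.
  rewrite -[s]/(digit _) -[t]/(digit _); apply: digit_eq.
  have -> : x * w1 ^ n.+1 - y * w1 ^ n.+1 =
    (x * w1 ^ n.+1 - s) + ((s - t) - (y * w1 ^ n.+1 - t)).
    by rewrite opprB [s - t + _]addrA subrK addrA subrK.
  by do 2 (apply: nv1_lt1D => //); rewrite (nvN H1).
have e : nv2 ((s - t) * w2 ^ (- n.+1%:Z)) = r_ n.+1.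
  by rewrite (valdivM H2) st1 (nv_unifX H2) mul1r.
rewrite (nvD_gt H2) ?e//; apply: (@le_lt_trans _ _ (r_ n)).
  by apply: (nvB_le H2); [case: (expand_in A' h')|case: (expand_in B' g')].
rewrite ltNge (ler_rhoXz H1); lia.
Qed.

(** The digits of [x'] with respect to [w2] are placed on powers of [w1]; [expand] recovers them
    because [digit] fixes digits. *)
Lemma expand_surj n x' : A2 x' -> nv2 x' <= r_ n ->
  exists x, [/\ A1 x, nv1 x <= r_ n & nv2 (expand n x - x') <= 1].
Proof.
elim: n x' => [|n IH] x' Ax' hx'.
  exists 0; rewrite (nv0 H1) ltW ?rX_gt0//= sub0r (nvN H2).
  by split=> //; exact: (in0 H1).
pose X := x' * w2 ^ n.+1.
have AX : A2 X by apply: (valdiv_inM H2) => //; apply: (inXz H2); exact: (in_unif H2).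
have X1 : nv1 X <= 1.
  by rewrite nv12_le1 (valdivM H2) (nv_unifX H2) -(rhoXK n.+1) ler_pM2r ?rX_gt0.
have [As s1 hs] := digitP (sA AX) X1; set s := digit X in As s1 hs *.
have e : x' - s * w2 ^ (- n.+1%:Z) = (X - s) * w2 ^ (- n.+1%:Z).
  by rewrite mulrBl -mulrA (unifXN H2) mulr1.
have Ax1' : A2 (x' - s * w2 ^ (- n.+1%:Z)).
  rewrite e; apply: (valdiv_inM H2); last by apply: (inXz H2); exact: (in_unif H2).
  exact: (valdiv_inB H2).
have [|x1 [Ax1 hx1 hsurj]] := IH _ Ax1'.
  rewrite e (valdivM H2) (nv_unifX H2); apply: (@le_trans _ _ (rho * r_ n.+1)).
    rewrite ler_pM2r ?rX_gt0//; apply: (nv_lt1_le_rho H2); last by rewrite -nv12_lt1.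
    exact: (valdiv_inB H2).
  by rewrite rhoS.
exists (x1 + s * w1 ^ (- n.+1%:Z)).
have dx : digit ((x1 + s * w1 ^ (- n.+1%:Z)) * w1 ^ n.+1) = s.
  rewrite mulrDl -mulrA -[X in s * X](unifXD H1) addNr expr0z mulr1.
  rewrite -[RHS](digit_id (sA AX) X1); apply: digit_eq; rewrite addrK.
  rewrite nvXK; apply: (@le_lt_trans _ _ (r_ n * rho ^ n.+1)).
    by rewrite ler_pM2r ?rX_gt0.
  rewrite -expfzDr ?gt_eqF ?(rho_gt0 H1)// -[ltRHS](expr0z rho) ltNge (ler_rhoXz H1); lia.
split=> /=.
- apply: (inD H1) => //; apply: (valdiv_inM H1); first exact: sA.
  by apply: (inXz H1); exact: (in_unif H1).
- apply: (nvD_le H1); first by apply: le_trans hx1 _; rewrite (ler_rhoXz H1); lia.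
  by rewrite nvXK ler_piMl ?nv12_le1// ltW// rX_gt0.
- rewrite dx addrK; have -> : s * w2 ^ (- n.+1%:Z) + expand n x1 - x' =
    expand n x1 - (x' - s * w2 ^ (- n.+1%:Z)) by rewrite opprB addrCA addrA.
  exact: hsurj.
Qed.

Lemma expand_stable n x : nv1 x <= r_ n -> expand n.+1 x = expand n x.
Proof.
move=> hx /=; rewrite (_ : digit _ = 0) ?mul0r ?subr0 ?add0r//.
rewrite /digit nvXK (_ : _ < 1)//; apply: (@le_lt_trans _ _ (r_ n * rho ^ n.+1)).
  by rewrite ler_pM2r ?rX_gt0.
rewrite -expfzDr ?gt_eqF ?(rho_gt0 H1)// -[ltRHS](expr0z rho) ltNge (ler_rhoXz H1); lia.
Qed.

(** Leading zeros contribute nothing, so the maps [expand n] agree where they overlap and glue to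
    one map on elements with arbitrary poles. *)
Lemma exists_expansion : exists phi : D -> D, trunc_isometry A1 A2 nv1 nv2 1 phi.
Proof.
have bnd (A : set D) nv w (H : valdiv A nv w rho) x : A x -> exists n : nat, nv x <= r_ n.
  move=> Ax; have [->|x0] := eqVneq x 0; first by exists 0%N; rewrite (nv0 H).
  have [k ->] := valdiv_discrete H Ax x0; exists `|k|%N.
  by rewrite (ler_rhoXz H1); lia.
have ex x : exists n : nat, A1 x -> nv1 x <= r_ n.
  by have [Ax|nA] := pselect (A1 x); [have [n hn] := bnd _ _ _ H1 _ Ax; exists n|exists 0%N].
have [nx hnx] := choice ex.
pose phi x := expand (nx x) x.
have mono n k x : nv1 x <= r_ n -> expand (k + n) x = expand n x /\ nv1 x <= r_ (k + n)%N.
  move=> hx; have h k' : nv1 x <= r_ (k' + n)%N.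
    by apply: le_trans hx _; rewrite (ler_rhoXz H1); lia.
  split=> //; elim: k => // k IH; rewrite addSn.
  by rewrite (expand_stable (h k)).
have phiE n x : A1 x -> nv1 x <= r_ n -> phi x = expand n x.
  move=> Ax hx; have hx' := hnx x Ax.
  rewrite /phi -(mono _ n _ hx').1 -[RHS](mono _ (nx x) _ hx).1.
  by rewrite addnC.
have both x y : A1 x -> A1 y -> exists n, nv1 x <= r_ n /\ nv1 y <= r_ n.
  move=> Ax Ay; exists (nx x + nx y)%N; split; last exact: (mono _ _ _ (hnx y Ay)).2.
  by rewrite addnC; exact: (mono _ _ _ (hnx x Ax)).2.
exists phi; split.
- by move=> x Ax; have [] := expand_in Ax (hnx x Ax).
- by rewrite (phiE 0%N)//; [exact: (in0 H1)|rewrite (nv0 H1)].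
- move=> x y Ax Ay h; have [n [hx hy]] := both x y Ax Ay.
  by rewrite !(phiE n)//; exact: (expand_isometry Ax Ay hx hy).1.
- move=> x y Ax Ay h; have [n [hx hy]] := both x y Ax Ay.
  by rewrite !(phiE n)//; exact: (expand_isometry Ax Ay hx hy).2.
- move=> x' Ax'; have [n hn] := bnd _ _ _ H2 _ Ax'.
  by have [x [Ax hx h]] := expand_surj Ax' hn; exists x; rewrite // (phiE n).
Qed.
End Digits.

(** * Representatives modulo balls *)

Section Representatives.
Context (R : realType) (D : unitRingType) (A : set D) (nv : D -> R)
  (w : D) (rho : R).
Hypothesis H : valdiv A nv w rho.

Lemma nvD_max a b c : nv b <= c -> Num.max c (nv (a + b)) = Num.max c (nv a).
Proof.
move=> bc; apply/eqP; rewrite eq_le !ge_max !le_max !lexx /=; apply/andP; split.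
  by have := valdivD H a b; rewrite le_max => /orP[->|/le_trans->//]; rewrite ?orbT.
rewrite -[a](addrK b); have := nvB H (a + b) b; rewrite le_max addrK.
by move=> /orP[->|/le_trans->//]; rewrite ?orbT.
Qed.

(** Choosing 0 on the ball itself ensures that every nonzero representative has absolute value above
    [c], the range in which a truncated isometry is exact. *)
Definition rep (c : R) (x : D) : D :=
  if nv x <= c then 0 else xget 0 [set y | A y /\ nv (x - y) <= c].

Lemma rep0 c : 0 <= c -> rep c 0 = 0.
Proof. by move=> c0; rewrite /rep (nv0 H) c0. Qed.

Lemma repP c x : 0 <= c -> A x -> A (rep c x) /\ nv (x - rep c x) <= c.
Proof.
move=> c0 Ax; rewrite /rep; case: ifPn => [h|_].
  by rewrite subr0; split=> //; exact: (in0 H).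
have := @xgetPex _ 0 [set y | A y /\ nv (x - y) <= c]; apply.
by exists x; rewrite /= subrr (nv0 H).
Qed.

Lemma rep_eq c x y : nv (x - y) <= c -> rep c x = rep c y.
Proof.
move=> xy; have yx : nv (y - x) <= c by rewrite (nvBC H).
have e a b z : nv (a - b) <= c -> nv (b - z) <= c -> nv (a - z) <= c.
  by move=> ab bz; rewrite -(subrK b a) -addrA; exact: (nvD_le H).
have e' a b : nv (a - b) <= c -> nv b <= c -> nv a <= c.
  by move=> ab b1; rewrite -(subrK b a); exact: (nvD_le H).
rewrite /rep (_ : (nv x <= c) = (nv y <= c)); last by apply/idP/idP; exact: e'.
case: ifP => // _; congr xget; apply/predeqP => s.
by split=> -[As h]; split=> //; exact: e h.
Qed.

Lemma rep_id c x : 0 <= c -> A x -> rep c (rep c x) = rep c x.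
Proof. by move=> c0 Ax; apply/esym/rep_eq; case: (repP c0 Ax). Qed.

Lemma rep_le c x : 0 <= c -> A x -> nv (rep c x) <= c -> rep c x = 0.
Proof. by move=> c0 Ax h; rewrite -(rep_id c0 Ax) /rep h. Qed.

End Representatives.

Section TruncatedIsometries.
Context (R : realType) (D : unitRingType) (A1 A2 : set D) (nv1 nv2 : D -> R)
  (w1 w2 : D) (rho : R).
Hypothesis H1 : valdiv A1 nv1 w1 rho.
Hypothesis H2 : valdiv A2 nv2 w2 rho.

(** Multiplication by [w1 ^ (- k)] before and [w2 ^ k] after changes the level from 1 to [rho ^ k],
    because both uniformizers have absolute value [rho]. *)
Lemma tiso_scale (k : int) : (exists phi, trunc_isometry A1 A2 nv1 nv2 1 phi) ->
  exists phi, trunc_isometry A1 A2 nv1 nv2 (rho ^ k) phi.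
Proof.
move=> [phi [i1 i2 i3 i4 i5]].
have r0 : 0 < rho ^ k by rewrite exprz_gt0// (rho_gt0 H1).
have rN : rho ^ (- k) * rho ^ k = 1 by exact: (rhoXK H1).
have wk1 x l : A1 x -> A1 (x * w1 ^ l).
  by move=> Ax; apply: (valdiv_inM H1) => //; apply: (inXz H1); exact: (in_unif H1).
have wk2 x l : A2 x -> A2 (x * w2 ^ l).
  by move=> Ax; apply: (valdiv_inM H2) => //; apply: (inXz H2); exact: (in_unif H2).
have n1 x : nv1 (x * w1 ^ (- k)) * rho ^ k = nv1 x.
  by rewrite (valdivM H1) (nv_unifX H1) -mulrA rN mulr1.
exists (fun x => phi (x * w1 ^ (- k)) * w2 ^ k); split.
- by move=> x Ax; apply: wk2; apply: i1; exact: wk1.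
- by rewrite mul0r i2 mul0r.
- move=> x y Ax Ay h; congr (_ * _); apply: i3; try exact: wk1.
  by rewrite -mulrBl -(ler_pM2r r0) n1 mul1r.
- move=> x y Ax Ay h; rewrite -mulrBl (valdivM H2) i4; try exact: wk1.
    by rewrite -mulrBl (nv_unifX H2) n1.
  by rewrite -mulrBl -(ltr_pM2r r0) n1 mul1r.
- move=> x' Ax'; have [x Ax hx] := i5 _ (wk2 x' (- k) Ax').
  exists (x * w1 ^ k); first exact: wk1.
  rewrite -mulrA (unifXN H1) mulr1.
  have -> : phi x * w2 ^ k - x' = (phi x - x' * w2 ^ (- k)) * w2 ^ k.
    by rewrite mulrBl -[x' * _ * _]mulrA -(unifXD H2) addNr expr0z mulr1.
  by rewrite (valdivM H2) (nv_unifX H2) -[leRHS]mul1r ler_pM2r.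
Qed.

Section Level.
Variables (c : R) (phi : D -> D).
Hypothesis c0 : 0 <= c.
Hypothesis T : trunc_isometry A1 A2 nv1 nv2 c phi.

Lemma tiso_max x y : A1 x -> A1 y ->
  Num.max c (nv2 (phi x - phi y)) = Num.max c (nv1 (x - y)).
Proof.
move=> Ax Ay; have [h|h] := ltP c (nv1 (x - y)).
  by rewrite (tiso_gt T) ?max_r// ltW.
by rewrite (tiso_eq T Ax Ay h) subrr (nv0 H2) max_l.
Qed.

Lemma tiso_le x y : A1 x -> A1 y -> nv2 (phi x - phi y) <= c -> nv1 (x - y) <= c.
Proof.
move=> Ax Ay h; rewrite leNgt; apply/negP => lt.
by move: h; rewrite (tiso_gt T)// leNgt lt.
Qed.

Lemma tiso_rep x : A1 x -> nv2 (phi (rep A1 nv1 c x)) = nv1 (rep A1 nv1 c x).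
Proof.
move=> Ax; have [Ar _] := repP H1 c0 Ax.
have [h|h] := ltP c (nv1 (rep A1 nv1 c x)).
  by rewrite -[X in nv2 X]subr0 -(tiso0 T) (tiso_gt T) ?subr0//; exact: (in0 H1).
by rewrite (rep_le H1 c0 Ax h) (tiso0 T) (nv0 H1) (nv0 H2).
Qed.

(* Left multiplication by [p' / phi p], an element of norm [1], moves [phi p] to [p']. *)
Lemma tiso_through p p' : A1 p -> A2 p' -> nv1 p = nv2 p' ->
  exists psi, trunc_isometry A1 A2 nv1 nv2 c psi /\ nv2 (psi p - p') <= c.
Proof.
move=> Ap Ap' pp'; have [h|h] := leP (nv1 p) c.
  exists phi; split=> //; apply: (nvB_le H2); last by rewrite -pp'.
  have -> : phi p = 0; last by rewrite (nv0 H2).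
  by rewrite -(tiso0 T); apply: (tiso_eq T) => //; rewrite ?subr0//; exact: (in0 H1).
have nphi : nv2 (phi p) = nv1 p.
  by rewrite -[X in nv2 X]subr0 -(tiso0 T) (tiso_gt T) ?subr0//; exact: (in0 H1).
have p0 : 0 < nv1 p by apply: le_lt_trans h.
have phiU : phi p \is a GRing.unit by rewrite (valdiv_unit H2)// -(nv_gt0 H2) nphi.
have Aphi := tiso_in T Ap.
pose e := p' / phi p.
have Ae : A2 e by apply: (valdiv_inM H2) => //; exact: (valdiv_inV H2).
have ne : nv2 e = 1 by rewrite (valdivM H2) (nvV H2) nphi pp' divff// gt_eqF// -pp'.
have eU : e \is a GRing.unit by rewrite (valdiv_unit H2)// -(nv_gt0 H2) ne.
exists (fun x => e * phi x); split; last by rewrite /e divrK// subrr (nv0 H2).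
split.
- by move=> x Ax; apply: (valdiv_inM H2) => //; exact: (tiso_in T).
- by rewrite (tiso0 T) mulr0.
- by move=> x y Ax Ay hxy; rewrite (tiso_eq T Ax Ay hxy).
- by move=> x y Ax Ay hxy; rewrite -mulrBr (valdivM H2) ne mul1r; exact: (tiso_gt T).
- move=> x' Ax'; have [|x Ax hx] := tiso_surj T (_ : A2 (e^-1 * x')).
    by apply: (valdiv_inM H2) => //; exact: (valdiv_inV H2).
  exists x => //; have -> : e * phi x - x' = e * (phi x - e^-1 * x').
    by rewrite mulrBr mulVKr.
  by rewrite (valdivM H2) ne mul1r.
Qed.
End Level.
End TruncatedIsometries.

(** * Lower unipotent matrices of size at most 3 *)

Section Coordinates.
Context (D : unitRingType) (m : nat).
Hypothesis hm : (0 < m <= 3)%N.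
Implicit Types (u : 'M[D]_m) (x y z : D).

(** Entries outside the matrix read as 0, so three coordinates exist for every [m] and one argument
    covers sizes 1, 2 and 3. *)
Definition ent u (i j : nat) : D :=
  if (insub i : option 'I_m) is Some i' then
    if (insub j : option 'I_m) is Some j' then u i' j' else 0
  else 0.

Definition cx u := ent u 1 0.
Definition cy u := ent u 2 1.
Definition cz u := ent u 2 0.

(* For [m < 3] the coordinates that do not fit are ignored. *)
Definition Lmx x y z : 'M[D]_m := \matrix_(i, j)
  if i == j :> nat then 1 else if (i < j)%N then 0 else
  if i == 1%N :> nat then x else if j == 1%N :> nat then y else z.

Lemma entE u (i j : 'I_m) : ent u i j = u i j.
Proof. by rewrite /ent !valK. Qed.

Lemma ent_out u i j : (m <= i)%N -> ent u i j = 0.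
Proof. by move=> h; rewrite /ent insubF// ltnNge h. Qed.

Lemma cxE u (i j : 'I_m) : i = 1%N :> nat -> j = 0%N :> nat -> cx u = u i j.
Proof. by rewrite /cx => <- <-; rewrite entE. Qed.
Lemma cyE u (i j : 'I_m) : i = 2%N :> nat -> j = 1%N :> nat -> cy u = u i j.
Proof. by rewrite /cy => <- <-; rewrite entE. Qed.
Lemma czE u (i j : 'I_m) : i = 2%N :> nat -> j = 0%N :> nat -> cz u = u i j.
Proof. by rewrite /cz => <- <-; rewrite entE. Qed.

Lemma cxL x y z : cx (Lmx x y z) = if (1 < m)%N then x else 0.
Proof.
case: ltnP => h; last exact: ent_out.
by rewrite (@cxE _ (Ordinal h) (Ordinal (ltnW h)))// mxE.
Qed.

Lemma cyL x y z : cy (Lmx x y z) = if (2 < m)%N then y else 0.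
Proof.
case: ltnP => h; last exact: ent_out.
by rewrite (@cyE _ (Ordinal h) (Ordinal (ltnW h)))// mxE.
Qed.

Lemma czL x y z : cz (Lmx x y z) = if (2 < m)%N then z else 0.
Proof.
case: ltnP => h; last exact: ent_out.
by rewrite (@czE _ (Ordinal h) (Ordinal (ltn_trans (ltn0Sn 1) h)))// mxE.
Qed.

Lemma Lmx_coord u : is_trig_mx u -> (forall i, u i i = 1) ->
  u = Lmx (cx u) (cy u) (cz u).
Proof.
move=> /is_trig_mxP ut u1; apply/matrixP => i j; rewrite mxE.
case: eqP => [/val_inj->//|/eqP ij].
case: ltnP => [/ut//|ji].
have [hi hj] := (ltn_ord i, ltn_ord j).
case: eqP => [i1|/eqP i1]; first by apply/esym/cxE => //; lia.
by case: eqP => [j1|/eqP j1]; apply/esym; [apply: cyE|apply: czE] => //; lia.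
Qed.

Lemma Lmx_trig x y z : is_trig_mx (Lmx x y z).
Proof. by apply/is_trig_mxP => i j ij; rewrite mxE ij ltn_eqF. Qed.

Lemma Lmx_diag x y z i : Lmx x y z i i = 1.
Proof. by rewrite mxE eqxx. Qed.

Lemma Lmx0 : Lmx 0 0 0 = 1%:M.
Proof.
apply/matrixP => i j; rewrite !mxE; case: (altP (i =P j)) => [->|ij]; first by rewrite eqxx.
by rewrite ifN//; do 3 case: ifP => //.
Qed.

End Coordinates.

Lemma LmxM (D : unitRingType) m (x y z x' y' z' : D) : (0 < m <= 3)%N ->
  Lmx m x y z *m Lmx m x' y' z' = Lmx m (x + x') (y + y') (z + y * x' + z').
Proof.
case: m => [|[|[|[|]]]]// _; apply/matrixP => i j; rewrite !mxE !big_ord_recl !big_ord0 !mxE /=.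
- case: i => [[|i]]// ?; case: j => [[|j]]// ?.
  by rewrite /= mulr1 addr0.
- by case: i => [[|[|i]]]// ?; case: j => [[|[|j]]]// ?;
  rewrite /= ?(mul0r, mulr0, mul1r, mulr1, addr0, add0r).
- by case: i => [[|[|[|i]]]]// ?; case: j => [[|[|[|j]]]]// ?;
  rewrite /= ?(mul0r, mulr0, mul1r, mulr1, addr0, add0r, addrA).
Qed.

Section Unipotent.
Context (R : realType) (D : unitRingType) (A : set D) (nv : D -> R)
  (w : D) (rho : R) (m : nat).
Hypothesis H : valdiv A nv w rho.
Hypothesis hm : (0 < m <= 3)%N.
Local Notation U := (lower_unip m A).
Local Notation L := (@Lmx D m).

(** The corner entry of the inverse is the origin of the fourth quantity to be preserved. *)
Lemma LmxV x y z : L x y z *m L (- x) (- y) (y * x - z) = 1%:M.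
Proof. by rewrite LmxM// !subrr mulrN addrA subrK subrr Lmx0. Qed.

Lemma LmxVl x y z : L (- x) (- y) (y * x - z) *m L x y z = 1%:M.
Proof. by rewrite LmxM// !addNr mulNr [X in X + z]addrAC subrr sub0r addNr Lmx0. Qed.

Lemma Lmx_in (S : set D) x y z : S 0 -> S 1 -> S x -> S y -> S z ->
  forall i j, S (L x y z i j).
Proof. by move=> S0 S1 Sx Sy Sz i j; rewrite mxE; do 4 case: ifP => // _. Qed.

Lemma Lmx_GL (S : set D) x y z : S 0 -> S 1 -> S x -> S y -> S z ->
  S (- x) -> S (- y) -> S (y * x - z) -> GL m S (L x y z).
Proof.
move=> *; split; first exact: Lmx_in.
exists (L (- x) (- y) (y * x - z)); split; first exact: Lmx_in.
  exact: LmxV.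
exact: LmxVl.
Qed.

Lemma Lmx_U x y z : A x -> A y -> A z -> U (L x y z).
Proof.
move=> Ax Ay Az; split; [|exact: Lmx_trig|exact: Lmx_diag].
apply: Lmx_GL => //; try exact: (inN H).
- exact: (in0 H).
- exact: (valdiv_in1 H).
- by apply: (valdiv_inB H) => //; exact: (valdiv_inM H).
Qed.

Lemma ent_in u i j : U u -> A (ent u i j).
Proof.
move=> [[uA _] _ _]; rewrite /ent.
by case: insub => [i'|]; [case: insub => [j'|]|]; [exact: uA|exact: (in0 H)|exact: (in0 H)].
Qed.

Lemma UL u : U u -> u = L (cx u) (cy u) (cz u).
Proof. by move=> [_ ut u1]; exact: Lmx_coord. Qed.

Lemma U_ext u u' : U u -> U u' -> cx u = cx u' -> cy u = cy u' -> cz u = cz u' -> u = u'.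
Proof. by move=> uU u'U ex ey ez; rewrite (UL uU) (UL u'U) ex ey ez. Qed.

Lemma U1 : U 1%:M.
Proof. by rewrite -Lmx0; apply: Lmx_U; exact: (in0 H). Qed.

Lemma UM u u' : U u -> U u' -> [/\ U (u *m u'), cx (u *m u') = cx u + cx u',
  cy (u *m u') = cy u + cy u' & cz (u *m u') = cz u + cy u * cx u' + cz u'].
Proof.
move=> uU u'U.
have -> : u *m u' = L (cx u + cx u') (cy u + cy u') (cz u + cy u * cx u' + cz u').
  by rewrite [in LHS](UL uU) [in LHS](UL u'U) LmxM.
rewrite cxL cyL czL; split.
- apply: Lmx_U; repeat (apply: (inD H) || apply: (valdiv_inM H)); exact: ent_in.
- by case: ltnP => // h; rewrite /cx !ent_out// addr0.
- by case: ltnP => // h; rewrite /cy !ent_out// addr0.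
- by case: ltnP => // h; rewrite /cz /cy !ent_out// mul0r !addr0.
Qed.

Section Subgroups.
Variables (c1 c2 c3 : R).
Hypotheses (c1_ge0 : 0 <= c1) (c2_ge0 : 0 <= c2) (c3_ge0 : 0 <= c3) (c123 : c2 * c1 <= c3).

(** The condition [c2 * c1 <= c3] accounts for the product [y * x'] in the group law. Radii 1 give
    the intersection with [K] ([U_GL]), other radii its conjugates by cocharacters ([conj_subU]). *)
Definition subU : set 'M[D]_m :=
  [set u | U u /\ [/\ nv (cx u) <= c1, nv (cy u) <= c2 & nv (cz u) <= c3]].
Local Notation N := subU.

Lemma prod_le3 y x : nv y <= c2 -> nv x <= c1 -> nv (y * x) <= c3.
Proof.
move=> hy hx; rewrite (valdivM H); apply: le_trans c123.
by rewrite ler_pM ?(valdiv_ge0 H).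
Qed.

Lemma subU1 : N 1%:M.
Proof.
split; first exact: U1.
by rewrite -Lmx0 cxL cyL czL !if_same (nv0 H).
Qed.

Lemma subU_mul u u' : N u -> N u' -> N (u *m u').
Proof.
move=> [uU [ux uy uz]] [u'U [ux' uy' uz']].
have [uuU ex ey ez] := UM uU u'U; split=> //; rewrite ex ey ez.
by split; repeat apply: (nvD_le H) => //; exact: prod_le3.
Qed.

(** The three differences are the coordinates of [u^-1 u']. *)
Lemma coset_crit u u' : U u -> U u' ->
  (exists2 k, N k & u' = u *m k) <->
  [/\ nv (cx u' - cx u) <= c1, nv (cy u' - cy u) <= c2 &
      nv (cz u' - cz u - cy u * (cx u' - cx u)) <= c3].
Proof.
move=> uU u'U; split=> [[k [kU [kx ky kz]] ->]|[hx hy hz]].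
  have [_ -> -> ->] := UM uU kU.
  rewrite ![_ + cx k - _]addrAC ![_ + cy k - _]addrAC !subrr !add0r.
  split=> //; have e (a b c : D) : a + b + c - a - b = c.
    by rewrite -[a + b + c]addrA [a + _]addrC addrK [b + c]addrC addrK.
  by rewrite e.
have Ac i j v : U v -> A (ent v i j) by exact: ent_in.
pose k := L (cx u' - cx u) (cy u' - cy u) (cz u' - cz u - cy u * (cx u' - cx u)).
have kU : U k.
  by apply: Lmx_U; repeat (apply: (valdiv_inB H) || apply: (valdiv_inM H)); exact: Ac.
have [ex ey ez] : [/\ cx k = cx u' - cx u, cy k = cy u' - cy u &
    cz k = cz u' - cz u - cy u * (cx u' - cx u)].
  rewrite /k cxL cyL czL; split; case: ltnP => // h; rewrite /cx /cy /cz.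
  - by rewrite !(ent_out _ _ h) subrr.
  - by rewrite !(ent_out _ _ h) subrr.
  - by rewrite !(ent_out _ _ h) mul0r !subrr.
exists k; first by split=> //; rewrite ex ey ez.
have [ukU e1 e2 e3] := UM uU kU.
apply: U_ext => //; rewrite ?e1 ?e2 ?e3 ?ex ?ey ?ez.
- by rewrite addrC subrK.
- by rewrite addrC subrK.
- by rewrite addrC -[_ - _ - _]addrA -opprD subrK.
Qed.

Lemma subU_inv u : N u -> exists2 u', N u' & u *m u' = 1%:M.
Proof.
move=> [uU [ux uy uz]]; suff /(coset_crit uU U1)[k Nk e] : 
    [/\ nv (cx (1%:M : 'M[D]_m) - cx u) <= c1, nv (cy (1%:M : 'M[D]_m) - cy u) <= c2 &
      nv (cz (1%:M : 'M[D]_m) - cz u - cy u * (cx (1%:M : 'M[D]_m) - cx u)) <= c3].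
  by exists k.
have -> : cx (1%:M : 'M[D]_m) = 0 by rewrite -Lmx0 cxL if_same.
have -> : cy (1%:M : 'M[D]_m) = 0 by rewrite -Lmx0 cyL if_same.
have -> : cz (1%:M : 'M[D]_m) = 0 by rewrite -Lmx0 czL if_same.
rewrite !sub0r mulrN opprK !(nvN H); split=> //.
by apply: (nvD_le H); [rewrite (nvN H)|exact: prod_le3].
Qed.
End Subgroups.
End Unipotent.

(** * Bijections of cosets *)

Section CosetMap.
Context (R : realType) (D : unitRingType) (A1 A2 : set D) (nv1 nv2 : D -> R)
  (w1 w2 : D) (rho : R) (m : nat).
Hypothesis H1 : valdiv A1 nv1 w1 rho.
Hypothesis H2 : valdiv A2 nv2 w2 rho.
Hypothesis hm : (0 < m <= 3)%N.
Hypothesis iso : exists phi, trunc_isometry A1 A2 nv1 nv2 1 phi.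
Variables (k1 k2 k3 : int).
Hypothesis k123 : (k3 <= k2 + k1).
Let c1 := rho ^ k1.
Let c2 := rho ^ k2.
Let c3 := rho ^ k3.
Local Notation U1 := (lower_unip m A1).
Local Notation U2 := (lower_unip m A2).
Local Notation N1 := (subU A1 nv1 (m := m) c1 c2 c3).
Local Notation N2 := (subU A2 nv2 (m := m) c1 c2 c3).

(** These are the entries, up to sign, of the two matrices and of their inverses. The first two
    agree exactly, as isometries do on representatives ([tiso_rep]); the corner entries can be
    compared only above the level [c]. *)
Definition matched (c : R) (u u' : 'M[D]_m) := [/\ nv1 (cx u) = nv2 (cx u'),
  nv1 (cy u) = nv2 (cy u'), Num.max c (nv1 (cz u)) = Num.max c (nv2 (cz u'))
  & Num.max c (nv1 (cy u * cx u - cz u)) = Num.max c (nv2 (cy u' * cx u' - cz u'))].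

(* [f] acts on the representative [(r1 x, r2 y, zt)] of the coset of [u = (x, y, z)]; the isometry
   applied to the last coordinate depends on [x] and [y], as it has to map [r2 y * r1 x] to the
   product of the images of [r2 y] and [r1 x]. *)
Lemma coset_map : exists f : 'M[D]_m -> 'M[D]_m, [/\
  forall u, U1 u -> U2 (f u),
  forall u u', U1 u -> U1 u' ->
    (exists2 k, N1 k & u' = u *m k) <-> (exists2 k, N2 k & f u' = f u *m k),
  forall u', U2 u' -> exists2 u, U1 u & exists2 k, N2 k & u' = f u *m k &
  forall u, U1 u -> exists2 k, N1 k & matched c3 (u *m k) (f u)].
Proof.
have [c10 c20 c30] : [/\ 0 <= c1, 0 <= c2 & 0 <= c3] by split; exact: rhoX_ge0 H1 _.
have c123 : c2 * c1 <= c3.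
  by rewrite /c1 /c2 -expfzDr ?gt_eqF ?(rho_gt0 H1)// (ler_rhoXz H1).
have [p1 T1] := tiso_scale H1 H2 k1 iso; rewrite -/c1 in T1.
have [p2 T2] := tiso_scale H1 H2 k2 iso; rewrite -/c2 in T2.
have [p3 T3] := tiso_scale H1 H2 k3 iso; rewrite -/c3 in T3.
pose r1 := rep A1 nv1 c1; pose r2 := rep A1 nv1 c2.
have Ar1 x : A1 x -> A1 (r1 x) by move=> Ax; case: (repP H1 c10 Ax).
have Ar2 x : A1 x -> A1 (r2 x) by move=> Ax; case: (repP H1 c20 Ax).
have lr1 x : A1 x -> nv1 (x - r1 x) <= c1 by move=> Ax; case: (repP H1 c10 Ax).
have lr2 x : A1 x -> nv1 (x - r2 x) <= c2 by move=> Ax; case: (repP H1 c20 Ax).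
have r10 : r1 0 = 0 by exact: (rep0 H1).
have r20 : r2 0 = 0 by exact: (rep0 H1).
have ex (yx : D * D) : exists psi, A1 yx.1 -> A1 yx.2 ->
    trunc_isometry A1 A2 nv1 nv2 c3 psi /\
    nv2 (psi (r2 yx.1 * r1 yx.2) - p2 (r2 yx.1) * p1 (r1 yx.2)) <= c3.
  case: yx => y x /=.
  have [[Ay Ax]|nA] := pselect (A1 y /\ A1 x); last by exists id => ? ?; exfalso; apply: nA.
  have [|||psi h] := @tiso_through _ _ _ _ _ _ _ _ _ H1 H2 c3 p3 c30 T3
    (r2 y * r1 x) (p2 (r2 y) * p1 (r1 x)).
  - by apply: (valdiv_inM H1); [exact: Ar2|exact: Ar1].
  - by apply: (valdiv_inM H2); [apply: (tiso_in T2); exact: Ar2|apply: (tiso_in T1); exact: Ar1].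
  - by rewrite (valdivM H1) (valdivM H2) (tiso_rep H1 H2 c10 T1 Ax) (tiso_rep H1 H2 c20 T2 Ay).
  by exists psi.
have [ps hps] := choice ex.
have Tps y x : A1 y -> A1 x -> trunc_isometry A1 A2 nv1 nv2 c3 (ps (y, x)).
  by move=> Ay Ax; case: (hps (y, x) Ay Ax).
have Lps y x : A1 y -> A1 x -> nv2 (ps (y, x) (r2 y * r1 x) - p2 (r2 y) * p1 (r1 x)) <= c3.
  by move=> Ay Ax; case: (hps (y, x) Ay Ax).
(* Moving x to [r1 x] inside the coset shifts z by [- y * (x - r1 x)]. Writing [r2 y] for [y] here
   changes this by at most [c2 * c1 <= c3]. *)
pose zt (u : 'M[D]_m) := cz u - r2 (cy u) * (cx u - r1 (cx u)).
(* [ps] is indexed by representatives, so that all elements of a coset use the same isometry. *)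
pose f (u : 'M[D]_m) : 'M[D]_m := Lmx m (p1 (r1 (cx u))) (p2 (r2 (cy u)))
  (ps (r2 (cy u), r1 (cx u)) (zt u)).
have Ac u : U1 u -> [/\ A1 (cx u), A1 (cy u) & A1 (cz u)] by move=> uU; split; exact: (ent_in H1).
have Azt u : U1 u -> A1 (zt u).
  move=> /Ac[Ax Ay Az]; apply: (valdiv_inB H1) => //; apply: (valdiv_inM H1); first exact: Ar2.
  by apply: (valdiv_inB H1) => //; exact: Ar1.
have Tf u : U1 u -> trunc_isometry A1 A2 nv1 nv2 c3 (ps (r2 (cy u), r1 (cx u))).
  by move=> /Ac[Ax Ay _]; apply: Tps; [exact: Ar2|exact: Ar1].
have fc u : U1 u -> [/\ cx (f u) = p1 (r1 (cx u)), cy (f u) = p2 (r2 (cy u)) &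
    cz (f u) = ps (r2 (cy u), r1 (cx u)) (zt u)].
  move=> uU; rewrite /f cxL cyL czL; split; case: ltnP => // h.
  - by rewrite /cx !(ent_out _ _ h) r10 (tiso0 T1).
  - by rewrite /cy !(ent_out _ _ h) r20 (tiso0 T2).
  - rewrite [X in ps _ X](_ : _ = 0) ?(tiso0 (Tf u uU))//.
    by rewrite /zt /cz /cy !(ent_out _ _ h) r20 mul0r subrr.
have fU u : U1 u -> U2 (f u).
  move=> uU; have [Ax Ay Az] := Ac u uU; apply: (Lmx_U H2 hm).
  - by apply: (tiso_in T1); exact: Ar1.
  - by apply: (tiso_in T2); exact: Ar2.
  - by apply: (tiso_in (Tf u uU)); exact: Azt.
exists f; split=> //.
- move=> u u' uU u'U; have [Ax Ay Az] := Ac u uU; have [Ax' Ay' Az'] := Ac u' u'U.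
  have [ex1 ey1 ez1] := fc u uU; have [ex2 ey2 ez2] := fc u' u'U.
  (* Once x and y agree up to their levels, the twisted condition on z becomes mere closeness of the
     [zt]: the two differ by [(y - r2 y) * (x' - x)], which is within [c3]. *)
  have key : r1 (cx u') = r1 (cx u) -> r2 (cy u') = r2 (cy u) ->
      (nv1 (cz u' - cz u - cy u * (cx u' - cx u)) <= c3 <-> nv1 (zt u' - zt u) <= c3).
    move=> er1 er2.
    have lx : nv1 (cx u' - cx u) <= c1.
      have -> : cx u' - cx u = (cx u' - r1 (cx u')) - (cx u - r1 (cx u)).
        by rewrite er1 opprB addrA subrK.
      by apply: (nvB_le H1); exact: lr1.
    have l : nv1 ((cy u - r2 (cy u)) * (cx u' - cx u)) <= c3.
      by apply: (prod_le3 H1 c123) => //; exact: lr2.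
    have -> : zt u' - zt u = cz u' - cz u - cy u * (cx u' - cx u) +
        (cy u - r2 (cy u)) * (cx u' - cx u).
      rewrite mulrBl addrA subrK /zt er1 er2.
      have -> : r2 (cy u) * (cx u' - cx u) =
          r2 (cy u) * (cx u' - r1 (cx u)) - r2 (cy u) * (cx u - r1 (cx u)).
        by rewrite -mulrBr opprB addrA subrK.
      by rewrite !opprB addrACA [RHS]addrACA [- cz u + _]addrC.
    split=> h; first exact: (nvD_le H1).
    rewrite -[X in nv1 X](addrK ((cy u - r2 (cy u)) * (cx u' - cx u))).
    exact: (nvB_le H1).
  rewrite (coset_crit H1 hm c1 c2 c3 uU u'U).
  rewrite (coset_crit H2 hm c1 c2 c3 (fU u uU) (fU u' u'U)).
  rewrite ex1 ey1 ez1 ex2 ey2 ez2; split=> [[hx hy hz]|[hx hy hz]].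
    have er1 : r1 (cx u') = r1 (cx u) by exact: (rep_eq H1).
    have er2 : r2 (cy u') = r2 (cy u) by exact: (rep_eq H1).
    have ez : nv1 (zt u' - zt u) <= c3 by apply/key.
    rewrite er1 er2 !subrr mulr0 subr0 (nv0 H2); split=> //.
    by rewrite (tiso_eq (Tf u uU) (Azt u' u'U) (Azt u uU) ez) subrr (nv0 H2).
  have er1 : r1 (cx u') = r1 (cx u).
    rewrite -[LHS](rep_id H1 c10 Ax') -[RHS](rep_id H1 c10 Ax); apply: (rep_eq H1).
    by apply: (tiso_le T1) => //; exact: Ar1.
  have er2 : r2 (cy u') = r2 (cy u).
    rewrite -[LHS](rep_id H1 c20 Ay') -[RHS](rep_id H1 c20 Ay); apply: (rep_eq H1).
    by apply: (tiso_le T2) => //; exact: Ar2.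
  move: hz; rewrite er1 er2 subrr mulr0 subr0 => hz; split.
  - have -> : cx u' - cx u = (cx u' - r1 (cx u')) - (cx u - r1 (cx u)).
      by rewrite er1 opprB addrA subrK.
    by apply: (nvB_le H1); exact: lr1.
  - have -> : cy u' - cy u = (cy u' - r2 (cy u')) - (cy u - r2 (cy u)).
      by rewrite er2 opprB addrA subrK.
    by apply: (nvB_le H1); exact: lr2.
  - apply/key => //; apply: (tiso_le (Tf u uU)) => //; exact: Azt.
- move=> u' u'U.
  have [Bx By Bz] : [/\ A2 (cx u'), A2 (cy u') & A2 (cz u')] by split; exact: (ent_in H2).
  (* The preimage coordinates are chosen as representatives, fixed by [r1] and [r2], and as 0 where
     the matrix has no room for them, so that [Lmx] loses nothing. *)
  have [a [Aa ra ha ma]] : exists a, [/\ A1 a, r1 a = a, nv2 (cx u' - p1 a) <= c1 &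
      (m <= 1)%N -> a = 0].
    have [h|h] := leqP m 1.
      exists 0; split=> //; first exact: (in0 H1).
      by rewrite (tiso0 T1) /cx (ent_out _ _ h) subr0 (nv0 H2).
    have [x Ax hx] := tiso_surj T1 Bx; exists (r1 x); split=> //; first exact: Ar1.
      exact: (rep_id H1 c10 Ax).
    by rewrite -(tiso_eq T1 Ax (Ar1 x Ax) (lr1 x Ax)) (nvBC H2).
  have [b [Ab rb hb mb]] : exists b, [/\ A1 b, r2 b = b, nv2 (cy u' - p2 b) <= c2 &
      (m <= 2)%N -> b = 0].
    have [h|h] := leqP m 2.
      exists 0; split=> //; first exact: (in0 H1).
      by rewrite (tiso0 T2) /cy (ent_out _ _ h) subr0 (nv0 H2).
    have [x Ax hx] := tiso_surj T2 By; exists (r2 x); split=> //; first exact: Ar2.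
      exact: (rep_id H1 c20 Ax).
    by rewrite -(tiso_eq T2 Ax (Ar2 x Ax) (lr2 x Ax)) (nvBC H2).
  have [z [Az hz mz]] : exists z, [/\ A1 z,
      nv2 (cz u' - ps (b, a) z - p2 b * (cx u' - p1 a)) <= c3 & (m <= 2)%N -> z = 0].
    have [h|h] := leqP m 2.
      exists 0; split=> //; first exact: (in0 H1).
      rewrite (tiso0 (Tps b a Ab Aa)) (mb h) (tiso0 T2) /cz (ent_out _ _ h).
      by rewrite mul0r !subr0 (nv0 H2).
    have Bt : A2 (cz u' - p2 b * (cx u' - p1 a)).
      apply: (valdiv_inB H2) => //; apply: (valdiv_inM H2); first exact: (tiso_in T2).
      by apply: (valdiv_inB H2) => //; exact: (tiso_in T1).
    have [z Az hz] := tiso_surj (Tps b a Ab Aa) Bt; exists z; split=> //.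
    by rewrite addrAC (nvBC H2).
  have uU : U1 (Lmx m a b z) by exact: (Lmx_U H1 hm).
  exists (Lmx m a b z) => //.
  have ea : cx (Lmx m a b z) = a by rewrite cxL; case: ltnP => // /ma.
  have eb : cy (Lmx m a b z) = b by rewrite cyL; case: ltnP => // /mb.
  have ez : cz (Lmx m a b z) = z by rewrite czL; case: ltnP => // /mz.
  apply/(coset_crit H2 hm c1 c2 c3 (fU _ uU) u'U).
  have [-> -> ->] := fc _ uU.
  by rewrite /zt ea eb ez ra rb subrr mulr0 subr0.
- move=> u uU; have [Ax Ay Az] := Ac u uU.
  pose v := Lmx m (r1 (cx u)) (r2 (cy u)) (zt u).
  have vU : U1 v by apply: (Lmx_U H1 hm); [exact: Ar1|exact: Ar2|exact: Azt].
  have [ea eb ez] : [/\ cx v = r1 (cx u), cy v = r2 (cy u) & cz v = zt u].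
    rewrite /v cxL cyL czL; split; case: ltnP => // h.
    - by rewrite /cx (ent_out _ _ h) r10.
    - by rewrite /cy (ent_out _ _ h) r20.
    - by rewrite /zt /cz /cy !(ent_out _ _ h) r20 mul0r subrr.
  have [k Nk e] : exists2 k, N1 k & v = u *m k.
    apply/(coset_crit H1 hm c1 c2 c3 uU vU); rewrite ea eb ez; split.
    - by rewrite (nvBC H1) lr1.
    - by rewrite (nvBC H1) lr2.
    - have -> : zt u - cz u - cy u * (r1 (cx u) - cx u) =
          (cy u - r2 (cy u)) * (cx u - r1 (cx u)).
        rewrite /zt mulrBl -[X in _ - _ - _ * X]opprB mulrN opprK.
        by rewrite [cz u - _]addrC addrK addrC.
      by apply: (prod_le3 H1 c123); [exact: lr2|exact: lr1].
  exists k => //; rewrite -e /matched ea eb ez; have [-> -> ->] := fc u uU; split.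
  - by rewrite (tiso_rep H1 H2 c10 T1).
  - by rewrite (tiso_rep H1 H2 c20 T2).
  - have := tiso_max H2 c30 (Tf u uU) (Azt u uU) (in0 H1).
    by rewrite (tiso0 (Tf u uU)) !subr0 => ->.
  (* The isometry used for z sends [r2 y * r1 x] to within [c3] of the product of the images, so
     distances to that product are preserved above [c3]. *)
  - rewrite (nvBC H1) (nvBC H2).
    have rr2 := rep_id H1 c20 Ay; have rr1 := rep_id H1 c10 Ax.
    have Ap : A1 (r2 (cy u) * r1 (cx u)) by apply: (valdiv_inM H1); [exact: Ar2|exact: Ar1].
    rewrite -(tiso_max H2 c30 (Tf u uU) (Azt u uU) Ap).
    have := Lps _ _ (Ar2 _ Ay) (Ar1 _ Ax); rewrite /r1 /r2 rr1 rr2 => l.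
    rewrite -[in LHS](nvD_max H2 _ l); congr (Num.max _ (nv2 _)).
    by rewrite addrA subrK.
Qed.
End CosetMap.

Section LeftCosets.
Context (D : unitRingType) (m : nat) (N : set 'M[D]_m).
Hypothesis N1 : N 1%:M.
Hypothesis NM : forall k k', N k -> N k' -> N (k *m k').
Hypothesis NV : forall k, N k -> exists2 k', N k' & k *m k' = 1%:M.
Local Notation "u ~* N" := [set u *m k | k in N] (at level 40).

Lemma left_coset_eqP (u u' : 'M[D]_m) :
  u ~* N = u' ~* N <-> exists2 k, N k & u' = u *m k.
Proof.
split=> [e|[k Nk ->]].
  have : (u' ~* N) u' by exists 1%:M; rewrite ?mulmx1.
  by rewrite -e => -[k Nk <-]; exists k.
apply/seteqP; split=> [_ [l Nl <-]|_ [l Nl <-]].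
  have [k' Nk' kk'] := NV Nk; exists (k' *m l); first exact: NM.
  by rewrite -!mulmxA [k *m _]mulmxA kk' mul1mx.
by exists (k *m l); [exact: NM|rewrite mulmxA].
Qed.

Lemma xget_left_coset (u : 'M[D]_m) :
  exists2 k, N k & xget 1%:M (u ~* N) = u *m k.
Proof.
have := @xgetPex _ 1%:M (u ~* N); case.
  by exists u; exists 1%:M; rewrite ?mulmx1.
by move=> k Nk <-; exists k.
Qed.
End LeftCosets.

(* No finiteness is assumed: [fset_set] sends all infinite sets to the empty one. *)
Lemma card_fset_set_bij (T : choiceType) (T' : pointedType) (X : set T) (Y : set T') (h : T -> T') :
  set_bij X Y h -> #|` fset_set X|%N = #|` fset_set Y|%N.
Proof.
move=> hb; have XY : (X #= Y)%card by apply/card_set_bijP; exists h.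
have [fX|nX] := pselect (finite_set X).
  have fY : finite_set Y by rewrite -(eq_finite_set XY).
  by apply/fcard_eq.
have nY : ~ finite_set Y by rewrite -(eq_finite_set XY).
by rewrite /fset_set; case: pselect => //; case: pselect.
Qed.

Section CosetBijection.
Context (R : realType) (D : unitRingType) (A1 A2 : set D) (nv1 nv2 : D -> R)
  (w1 w2 : D) (rho : R) (m : nat).
Hypothesis H1 : valdiv A1 nv1 w1 rho.
Hypothesis H2 : valdiv A2 nv2 w2 rho.
Hypothesis hm : (0 < m <= 3)%N.
Hypothesis iso : exists phi, trunc_isometry A1 A2 nv1 nv2 1 phi.
Local Notation U1 := (lower_unip m A1).
Local Notation U2 := (lower_unip m A2).

(** [V1] and [V2] will be the whole unipotent groups for orbital sums and larger subgroups for
    indices. The last clause mentions [xget] because orbital sums are evaluated there; such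
    representatives are matched only up to right factors in [N1] and [N2]. *)
Lemma coset_bijection (k1 k2 k3 : int) (V1 V2 : set 'M[D]_m) :
  (k3 <= k2 + k1) ->
  let c1 := rho ^ k1 in let c2 := rho ^ k2 in let c3 := rho ^ k3 in
  let N1 := subU A1 nv1 (m := m) c1 c2 c3 in
  let N2 := subU A2 nv2 (m := m) c1 c2 c3 in
  V1 `<=` U1 -> V2 `<=` U2 ->
  (forall u k, U1 u -> N1 k -> V1 (u *m k) <-> V1 u) ->
  (forall u k, U2 u -> N2 k -> V2 (u *m k) <-> V2 u) ->
  (forall u u', U1 u -> U2 u' -> matched nv1 nv2 c3 u u' -> V1 u <-> V2 u') ->
  exists h : set 'M[D]_m -> set 'M[D]_m,
    set_bij (left_cosets V1 N1) (left_cosets V2 N2) h /\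
    forall c, left_cosets V1 N1 c -> exists u u',
      [/\ U1 u, U2 u', matched nv1 nv2 c3 u u',
        exists2 k, N1 k & xget 1%:M c = u *m k &
        exists2 k, N2 k & xget 1%:M (h c) = u' *m k].
Proof.
move=> k123 c1 c2 c3 N1 N2 VU1 VU2 VN1 VN2 VV.
have [c10 c20 c30] : [/\ 0 <= c1, 0 <= c2 & 0 <= c3] by split; exact: rhoX_ge0 H1 _.
have c123 : c2 * c1 <= c3.
  by rewrite /c1 /c2 -expfzDr ?gt_eqF ?(rho_gt0 H1)// (ler_rhoXz H1).
have [f [fU fE fS fM]] := coset_map H1 H2 hm iso k123.
have N11 : N1 1%:M by exact: (subU1 H1 hm).
have N21 : N2 1%:M by exact: (subU1 H2 hm).
have NM1 k k' : N1 k -> N1 k' -> N1 (k *m k') by exact: (subU_mul H1 hm).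
have NM2 k k' : N2 k -> N2 k' -> N2 (k *m k') by exact: (subU_mul H2 hm).
have NV1 k : N1 k -> exists2 k', N1 k' & k *m k' = 1%:M by exact: (subU_inv H1 hm).
have NV2 k : N2 k -> exists2 k', N2 k' & k *m k' = 1%:M by exact: (subU_inv H2 hm).
have e1 := left_coset_eqP N11 NM1 NV1.
have e2 := left_coset_eqP N21 NM2 NV2.
have UM1 u k : U1 u -> N1 k -> U1 (u *m k) by move=> uU [kU _]; case: (UM H1 hm uU kU).
have fV u : U1 u -> V1 u <-> V2 (f u).
  move=> uU; have [k Nk mk] := fM u uU.
  by rewrite -(VN1 u k uU Nk); apply: VV => //; [exact: UM1|exact: fU].
have gP c : left_cosets V1 N1 c -> [/\ V1 (xget 1%:M c), U1 (xget 1%:M c) &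
    c = [set xget 1%:M c *m k | k in N1]].
  move=> [u Vu <-]; have [k Nk uk] := xget_left_coset N11 u.
  have Vk : V1 (xget 1%:M [set u *m k | k in N1]).
    by rewrite uk; apply/VN1 => //; exact: VU1.
  split=> //; first exact: VU1.
  by apply/e1; exists k.
exists (fun c => [set f (xget 1%:M c) *m k | k in N2]); split.
  split.
  - move=> c /gP[Vg Ug _]; exists (f (xget 1%:M c)) => //; exact/fV.
  - move=> c c' /set_mem/gP[Vg Ug cE] /set_mem/gP[Vg' Ug' cE'].
    move=> /e2/(fE _ _ Ug Ug')[k Nk e]; rewrite cE cE'; apply/e1.
    by exists k.
  - move=> _ [u' Vu' <-]; have [u uU [k Nk e]] := fS u' (VU2 _ Vu').
    have Vu : V1 u by apply/fV => //; rewrite -(VN2 _ k)// -?e//; exact: fU.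
    exists [set u *m k | k in N1]; first by exists u.
    have [k1' Nk1 uk] := xget_left_coset N11 u.
    have [k2' Nk2 ek2] := (fE _ _ uU (UM1 _ _ uU Nk1)).1 (ex_intro2 _ _ k1' Nk1 erefl).
    rewrite uk; apply/esym/e2.
    have [k3' Nk3 kk3] := NV2 _ Nk2.
    rewrite ek2 e; have [l Nl kl] := NV2 _ Nk.
    exists (l *m k2'); first exact: NM2.
    by rewrite -[f u *m k *m _]mulmxA [k *m _]mulmxA kl mul1mx.
move=> c /gP[Vg Ug cE]; have [k Nk mk] := fM _ Ug.
exists (xget 1%:M c *m k), (f (xget 1%:M c)); split=> //.
- exact: UM1.
- exact: fU.
- have [l Nl kl] := NV1 _ Nk; exists l => //.
  by rewrite -mulmxA kl mulmx1.
- exact: xget_left_coset.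
Qed.
End CosetBijection.

(** * Conjugation of unipotent subgroups by cocharacters *)

Section Conjugation.
Context (R : realType) (D : unitRingType) (A : set D) (nv : D -> R)
  (w : D) (rho : R) (m : nat).
Hypothesis H : valdiv A nv w rho.
Hypothesis hm : (0 < m <= 3)%N.
Local Notation U := (lower_unip m A).
Local Notation O := (valring A nv).

Lemma U_GL : U `&` GL m O = subU A nv 1 1 1.
Proof.
apply/seteqP; split=> u.
  move=> [uU [uO _]]; split=> //.
  have h i j : nv (ent u i j) <= 1.
    rewrite /ent; case: insub => [i'|]; last by rewrite (nv0 H).
    by case: insub => [j'|]; [case: (uO i' j')|rewrite (nv0 H)].
  by split; exact: h.
move=> [uU [ux uy uz]]; split=> //; rewrite (UL hm uU).
have [Ax Ay Az] : [/\ O (cx u), O (cy u) & O (cz u)].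
  by split; split=> //; exact: (ent_in H).
apply: (Lmx_GL hm) => //; try exact: (ON H).
- exact: (O0 H).
- exact: (O1 H).
- by apply: (OD H); [exact: (OM H)|exact: (ON H)].
Qed.

Definition entr (mu : 'rV[int]_m) (i : nat) : int :=
  if (insub i : option 'I_m) is Some i' then mu 0 i' else 0.

Lemma ent_conj mu (u : 'M[D]_m) i j :
  ent (cochar w mu *m u *m cochar w (- mu)) i j =
  w ^ entr mu i * ent u i j * w ^ (- entr mu j).
Proof.
rewrite /ent /entr; case: insub => [i'|]; last by rewrite mulr0 mul0r.
case: insub => [j'|]; last by rewrite mulr0 mul0r.
by rewrite (mul_cochar w) (cochar_mul w) mxE.
Qed.

Lemma nv_ent_conj mu (u : 'M[D]_m) i j :
  nv (ent (cochar w mu *m u *m cochar w (- mu)) i j) =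
  rho ^ (entr mu i - entr mu j) * nv (ent u i j).
Proof.
rewrite ent_conj !(valdivM H) !(nv_unifX H) expfzDr ?gt_eqF ?(rho_gt0 H)//.
by rewrite mulrAC.
Qed.

Lemma U_conj mu u : U u -> U (cochar w mu *m u *m cochar w (- mu)).
Proof.
move=> [uG ut u1]; split.
- by apply: (GLA_mul H); [apply: (GLA_mul H) => //|]; exact: (GLA_cochar H).
- apply/is_trig_mxP => i j ij; rewrite (mul_cochar w) (cochar_mul w).
  by rewrite (is_trig_mxP ut)// mulr0 mul0r.
- move=> i; rewrite (mul_cochar w) (cochar_mul w) u1 mulr1 mxE.
  by rewrite (unifXN H).
Qed.

Lemma conj_conj mu (u : 'M[D]_m) :
  cochar w mu *m (cochar w (- mu) *m u *m cochar w mu) *m cochar w (- mu) = u.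
Proof.
rewrite !mulmxA (cocharN H) mul1mx -mulmxA (cocharN H) mulmx1.
by [].
Qed.

Lemma conj_subU mu :
  [set cochar w mu *m u *m cochar w (- mu) | u in subU A nv 1 1 1] =
  subU A nv (rho ^ (entr mu 1 - entr mu 0)) (rho ^ (entr mu 2 - entr mu 1))
    (rho ^ (entr mu 2 - entr mu 0)).
Proof.
have e mu' u i j c : nv (ent u i j) <= c ->
    nv (ent (cochar w mu' *m u *m cochar w (- mu')) i j) <= rho ^ (entr mu' i - entr mu' j) * c.
  by move=> h; rewrite nv_ent_conj ler_wpM2l ?(rhoX_ge0 H).
have eN i : entr (- mu) i = - entr mu i.
  by rewrite /entr; case: insub => [i'|]; rewrite ?mxE ?oppr0.
apply/seteqP; split=> [_ [u [uU [ux uy uz]] <-]|u [uU [ux uy uz]]].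
  split; first exact: U_conj.
  by split; rewrite -[leRHS]mulr1; exact: e.
exists (cochar w (- mu) *m u *m cochar w mu); last exact: conj_conj.
have r i j : rho ^ (entr (- mu) i - entr (- mu) j) * rho ^ (entr mu i - entr mu j) = 1.
  rewrite -expfzDr ?gt_eqF ?(rho_gt0 H)// !eN.
  by rewrite (_ : _ + _ = 0)// ?expr0z//; lia.
split; first by rewrite -{2}[mu]opprK; exact: U_conj.
rewrite -{2 4 6}[mu]opprK; split.
- by rewrite -(r 1%N 0%N); exact: e.
- by rewrite -(r 2%N 1%N); exact: e.
- by rewrite -(r 2%N 0%N); exact: e.
Qed.

Lemma exists_rho_bound x : A x -> exists M : nat, nv x <= rho ^ (- M%:Z).
Proof.
move=> Ax; have [->|x0] := eqVneq x 0; first by exists 0%N; rewrite (nv0 H).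
have [k ->] := valdiv_discrete H Ax x0; exists `|k|%N.
by rewrite (ler_rhoXz H); lia.
Qed.

(** A strongly contracting cocharacter conjugates [u] into [K], and conjugation does not change
    [Delta]. *)
Lemma detlike_unip Delta u : detlike A nv w Delta -> U u -> Delta u = 1.
Proof.
move=> [DM DK _ _] uU.
have Ac i j : A (ent u i j) by exact: (ent_in H).
have [[[M1 h1] [M2 h2]] [M3 h3]] :=
  (exists_rho_bound (Ac 1%N 0%N), exists_rho_bound (Ac 2%N 1%N), exists_rho_bound (Ac 2%N 0%N)).
(* Entry (i, j) of the conjugate gains the factor [rho ^ ((i - j) * M)], and [M] is at least the
   pole order of each of the three entries. *)
pose M : int := (M1 + M2 + M3)%:Z.
pose xi : 'rV[int]_m := \row_i (i%:Z * M).
have exi i : (i < m)%N -> entr xi i = i%:Z * M.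
  by move=> im; rewrite /entr insubT mxE.
have small i j Mi : (i < 3)%N -> (j < i)%N -> (Mi <= M1 + M2 + M3)%N ->
    nv (ent u i j) <= rho ^ (- Mi%:Z) ->
    nv (ent (cochar w xi *m u *m cochar w (- xi)) i j) <= 1.
  move=> i3 ji MiM hMi; have [im|im] := ltnP i m; last by rewrite ent_out// (nv0 H).
  rewrite nv_ent_conj !exi ?(ltn_trans ji)//.
  apply: (@le_trans _ _ (rho ^ (i%:Z * M - j%:Z * M) * rho ^ (- Mi%:Z))).
    by rewrite ler_wpM2l ?(rhoX_ge0 H).
  rewrite -expfzDr ?gt_eqF ?(rho_gt0 H)// -[leRHS](expr0z rho) (ler_rhoXz H) /M.
  nia.
have : (U `&` GL m O) (cochar w xi *m u *m cochar w (- xi)).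
  rewrite U_GL; split; first exact: U_conj.
  by split; [apply: small h1|apply: small h2|apply: small h3]; lia.
move=> [_ /DK]; rewrite !DM mulrAC -DM (cocharN H).
have -> : Delta 1%:M = 1 by apply: DK; exact: (K1 H).
by rewrite mul1r.
Qed.

End Conjugation.

(** * Satake transforms *)

Section Comparison.
Context (R : realType) (D : unitRingType) (A1 A2 : set D) (nv1 nv2 : D -> R)
  (w1 w2 : D) (rho : R) (m : nat).
Hypothesis H1 : valdiv A1 nv1 w1 rho.
Hypothesis H2 : valdiv A2 nv2 w2 rho.
Hypothesis hm : (0 < m <= 3)%N.
Hypothesis iso : exists phi, trunc_isometry A1 A2 nv1 nv2 1 phi.
Local Notation U1 := (lower_unip m A1).
Local Notation U2 := (lower_unip m A2).
Local Notation K1 := (GL m (valring A1 nv1)).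
Local Notation K2 := (GL m (valring A2 nv2)).

Lemma coset_index_subU (k1 k2 k3 b1 b2 b3 : int) :
  k3 <= k2 + k1 -> b3 <= b2 + b1 -> b1 <= k1 -> b2 <= k2 -> b3 <= k3 ->
  coset_index (subU A1 nv1 (m := m) (rho ^ b1) (rho ^ b2) (rho ^ b3))
              (subU A1 nv1 (rho ^ k1) (rho ^ k2) (rho ^ k3)) =
  coset_index (subU A2 nv2 (m := m) (rho ^ b1) (rho ^ b2) (rho ^ b3))
              (subU A2 nv2 (rho ^ k1) (rho ^ k2) (rho ^ k3)).
Proof.
move=> k123 b123 bk1 bk2 bk3.
have VN (A : set D) nv w (H : valdiv A nv w rho) u k : lower_unip m A u ->
    subU A nv (rho ^ k1) (rho ^ k2) (rho ^ k3) k ->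
    subU A nv (rho ^ b1) (rho ^ b2) (rho ^ b3) (u *m k) <->
    subU A nv (rho ^ b1) (rho ^ b2) (rho ^ b3) u.
  move=> uU Nk.
  have c123 : rho ^ b2 * rho ^ b1 <= rho ^ b3.
    by rewrite -expfzDr ?gt_eqF ?(rho_gt0 H)// (ler_rhoXz H).
  have k123' : rho ^ k2 * rho ^ k1 <= rho ^ k3.
    by rewrite -expfzDr ?gt_eqF ?(rho_gt0 H)// (ler_rhoXz H).
  have NV l : subU A nv (m := m) (rho ^ k1) (rho ^ k2) (rho ^ k3) l ->
      subU A nv (rho ^ b1) (rho ^ b2) (rho ^ b3) l.
    by move=> [lU [lx ly lz]]; split=> //; split;
      [apply: le_trans lx _|apply: le_trans ly _|apply: le_trans lz _]; rewrite (ler_rhoXz H).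
  split=> [Vuk|Vu]; last by apply: (subU_mul H hm c123) => //; exact: NV.
  have [l Nl kl] := subU_inv H hm k123' Nk.
  rewrite -[u]mulmx1 -kl mulmxA; apply: (subU_mul H hm c123) => //; exact: NV.
have [|||||h [hbij _]] := @coset_bijection _ _ _ _ _ _ _ _ _ m H1 H2 hm iso k1 k2 k3
  (subU A1 nv1 (rho ^ b1) (rho ^ b2) (rho ^ b3))
  (subU A2 nv2 (rho ^ b1) (rho ^ b2) (rho ^ b3)) k123.
- by move=> u [].
- by move=> u [].
- by move=> u k uU Nk; exact: (VN _ _ _ H1).
- by move=> u k uU Nk; exact: (VN _ _ _ H2).
- move=> u u' uU u'U [ex ey ez _].
  (* Corner entries are matched only above [rho ^ k3]; the tested radius is no smaller, since
     [b3 <= k3] and [rho < 1]. *)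
  have e : (nv1 (cz u) <= rho ^ b3) = (nv2 (cz u') <= rho ^ b3).
    have := congr1 (fun z => z <= rho ^ b3) ez.
    by rewrite /= !ge_max (ler_rhoXz H1) bk3.
  split=> -[_ [hx hy hz]]; do 2 split=> //.
  - by rewrite -ex.
  - by rewrite -ey.
  - by rewrite -e.
  - by rewrite ex.
  - by rewrite ey.
  - by rewrite e.
exact: card_fset_set_bij hbij.
Qed.

Lemma subUI (A : set D) nv w (H : valdiv A nv w rho) (a1 a2 a3 b1 b2 b3 : int) :
  subU A nv (m := m) (rho ^ a1) (rho ^ a2) (rho ^ a3) `&`
    subU A nv (rho ^ b1) (rho ^ b2) (rho ^ b3) =
  subU A nv (rho ^ Num.max a1 b1) (rho ^ Num.max a2 b2) (rho ^ Num.max a3 b3).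
Proof.
have e (a b : int) x : (x <= rho ^ Num.max a b) = (x <= rho ^ a) && (x <= rho ^ b).
  have [ab|/ltW ab] := leP a b; apply/idP/andP => [h|[]//]; split=> //;
  by apply: le_trans h _; rewrite (ler_rhoXz H).
apply/seteqP; split=> u.
  by move=> [[uU [ux uy uz]] [_ [vx vy vz]]]; split=> //; rewrite !e; split; apply/andP.
by move=> [uU []]; rewrite !e => /andP[? ?] /andP[? ?] /andP[? ?].
Qed.

Lemma modulus_eq (mu : 'rV[int]_m) :
  modulus R A1 (valring A1 nv1) w1 mu = modulus R A2 (valring A2 nv2) w2 mu.
Proof.
rewrite /modulus /= (U_GL H1 hm) (U_GL H2 hm) !(conj_subU H1, conj_subU H2)//.
rewrite /gen_index -[1](expr0z rho) !(subUI H1, subUI H2).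
(* The conjugated radii have exponents [a1], [a2] and [a3 = a1 + a2]. The intersection has the
   exponents [max a 0], and these are subadditive as required. *)
by congr (_%:R / _%:R); apply: coset_index_subU; lia.
Qed.

Lemma matched_sym c (u u' : 'M[D]_m) : matched nv1 nv2 c u u' -> matched nv2 nv1 c u' u.
Proof. by move=> [ex ey ez ew]; split; apply: esym. Qed.
End Comparison.

Section Transfer.
Context (R : realType) (D : unitRingType) (m : nat) (rho : R).
Hypothesis hm : (0 < m <= 3)%N.

Lemma matched_double_coset (A1 A2 : set D) (nv1 nv2 : D -> R) (w1 w2 : D)
    (H1 : valdiv A1 nv1 w1 rho) (H2 : valdiv A2 nv2 w2 rho)
    (Delta1 Delta2 : 'M[D]_m -> R) (mu la : 'rV[int]_m) (u u' : 'M[D]_m) :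
  detlike A1 nv1 w1 Delta1 -> detlike A2 nv2 w2 Delta2 ->
  lower_unip m A1 u -> lower_unip m A2 u' -> matched nv1 nv2 1 u u' ->
  double_coset (GL m (valring A1 nv1)) (cochar w1 la) (cochar w1 mu *m u) ->
  double_coset (GL m (valring A2 nv2)) (cochar w2 la) (cochar w2 mu *m u').
Proof.
move=> De1 De2 uU u'U [ex ey ez ew].
have [uG _ u1] := uU; have [u'G _ u'1] := u'U.
pose h := Lmx m (- cx u) (- cy u) (cy u * cx u - cz u).
pose h' := Lmx m (- cx u') (- cy u') (cy u' * cx u' - cz u').
apply: (@double_coset_transfer _ _ _ _ _ _ _ _ _ _ H1 H2 m Delta1 Delta2 mu la u h u' h') => //.
- exact: (detlike_unip H1 hm De1).
- exact: (detlike_unip H2 hm De2).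
- by rewrite {1}(UL hm uU) (LmxV hm).
- by rewrite {1}(UL hm uU) (LmxVl hm).
- by rewrite {1}(UL hm u'U) (LmxV hm).
- by rewrite {1}(UL hm u'U) (LmxVl hm).
- exact: Lmx_diag.
- exact: Lmx_diag.
- move=> i j; rewrite (UL hm uU) (UL hm u'U) !mxE.
  by do ?(case: ifP => _); rewrite ?(nv0 H1) ?(nv0 H2) ?(nv_one H1) ?(nv_one H2) ?ex ?ey.
- move=> i j; rewrite !mxE.
  by do ?(case: ifP => _); rewrite ?(nvN H1) ?(nvN H2) ?(nv0 H1) ?(nv0 H2)
    ?(nv_one H1) ?(nv_one H2) ?ex ?ey.
Qed.

Context (A1 A2 : set D) (nv1 nv2 : D -> R) (w1 w2 : D).
Hypothesis H1 : valdiv A1 nv1 w1 rho.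
Hypothesis H2 : valdiv A2 nv2 w2 rho.
Hypothesis iso : exists phi, trunc_isometry A1 A2 nv1 nv2 1 phi.
Variables (Delta1 Delta2 : 'M[D]_m -> R).
Hypothesis De1 : detlike A1 nv1 w1 Delta1.
Hypothesis De2 : detlike A2 nv2 w2 Delta2.
Variable la : 'rV[int]_m.
Local Notation K1 := (GL m (valring A1 nv1)).
Local Notation K2 := (GL m (valring A2 nv2)).

Lemma double_coset_mulr (A : set D) nv w (H : valdiv A nv w rho) t g k :
  GL m (valring A nv) k ->
  double_coset (GL m (valring A nv)) t (g *m k) <-> double_coset (GL m (valring A nv)) t g.
Proof.
move=> kK; split=> -[l lK [l' l'K e]]; exists l => //.
  have [k' [k'K kk' _]] := K_inv kK; exists (l' *m k'); first exact: (KM H).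
  by rewrite mulmxA -e -mulmxA kk' mulmx1.
by exists (l' *m k); [exact: (KM H)|rewrite e !mulmxA].
Qed.

Lemma orbital_sum_eq (mu : 'rV[int]_m) :
  orbital_sum A1 (valring A1 nv1) (\1_(double_coset K1 (cochar w1 la)) : _ -> R[i]) (cochar w1 mu) =
  orbital_sum A2 (valring A2 nv2) (\1_(double_coset K2 (cochar w2 la)) : _ -> R[i]) (cochar w2 mu).
Proof.
rewrite /orbital_sum /= (U_GL H1 hm) (U_GL H2 hm) -[X in subU A1 nv1 X X X](expr0z rho)
  -[X in subU A2 nv2 X X X](expr0z rho).
have VN (A : set D) nv w (H : valdiv A nv w rho) u k : lower_unip m A u ->
    subU A nv (rho ^ 0) (rho ^ 0) (rho ^ 0) k -> lower_unip m A (u *m k) <-> lower_unip m A u.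
  by move=> uU [kU _]; split=> // _; have [] := UM H hm uU kU.
have [|||||h [hbij hP]] := @coset_bijection _ _ _ _ _ _ _ _ _ m H1 H2 hm iso 0 0 0
  (lower_unip m A1) (lower_unip m A2) (lexx _) => //.
- by move=> u k uU Nk; exact: (VN _ _ _ H1).
- by move=> u k uU Nk; exact: (VN _ _ _ H2).
rewrite [RHS](reindex_fsbig h _ _ _ hbij); apply: eq_fsbigr => c /set_mem/hP.
move=> [u [u' [uU u'U mt [k Nk ->] [k' Nk' ->]]]].
have NK (A : set D) nv w (H : valdiv A nv w rho) l :
    subU A nv (rho ^ 0) (rho ^ 0) (rho ^ 0) l -> GL m (valring A nv) l.
  by rewrite expr0z -(U_GL H hm) => -[].
rewrite !indicE !mulmxA; congr (nat_of_bool _)%:R; apply/idP/idP => /set_mem dc; apply/mem_set.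
  apply/(double_coset_mulr H2 _ _ (NK _ _ _ H2 _ Nk')).
  apply: (matched_double_coset H1 H2 De1 De2 uU u'U mt).
  by apply/(double_coset_mulr H1 _ _ (NK _ _ _ H1 _ Nk)).
apply/(double_coset_mulr H1 _ _ (NK _ _ _ H1 _ Nk)).
apply: (matched_double_coset H2 H1 De2 De1 u'U uU (matched_sym mt)).
by apply/(double_coset_mulr H2 _ _ (NK _ _ _ H2 _ Nk')).
Qed.

Theorem satake_eq :
  satake A1 (valring A1 nv1) w1 (\1_(double_coset K1 (cochar w1 la)) : _ -> R[i]) =
  satake A2 (valring A2 nv2) w2 (\1_(double_coset K2 (cochar w2 la)) : _ -> R[i]).
Proof.
apply: eq_fsbigr => mu _.
by rewrite (modulus_eq H1 H2 hm iso) orbital_sum_eq.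
Qed.
End Transfer.

(** * The determinant over the base field *)

Section BlockDeterminant.
Context (R : realType) (F : fieldType) (v : nonarch_absval R F) (D : falgType F).
Hypothesis hF : local_field v.
Hypothesis hD : forall x : D, x != 0 -> x \is a GRing.unit.
Variable m : nat.
Hypothesis m0 : (0 < m)%N.
Local Notation N := (@bnorm R F v D).
Local Notation n := (dim D).

Definition blockmx (g : 'M[D]_m) : 'M[F]_(\sum_(i < m) n) :=
  \mxblock_(i < m, j < m) rmulmx (g i j).

Definition bdet (g : 'M[D]_m) : R := v (\det (blockmx g)).

Lemma blockmxM g h : blockmx (g *m h) = blockmx g *m blockmx h.
Proof.
rewrite /blockmx mul_mxblock; apply: eq_mxblock => i k.
rewrite mxE (big_morph _ (@rmulmxD F D) (@rmulmx0 F D)); apply: eq_bigr => j _.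
by rewrite rmulmxM.
Qed.

Lemma bdetM g h : bdet (g *m h) = bdet g * bdet h.
Proof. by rewrite /bdet blockmxM det_mulmx absvalM. Qed.

Lemma bdet_scalar (c : F) : bdet (c%:A)%:M = v c ^+ (\sum_(i < m) n).
Proof.
rewrite /bdet (_ : blockmx _ = c%:M) ?det_scalar ?absvalX//.
rewrite -mxdiagZ; apply: eq_mxblock => i j.
rewrite mxE; have [_|_] := eqVneq i j; last by rewrite mulr0n rmulmx0.
by rewrite mulr1n rmulmx_alg conform_mx_id.
Qed.

Lemma bdet1 : bdet 1%:M = 1.
Proof. by rewrite -[1]scale1r bdet_scalar absval1 expr1n. Qed.

Lemma bounded_powers_le1 (a C : R) : 0 <= a -> (forall j, a ^+ j <= C) -> a <= 1.
Proof.
move=> a0 h; rewrite leNgt; apply/negP => a1.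
have C0 : 0 < C by apply: lt_le_trans (h 0%N); rewrite expr0.
have a00 : 0 < a by apply: lt_trans a1.
have := @cvg_expr R a^-1; rewrite ger0_norm ?invr_ge0// invf_lt1// => /(_ a1).
have C10 : 0 < C^-1 by rewrite invr_gt0.
move=> /cvgr0Pnorm_lt /(_ _ C10) [k _ /(_ k)] /= /(_ (leqnn k)).
rewrite ger0_norm ?exprn_ge0 ?invr_ge0// exprVn ltf_pV2 ?posrE ?exprn_gt0//.
by rewrite ltNge h.
Qed.

(** Integral elements need not preserve the lattice of the chosen basis, so coordinates give only
    some bound. As all powers of an integral matrix obey this bound, its [bdet] is at most 1; for
    [k] the same holds for the inverse. *)
Lemma bdet_integral (k : 'M[D]_m) : GL m [set x | N x <= 1] k -> bdet k = 1.
Proof.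
have [C C1 hC] := bnorm_coord_bounded hF hD; have [B B1 hB] := rmulmx_bounded v D.
have bnd (g : 'M[D]_m) : (forall i j, N (g i j) <= 1) -> bdet g <= (C * B) ^+ (\sum_(i < m) n).
  move=> hg; apply: absval_det_le => s t; rewrite mxE.
  by apply: hB => l; apply: hC.
have le1 (g : 'M[D]_m) : (forall i j, N (g i j) <= 1) -> bdet g <= 1.
  move=> hg; apply: (@bounded_powers_le1 _ ((C * B) ^+ (\sum_(i < m) n))).
    exact: absval_ge0.
  move=> j; pose gj := iter j (mulmx g) 1%:M.
  have [<- hgj] : bdet gj = bdet g ^+ j /\ forall i l, N (gj i l) <= 1; last exact: bnd.
  rewrite /gj; elim: j {gj} => [|j [IH1 IH2]] /=.
    by rewrite bdet1 expr0; split=> // i l; rewrite mxE; case: (_ == _); rewrite ?bnorm1 ?bnorm0.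
  rewrite bdetM IH1 exprS; split=> // i l; rewrite mxE.
  apply: (bnorm_sum_le hF hD) => // q _.
  by rewrite bnormM mulr_ile1 ?bnorm_ge0.
move=> [kO [h [hO kh hk]]]; apply/eqP; rewrite eq_le le1//=.
have := bdetM k h; rewrite kh bdet1 => ->.
by rewrite ler_piMr ?absval_ge0// le1.
Qed.

(** This is applied to [D] with its degree [d], and to [E] with exponent 1, where the uniformizer is
    already a scalar. In both cases a power of [w] is the scalar [t], whose [bdet] is a positive
    power of [v t < 1]. *)
Lemma bdet_detlike (A : set D) (nv : D -> R) (w : D) (t : F) (d : nat) :
  (forall x, nv x <= 1 -> N x <= 1) -> w ^+ d = t%:A -> t != 0 -> v t < 1 ->
  detlike A nv w bdet.
Proof.
move=> hnv wd t0 vt1; split.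
- exact: bdetM.
- move=> k [kO [h [hO kh hk]]]; apply: bdet_integral; split=> [i j|].
    by apply: hnv; case: (kO i j).
  by exists h; split=> // i j; apply: hnv; case: (hO i j).
- by move=> g; exact: absval_ge0.
- apply/eqP => e.
  have hw k : bdet (w ^+ k)%:M = 1.
    elim: k => [|k IH]; first by rewrite expr0 bdet1.
    by rewrite exprS scalar_mxM bdetM e IH mulr1.
  have := hw d; rewrite wd bdet_scalar => /eqP.
  rewrite pexpr_eq1 ?absval_ge0//.
    by move=> /eqP h; rewrite h ltxx in vt1.
  by rewrite sum_nat_const card_ord muln_gt0 m0 dim_falg_gt0.
Qed.

End BlockDeterminant.

Theorem proposition0p2p7
  (R : realType) (F : fieldType) (v : nonarch_absval R F) (p : nat)
  (hF : local_field v) (hp : residue_char v p)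
  (D : falgType F) (d : nat)
  (hD : central_division_algebra D) (hd : \dim {:D} = (d ^ 2)%N)
  (E : {aspace D})
  (hE : maximal_commutative E) (hEd : \dim E = d) (hEur : unramified v E)
  (varpi_D : D) (varpi_F : F)
  (hvarpi_D : uniformizer (integers v {:D}) varpi_D)
  (hvarpi : varpi_D ^+ d = varpi_F%:A)
  (hvarpi_F : uniformizer (base_integers v) varpi_F)
  (m : nat) (hm : (1 <= m <= 3)%N) (lambda : 'rV[int]_m) :
  let K := GL m (integers v {:D}) in
  let t_lambda := cochar varpi_D lambda in
  let K_E := GL m (integers v E) in
  let s_lambda := cochar (varpi_F%:A : D) lambda in
  satake [set: D] (integers v {:D}) varpi_D \1_(double_coset K t_lambda) =
  satake [set` E] (integers v E) (varpi_F%:A : D)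
    \1_(double_coset K_E s_lambda) :> malg 'rV[int]_m R[i].
Proof.
move=> K tl KE sl.
have [hU _] := hD; pose N := @bnorm R F v D.
have m0 : (0 < m)%N by case/andP: hm.
have d0 : (0 < d)%N by rewrite -hEd adim_gt0.
(* A nonzero element of absolute value below 1 is a non-unit of the valuation ring, hence a multiple
   of [varpi_F]. *)
have t0 : varpi_F != 0.
  have [t t0 t1] := exists_absval_lt1 hF.
  have : [set varpi_F * y | y in base_integers v] t.
    rewrite -hvarpi_F; split; first exact: ltW.
    move=> [y y1 [ty _]].
    have := absvalM v t y; rewrite ty absval1 => e.
    have : v t * v y < 1 by apply: le_lt_trans t1; rewrite ler_piMr ?absval_ge0.
    by rewrite -e ltxx.
  by move=> [y _ e]; apply: contra_neq t0 => e0; rewrite -e e0 mul0r.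
have tA0 : (varpi_F%:A : D) != 0 by rewrite scaler_eq0 oner_eq0 orbF.
have w0 : varpi_D != 0 by apply: contra_neq tA0 => e; rewrite -hvarpi e expr0n gtn_eqF.
have [tE t1 hEsmall] := uniformizer_bnorm hF hU (hEur _ hvarpi_F).
have [wD w1 hDsmall] := @uniformizer_bnorm R F v D hF hU {:D}%AS _ hvarpi_D.
have discE := bnorm_discrete hU tE tA0 t1 hEsmall.
have discD := bnorm_discrete hU wD w0 w1 hDsmall.
have vt1 : v varpi_F < 1.
  rewrite ltNge; apply/negP => h; move: t1; rewrite bnorm_alg ltNge.
  by rewrite exprn_ege1.
have rho01 : 0 < N varpi_F%:A < 1 by rewrite (bnorm_gt0 v hU) tA0.
have Nwd : N varpi_D ^+ d = N varpi_F%:A by rewrite /N -hvarpi bnormX.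
have H2 : valdiv [set` E] N (varpi_F%:A : D) (N varpi_F%:A).
  split=> //.
  - exact: bnorm_ge0.
  - exact: (bnorm_eq0 v hU).
  - exact: bnormM.
  - exact: bnormD.
  - by rewrite /= -(divrr (hU _ tA0)) memvM// memvV.
  - by move=> x y /= xE yE; rewrite memvB.
  - by move=> x y /= xE yE; rewrite memvM.
  - by move=> x /= xE; rewrite memvV.
have H1 : valdiv [set: D] (fun x => N x ^+ d) varpi_D (N varpi_F%:A).
  split=> //.
  - by move=> x; rewrite exprn_ge0 ?bnorm_ge0.
  - by move=> x; rewrite expf_eq0 d0 (bnorm_eq0 v hU).
  - by move=> x y; rewrite /N bnormM exprMn.
  - move=> x y; have := bnormD hF hU x y; rewrite !le_max => /orP[h|h]; apply/orP; [left|right];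
    by rewrite lerXn2r ?nnegrE ?bnorm_ge0.
  - move=> x _ x0; have [k e] := discD x (memvf x) x0; exists k.
    by rewrite -Nwd /N e !exprnP !exprz_exp mulrC.
have O1 : integers v {:D} = valring [set: D] (fun x => N x ^+ d).
  apply/predeqP => x; rewrite (integersP hF hU) memvf /valring /= expr_le1 ?bnorm_ge0//.
  by split=> -[_ ?]; split.
have O2 : integers v E = valring [set` E] N.
  by apply/predeqP => x; rewrite (integersP hF hU).
have iso : exists phi, trunc_isometry [set: D] [set` E] (fun x => N x ^+ d) N 1 phi.
  (* Equality of the residue fields allows the digits of elements of [D] to be chosen in [E]. *)
  apply: (exists_expansion H1 H2 _ d0) => // x _; rewrite expr_le1 ?bnorm_ge0// => x1.
  have [|s [sE s1 xs]] := residue_surjective hF hU d0 hEd hd hvarpi _ discE x1.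
    by rewrite (bnorm_gt0 v hU) w0.
  by exists s; split=> //; rewrite expr_lt1 ?bnorm_ge0.
rewrite /K /tl /KE /sl O1 O2.
apply: (satake_eq hm H1 H2 iso (Delta1 := bdet v (m := m)) (Delta2 := bdet v (m := m))).
  apply: (bdet_detlike hF hU m0 _ _ hvarpi) => //.
  by move=> x; rewrite expr_le1 ?bnorm_ge0.
by apply: (bdet_detlike hF hU m0 _ _ (expr1 _)).
Qed.
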